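(* Let $\Sigma$ be a closed, compact $(m-1)$-dimensional manifold, let $F:\Sigma\times(-\infty,0)\to\mathbf{R}^n$ be a smooth one-parameter family of embeddings of $\Sigma$, and let $\Gamma(t)=F(\Sigma,t)$. Suppose $t\in(-\infty,0)\mapsto M(t)$ is an $m$-dimensional Brakke flow in $\mathbf{R}^n$ with boundary $\Gamma(\cdot)$. For $t<0$ let $$\tilde M(t)=\frac{M(t)}{|t|^{1/2}},\qquad \tilde\Gamma(t)=\frac{\Gamma(t)}{|t|^{1/2}},\qquad \tilde F(x,t)=\frac{F(x,t)}{|t|^{1/2}},$$ and for each $T<0$ let $N(T)$ be the surface swept out by $\tilde\Gamma(t)$ from $t=T$ to $0$: $$N(T)=\bigcup_{T\le t<0}\tilde\Gamma(t)=\tilde F(\Sigma\times[T,0)).$$ Then $$\Phi_m[\tilde M(t)]+\Phi_m[N(t)]$$ is a decreasing (i.e. nonincreasing) function of $t\in(-\infty,0)$.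
   Context: $\Phi_m(x)=(4\pi)^{-m/2}\exp(-|x|^2/4)$. For an $m$-dimensional surface $S$, $\Phi_m[S]=\int_S\Phi_m\,d\mathcal{H}^m$. For the swept-out surface $N(T)$ the $\Phi$-area is counted with multiplicity, i.e. it is the $\Phi$-area of the map $\tilde F|_{\Sigma\times[T,0)}$: $$\Phi_m[N(T)]=\Phi_m\bigl[\tilde F|_{\Sigma\times[T,0)}\bigr]=\int_T^0\int_\Sigma\left|\left(\tfrac{\partial\tilde F}{\partial t}\right)^\perp\right|\Phi_m(\tilde F(x,t))\,d\tilde\mu_t(x)\,dt,$$ where $\tilde\mu_t$ is the measure on $\Sigma$ corresponding to $\mathcal{H}^{m-1}$ on $\tilde F(\Sigma,t)$ and $(\cdot)^\perp$ is the component perpendicular to $\tilde F(\Sigma,t)$. For a Brakke flow, $\Phi_m[\tilde M(t)]=\int (4\pi|t|)^{-m/2}\exp(-|x|^2/(4|t|))\,dM(t)(x)$. Values in $[0,\infty]$ are allowed. For $q=F(x,t)\in\Gamma(t)$, $\dot\Gamma(q,t)$ denotes the normal velocity $(\partial F/\partial t(x,t))^\perp$, the component perpendicular to $\operatorname{Tan}(\Gamma(t),q)$. An $m$-dimensional Brakke flow with boundary $\Gamma(\cdot)$ on a time interval $I$ is a family $t\in I\mapsto M(t)$ of Radon measures on $\mathbf{R}^n$ such that: (i) for almost every $t$, $M(t)$ is the weight measure of an integral $m$-varifold, and there are a locally integrable vector field $H=H(\cdot,t)$ that is $M(t)$-a.e. perpendicular to the approximate tangent plane, and a Borel vector field $\nu_M=\nu_M(\cdot,t)$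 on $\Gamma(t)$, with $|\nu_M|\le1$ and $\nu_M$ perpendicular to $\Gamma(t)$, such that $\int \operatorname{Div}_{M(t)}X\,dM(t)=-\int H\cdot X\,dM(t)+\int_{\Gamma(t)}\nu_M\cdot X\,d\mathcal{H}^{m-1}$ for every compactly supported $C^1$ vector field $X$; (ii) $\int_a^b\int_K(1+|H|^2)\,dM(t)\,dt<\infty$ for every compact $K\subset\mathbf{R}^n$ and $[a,b]\subset I$; (iii) for every $[a,b]\subset I$ and every nonnegative compactly supported $C^2$ function $u$ on $\mathbf{R}^n\times[a,b]$, $$\int u(\cdot,b)\,dM(b)-\int u(\cdot,a)\,dM(a)\le\int_a^b\int\left(-u|H|^2+H\cdot\nabla u+\frac{\partial u}{\partial t}\right)dM(t)\,dt+\int_a^b\int_{\Gamma(t)}u\,\nu_M\cdot\dot\Gamma\,d\mathcal{H}^{m-1}\,dt.$$ This includes smooth one-parameter families of compact $m$-manifolds-with-boundary $M(t)$ with $\partial M(t)=\Gamma(t)$ whose normal velocity equals the mean curvature vector (then $\nu_M$ is the outward unit conormal). *)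

(* Defs.v *)
From HB Require Import structures.
From mathcomp Require Import all_boot all_order all_algebra.
From mathcomp Require Import all_classical all_reals all_analysis measurable_realfun.
Import Order.TTheory GRing.Theory Num.Theory.
Import numFieldNormedType.Exports.

Set Implicit Arguments.
Unset Strict Implicit.
Unset Printing Implicit Defensive.

Local Open Scope classical_set_scope.
Local Open Scope ring_scope.

(* R^n is 'rV[R]_n.  The library norm on 'rV[R]_n is
   the sup norm: it is used only through its topology, and all metric notions
   below go through [dot] and [enorm]. *)

Notation borelRn R n := (g_sigma_algebraType (@open 'rV[R]_n)).

Section Euclidean.
Context {R : realType} {n : nat}.
Implicit Types x y : 'rV[R]_n.

Definition dot x y : R := \sum_(i < n) x 0 i * y 0 i.

Definition enorm x : R := Num.sqrt (dot x x).

Definition gradient (f : 'rV[R]_n -> R) x : 'rV[R]_n :=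
  \row_i 'D_(delta_mx 0 i) f x.

Definition compactly_supported (V : zmodType) (f : 'rV[R]_n -> V) :=
  exists2 K : set 'rV[R]_n, compact K & forall x, ~ K x -> f x = 0.

(* The component of v orthogonal to a linear subspace V (given as a set). *)
Definition perp_part (V : set 'rV[R]_n) (v : 'rV[R]_n) : 'rV[R]_n :=
  xget 0 [set w | V (v - w) /\ forall z, V z -> dot w z = 0].

End Euclidean.

(* f is C^j on the open set U; V is meant to be finite dimensional. *)
Fixpoint Ck {R : realType} {V W : normedModType R} (j : nat)
    (U : set V) (f : V -> W) : Prop :=
  if j is j'.+1 then
    (forall x, U x -> differentiable f x) /\
    (forall v : V, Ck j' U (fun x => 'D_v f x))
  else forall x, U x -> {for x, continuous f}.

Definition smooth_on {R : realType} {V W : normedModType R}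
  (U : set V) (f : V -> W) : Prop := forall j, Ck j U f.

Section Hausdorff.
Context {R : realType} {n : nat}.
Implicit Types (A C : set 'rV[R]_n) (k : nat).

(* Volume of the unit ball of R^k, from omega_(k+2) = 2 pi omega_k / (k+2). *)
Fixpoint ball_volume (k : nat) : R :=
  match k with
  | 0 => 1
  | 1 => 2
  | k'.+2 => 2 * pi / k'.+2%:R * ball_volume k'
  end.

Definition diam C : R := sup [set enorm (p.1 - p.2) | p in C `*` C].

Definition hausdorff_size k C : \bar R :=
  if C == set0 then 0%E else (ball_volume k * (diam C / 2) ^+ k)%:E.

Definition hausdorff_delta k (delta : R) A : \bar R :=
  ereal_inf [set (\sum_(0 <= i <oo) hausdorff_size k (C i))%E |
    C in [set C : nat -> set 'rV[R]_n | A `<=` \bigcup_i C i /\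
      forall i x y, C i x -> C i y -> enorm (x - y) <= delta]].

Definition hausdorff k A : \bar R :=
  ereal_sup [set hausdorff_delta k delta A | delta in [set d : R | 0 < d]].

(* [hausdorff k] is an outer measure.  The library integral takes an arbitrary
   set function as measure and evaluates it only at measurable sets, so that
   \int[hausdorffB k] is integration against the restriction of [hausdorff k]
   to Borel sets. *)
Definition hausdorffB k : set (borelRn R n) -> \bar R := hausdorff k.

End Hausdorff.

(* [cmap] is meaningful on [cdom], and [cinv] on the image of [cdom]. *)
Record chart (R : realType) (k : nat) (S : Type) := Chart {
  cdom : set S ;
  cmap : S -> 'rV[R]_k ;
  cinv : 'rV[R]_k -> S
}.

Section Manifold.
Context {R : realType}.

Definition cimg k S (c : chart R k S) : set 'rV[R]_k := cmap c @` cdom c.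

Definition is_chart k (S : topologicalType) (c : chart R k S) : Prop :=
  [/\ open (cdom c), open (cimg c),
      forall x, cdom c x -> cinv c (cmap c x) = x,
      forall x, cdom c x -> {for x, continuous (cmap c)} &
      forall y, cimg c y -> {for y, continuous (cinv c)}].

Definition smooth_atlas k (S : topologicalType) (A : set (chart R k S)) : Prop :=
  [/\ forall c, A c -> is_chart c,
      forall x, exists2 c, A c & cdom c x &
      forall c c', A c -> A c' ->
        smooth_on (cmap c @` (cdom c `&` cdom c')) (cmap c' \o cinv c)].

(* Compact k-manifold without boundary (second countability is automatic).
   S may be empty, and need not be connected. *)
Definition closed_manifold k (S : topologicalType) (A : set (chart R k S)) :=
  [/\ compact [set: S], hausdorff_space S & smooth_atlas A].

Definition topological_embedding (S T : topologicalType) (f : S -> T) : Prop :=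
  injective f /\
  forall U : set S, open U <-> exists2 B : set T, open B & U = f @^-1` B.

Section Maps.
Context {k n : nat} {S : topologicalType} (A : set (chart R k S)).

(* The image of the differential of f at x. *)
Definition tangent_space (f : S -> 'rV[R]_n) (x : S) : set 'rV[R]_n :=
  [set w | exists c, [/\ A c, cdom c x &
     exists v, w = 'D_v (f \o cinv c) (cmap c x)]].

Definition immersion (f : S -> 'rV[R]_n) : Prop :=
  forall c x v, A c -> cdom c x -> 'D_v (f \o cinv c) (cmap c x) = 0 -> v = 0.

(* Smoothness is joint in (x, t); J is an open interval. *)
Definition smooth_family_of_embeddings (J : set R) (F : S -> R -> 'rV[R]_n) :=
  (forall c, A c ->
     smooth_on (cimg c `*` J) (fun p : 'rV[R]_k * R => F (cinv c p.1) p.2)) /\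
  (forall t, J t -> immersion (F^~ t) /\ topological_embedding (F^~ t)).

Definition moving_image (F : S -> R -> 'rV[R]_n) (t : R) : set 'rV[R]_n :=
  range (F^~ t).

(* For injective f, [transport f g] is g o f^-1 on the range of f. *)
Definition transport (V : zmodType) (f : S -> 'rV[R]_n) (g : S -> V)
    (q : 'rV[R]_n) : V :=
  xget 0 (g @` (f @^-1` [set q])).

(* The integral of g over S for the measure on S which corresponds, under the
   injective map f, to k-dimensional Hausdorff measure on f(S). *)
Definition integral_pullback (f : S -> 'rV[R]_n) (g : S -> R) : \bar R :=
  (\int[hausdorffB k]_(q in (range f : set (borelRn R n)))
     (transport f g q)%:E)%E.

Definition time_velocity_perp (F : S -> R -> 'rV[R]_n) (t : R) (x : S) :
    'rV[R]_n :=
  perp_part (tangent_space (F^~ t) x) (derive1 (F x) t).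

Definition normal_velocity (F : S -> R -> 'rV[R]_n) (t : R) (q : 'rV[R]_n) :
    'rV[R]_n :=
  transport (F^~ t) (time_velocity_perp F t) q.

End Maps.
End Manifold.

Section Varifold.
Context {R : realType} {n : nat}.
Implicit Types (m : nat) (M : {measure set (borelRn R n) -> \bar R}).

Definition radon M : Prop :=
  forall K : set 'rV[R]_n, compact K -> (M K < +oo)%E.

Definition lipschitz_map m (f : 'rV[R]_m -> 'rV[R]_n) : Prop :=
  exists L : R, forall x y, enorm (f x - f y) <= L * enorm (x - y).

Definition countably_rectifiable m (S : set 'rV[R]_n) : Prop :=
  exists2 f : nat -> 'rV[R]_m -> 'rV[R]_n, (forall j, lipschitz_map (f j)) &
    hausdorff m (S `\` \bigcup_j range (f j)) = 0%E.

Definition integral_varifold_weight m M : Prop :=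
  exists (S : set (borelRn R n)) (theta : borelRn R n -> nat),
    [/\ measurable S, countably_rectifiable m S, measurable_fun S theta,
        forall x, S x -> (0 < theta x)%N &
        forall B : set (borelRn R n), measurable B ->
          M B = (\int[hausdorffB m]_(x in B `&` S) (theta x)%:R%:E)%E].

(* The rows of E form an orthonormal basis of the approximate tangent plane of
   M at x: the rescalings of M about x converge weakly to a positive multiple
   of m-dimensional Hausdorff measure on the row space of E. *)
Definition is_tangent_frame m M (x : 'rV[R]_n) (E : 'M[R]_(m, n)) : Prop :=
  E *m E^T = 1%:M /\
  exists2 theta : R, 0 < theta &
    forall f : 'rV[R]_n -> R, continuous f -> compactly_supported f ->
      (fun l : R => (l ^- m)%:E * \int[M]_z (f (l^-1 *: (z - x)))%:E)%E @ 0^'+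
        --> (theta%:E * \int[hausdorffB m]_(y in
              ([set y | (y <= E)%MS] : set (borelRn R n))) (f y)%:E)%E.

(* The frame is not unique, but the plane it spans is. *)
Definition tangent_frame m M (x : 'rV[R]_n) : 'M[R]_(m, n) :=
  xget 0 (is_tangent_frame M x).

(* Div_M X, the trace of DX over the approximate tangent plane. *)
Definition divergence m M (X : 'rV[R]_n -> 'rV[R]_n) (x : 'rV[R]_n) : R :=
  \sum_(i < m) dot ('D_(row i (tangent_frame m M x)) X x)
                   (row i (tangent_frame m M x)).

End Varifold.

Definition ae_measurable {R : realType} d (T : measurableType d)
    (mu : {measure set T -> \bar R}) (D : set T) (f : T -> \bar R) : Prop :=
  exists2 g : T -> \bar R, measurable_fun D g & f = g %[ae mu in D].

Section Brakke.
Context {R : realType} {n k : nat} {S : topologicalType}.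
Local Notation Rn := (borelRn R n).
Local Notation leb := (@lebesgue_measure R).

(* M has generalized mean curvature H and boundary conormal nu; f : S -> R^n
   parametrizes the boundary.  The clause on [tangent_frame] says that M-a.e. the
   approximate tangent plane exists and is perpendicular to H. *)
Definition first_variation_with_boundary (m : nat) (A : set (chart R k S))
    (f : S -> 'rV[R]_n) (M : {measure set Rn -> \bar R})
    (H nu : 'rV[R]_n -> 'rV[R]_n) : Prop :=
  [/\ integral_varifold_weight m M,
      measurable_fun [set: Rn] (H : Rn -> Rn) /\
        (forall K : set 'rV[R]_n, compact K ->
           (\int[M]_(x in (K : set Rn)) (enorm (H x))%:E < +oo)%E),
      {ae M, forall x, is_tangent_frame M x (tangent_frame m M x) /\
                       tangent_frame m M x *m (H x)^T = 0},
      [/\ measurable_fun (range f : set Rn) (nu : Rn -> Rn),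
          forall x, enorm (nu (f x)) <= 1 &
          forall x w, tangent_space A f x w -> dot (nu (f x)) w = 0] &
      forall X : 'rV[R]_n -> 'rV[R]_n, Ck 1 setT X -> compactly_supported X ->
        ae_measurable M setT (fun x => (divergence m M X x)%:E) /\
        (\int[M]_x (divergence m M X x)%:E =
         - (\int[M]_x (dot (H x) (X x))%:E) +
         \int[hausdorffB m.-1]_(q in (range f : set Rn))
            (dot (nu q) (X q))%:E)%E].

(* An integral over time in the definition of a Brakke flow is understood to
   assert that its integrand is (Lebesgue-)measurable in t, and likewise for the
   integral of the divergence above; the library integral is total and does not
   impose this.
   A C^2 function on R^n x [a, b] is the restriction of a C^2 function on
   R^n x R. *)
Definition brakke_flow (m : nat) (A : set (chart R k S)) (I : set R)
    (F : S -> R -> 'rV[R]_n) (M : R -> {measure set Rn -> \bar R}) : Prop :=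
  (forall t, I t -> radon (M t)) /\
  exists H nu : R -> 'rV[R]_n -> 'rV[R]_n,
  [/\ {ae leb, forall t, I t ->
        first_variation_with_boundary m A (F^~ t) (M t) (H t) (nu t)},
      (forall (K : set 'rV[R]_n) (a b : R),
        compact K -> a <= b -> `[a, b] `<=` I ->
        let energy t :=
          (\int[M t]_(x in (K : set Rn)) (1 + enorm (H t x) ^+ 2)%:E)%E in
        ae_measurable leb `[a, b] energy /\
        (\int[leb]_(t in `[a, b]) energy t < +oo)%E) &
      (forall (a b : R) (u : 'rV[R]_n * R -> R),
        a <= b -> `[a, b] `<=` I ->
        Ck 2 setT u ->
        (forall x t, t \in `[a, b] -> 0 <= u (x, t)) ->
        (exists2 K : set 'rV[R]_n, compact K &
           forall x t, t \in `[a, b] -> ~ K x -> u (x, t) = 0) ->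
        let interior t :=
          (\int[M t]_x (- u (x, t) * enorm (H t x) ^+ 2
             + dot (H t x) (gradient (fun y => u (y, t)) x)
             + derive1 (fun s => u (x, s)) t)%:E)%E in
        let boundary t :=
          (\int[hausdorffB m.-1]_(q in (moving_image F t : set Rn))
             (u (q, t) * dot (nu t q) (normal_velocity A F t q))%:E)%E in
        [/\ ae_measurable leb `[a, b] interior,
            ae_measurable leb `[a, b] boundary &
            (\int[M b]_x (u (x, b))%:E - \int[M a]_x (u (x, a))%:E <=
             \int[leb]_(t in `[a, b]) interior t +
             \int[leb]_(t in `[a, b]) boundary t)%E])].

End Brakke.

Section GaussianArea.
Context {R : realType} {n : nat}.

Definition Phi (m : nat) (x : 'rV[R]_n) : R :=
  (4 * pi) `^ (- (m%:R / 2)) * expR (- (enorm x ^+ 2 / 4)).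

(* Phi_m of M(t) dilated by |t|^(-1/2), expressed on M(t). *)
Definition Phi_flow (m : nat) (M : R -> {measure set (borelRn R n) -> \bar R})
    (t : R) : \bar R :=
  (\int[M t]_x ((4 * pi * `|t|) `^ (- (m%:R / 2)) *
                expR (- (enorm x ^+ 2 / (4 * `|t|))))%:E)%E.

Definition rescaled (S : Type) (F : S -> R -> 'rV[R]_n) (x : S) (t : R) :
    'rV[R]_n :=
  (Num.sqrt `|t|)^-1 *: F x t.

(* Phi_m, with multiplicity, of the surface swept out by G(., t), T <= t < 0. *)
Definition Phi_swept (m k : nat) (S : topologicalType) (A : set (chart R k S))
    (G : S -> R -> 'rV[R]_n) (T : R) : \bar R :=
  (\int[@lebesgue_measure R]_(t in `[T, 0%R[)
     integral_pullback (k := k) (G^~ t)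
       (fun x => enorm (time_velocity_perp A G t x) * Phi m (G x t))%R)%E.

End GaussianArea.

(* Main.v *)
(* Let rho(x,t) = (4 pi |t|)^(-m/2) exp(-|x|^2/(4|t|)), and let u = f rho, with
   f = f_N a cutoff in the variable |x|^2 + 2m(t - a) that equals 1 on the
   boundary during [a, b].  Insert u in the Brakke inequality, and the field
   f grad rho - rho grad f, with its sign chosen suitably, in the first
   variation formula.  Adding the two, the interior terms become
   -u |H + x^perp/(2|t|)|^2 - 4 rho f'' |x^T|^2.  As f'' >= -18/N, and f'' < 0
   only on a fixed compact set, the interior contributes at most C/N times the
   energy of that set.  On the boundary f = 1, and what is left is
   rho nu . (dF/dt + x/(2|t|)); since nu is a normal vector of length at most 1
   and the rescaled boundary moves with velocity
   |t|^(-1/2) (dF/dt + x/(2|t|)), scaling of Hausdorff measure bounds its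
   integral by the rate at which the rescaled boundary sweeps out Phi-area.
   Integrate in time and let N tend to infinity.

   The swept-out rate is not known to be measurable in t, so its integral is
   a lower integral.  This suffices: lower integrals of nonnegative functions
   are superadditive over disjoint time intervals, and the rate only enters as
   an upper bound for a measurable function. *)
Require Import Defs.
From HB Require Import structures.
From mathcomp Require Import all_boot all_order all_algebra ring lra.
From mathcomp Require Import all_classical all_reals all_analysis measurable_realfun.
Import Order.TTheory GRing.Theory Num.Theory.
Import numFieldNormedType.Exports.
Set Implicit Arguments.
Unset Strict Implicit.
Unset Printing Implicit Defensive.
Local Open Scope classical_set_scope.
Local Open Scope ring_scope.
(** * Euclidean norm and Hausdorff measure *)

(** [M(t)] carries no bound at infinity: its mass and energy are finite on compact sets only, and
    the Gaussian areas may be infinite. An error term living in the far region where the cutoff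
    decays could not be controlled, however small its coefficient. So the cutoff is made convex as
    it decreases to 0, and its concave bend is kept in a shell near [r] that is the same for all
    [N]; only the slope, of order 1/(N+1), depends on [N].

    The field f grad rho - rho grad f is dictated by the algebra. In H . grad u + H . X the gradient
    of f cancels and 2 f H . grad rho is left, which completes the square. The tangential divergence
    of X is f tr D^2 rho - rho tr D^2 f, so that rho meets the backward heat operator and f the
    forward one: the first gives -rho |x^perp|^2 / (4 tau^2), which the completed square absorbs,
    and the second gives -4 f'' |x^T|^2.

    The (m-1)-dimensional measure of Gamma(t) is never estimated: that the flux of X through it is
    finite is read off the first variation formula. *)

Section EuclideanFacts.
Context {R : realType} {n : nat}.
Implicit Types x y z : 'rV[R]_n.

Lemma dotC x y : dot x y = dot y x.
Proof. by apply: eq_bigr => i _; rewrite mulrC. Qed.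

Lemma dotDl x y z : dot (x + y) z = dot x z + dot y z.
Proof. by rewrite /dot -big_split; apply: eq_bigr => i _; rewrite mxE mulrDl. Qed.

Lemma dotZl a x y : dot (a *: x) y = a * dot x y.
Proof. by rewrite /dot mulr_sumr; apply: eq_bigr => i _; rewrite mxE mulrA. Qed.

Lemma dotDr x y z : dot z (x + y) = dot z x + dot z y.
Proof. by rewrite !(dotC z) dotDl. Qed.

Lemma dotZr a x y : dot y (a *: x) = a * dot y x.
Proof. by rewrite !(dotC y) dotZl. Qed.

Lemma dotNl x y : dot (- x) y = - dot x y.
Proof. by rewrite -scaleN1r dotZl mulN1r. Qed.

Lemma dotNr x y : dot y (- x) = - dot y x.
Proof. by rewrite !(dotC y) dotNl. Qed.

Lemma dot0l x : dot 0 x = 0.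
Proof. by rewrite -(scale0r 0) dotZl mul0r. Qed.

Lemma dot_ge0 x : 0 <= dot x x.
Proof. by apply: sumr_ge0 => i _; rewrite -expr2 sqr_ge0. Qed.

Lemma sqr_coord_le_dot x i : x 0 i ^+ 2 <= dot x x.
Proof.
rewrite /dot (bigD1 i) //= -expr2 lerDl.
by apply: sumr_ge0 => j _; rewrite -expr2 sqr_ge0.
Qed.

Lemma dot_eq0 x : dot x x = 0 -> x = 0.
Proof.
move=> x0; apply/rowP => i; rewrite mxE; apply/eqP; rewrite -sqrf_eq0.
by rewrite eq_le sqr_ge0 andbT -x0 sqr_coord_le_dot.
Qed.

Lemma enorm_ge0 x : 0 <= enorm x.
Proof. exact: sqrtr_ge0. Qed.

Lemma enorm_sqr x : enorm x ^+ 2 = dot x x.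
Proof. by rewrite sqr_sqrtr // dot_ge0. Qed.

Lemma enormZ a x : enorm (a *: x) = `|a| * enorm x.
Proof.
by rewrite /enorm dotZl dotZr mulrA -expr2 sqrtrM ?sqr_ge0 // sqrtr_sqr.
Qed.

(** Bridges the sup norm, in which separation of sets is phrased, and the Euclidean size of the sets
    in a covering. *)
Lemma mx_norm_le_enorm x : `|x| <= enorm x.
Proof.
have [->|x0] := eqVneq `|x| 0; first exact: enorm_ge0.
have [[i j] /= xij] := mx_norm_neq0 x0.
rewrite [leLHS]xij ord1 -(ler_pXn2r (n := 2)) ?nnegrE ?enorm_ge0 //.
by rewrite enorm_sqr real_normK ?num_real // sqr_coord_le_dot.
Qed.

Lemma dot_le_enorm x y : dot x y <= enorm x * enorm y.
Proof.
have [x0|x0] := eqVneq (dot x x) 0.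
  by rewrite (dot_eq0 x0) dot0l mulr_ge0 ?enorm_ge0.
have xpos : 0 < dot x x by rewrite lt0r x0 dot_ge0.
(* The square of this vector is a (a c - b^2), and a > 0. *)
have := dot_ge0 (dot x x *: y - dot x y *: x).
rewrite !(dotDl, dotDr, dotNl, dotNr, dotZl, dotZr) (dotC y x).
set a := dot x x; set b := dot x y; set c := dot y y => h.
have {}h : 0 <= a * (a * c - b ^+ 2).
  by apply: le_trans h _; rewrite le_eqVlt; apply/orP; left; apply/eqP; ring.
have {}h : b ^+ 2 <= a * c by move: h; rewrite pmulr_rge0 // subr_ge0.
apply: le_trans (ler_norm _) _.
by rewrite -sqrtr_sqr /enorm -sqrtrM ?dot_ge0 // ler_wsqrtr.
Qed.

End EuclideanFacts.

(* Caratheodory's criterion, in the form needed for open sets: [U j] exhausts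
   an open set, and sets inside [U j] and outside [U j.+1] are at positive
   distance. *)
Lemma caratheodory_exhaustion (R : realType) (T : Type)
    (mu : {outer_measure set T -> \bar R}) (U : nat -> set T) :
  (forall j, U j `<=` U j.+1) ->
  (forall j Y Z, Y `<=` U j -> Z `<=` ~` U j.+1 ->
     (mu Y + mu Z <= mu (Y `|` Z))%E) ->
  mu.-caratheodory (\bigcup_j U j).
Proof.
move=> ndU sep; apply: le_caratheodory_measurable => X.
have UU i j : (i <= j)%N -> U i `<=` U j.
  move=> ij; rewrite -(subnKC ij); elim: (j - i)%N => [|d IH]; first by rewrite addn0.
  by rewrite addnS; apply: subset_trans IH _.
have [->|Xfin] := eqVneq (mu X) +oo%E; first by rewrite leey.
pose Rg j := X `&` (U j.+1 `\` U j).
have mu0 A : (0 <= mu A)%E by exact: outer_measure_ge0.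
(* Rings whose indices differ by two are separated by a full layer, so [sep] adds up the rings of
   one parity [o] inside [X]. The two parities together make the series of all rings converge. *)
have ring_sum (o N : nat) : (\sum_(0 <= j < N) mu (Rg (j.*2 + o)%N) <= mu X)%E.
  pose V k := if k is k'.+1 then U (k'.*2 + o).+1 else set0.
  suff : (\sum_(0 <= j < N) mu (Rg (j.*2 + o)%N) <= mu (X `&` V N))%E.
    by move=> /le_trans; apply; apply: le_outer_measure => x [].
  elim: N => [|N IH]; first by rewrite big_nil.
  rewrite big_nat_recr //=; apply: le_trans (leeD2r _ IH) _.
  have le1 : (mu (X `&` V N) + mu (Rg (N.*2 + o)%N) <=
      mu ((X `&` V N) `|` Rg (N.*2 + o)%N))%E.
    case: N {IH} => [|N] /=; first by rewrite setI0 outer_measure0 add0e set0U.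
    apply: sep (N.*2 + o).+1 _ _ _ _; first by move=> x [].
    by move=> x [_ []]; rewrite doubleS.
  apply: le_trans le1 _; apply: le_outer_measure => x [[Xx]|[Xx [? ?]]] //.
  by case: N {IH} => [|N] //= Ux; split=> //; apply: UU Ux; rewrite doubleS !addSn !ltnS; exact: leqW.
have series_fin : (\sum_(0 <= j <oo) mu (Rg j) < +oo)%E.
  apply: (@le_lt_trans _ _ (mu X + mu X)%E); last first.
    by rewrite lte_add_pinfty // ltey.
  apply: lime_le; first exact: is_cvg_nneseries.
  near=> N.
  apply: (@le_trans _ _ (\sum_(0 <= j < N.*2) mu (Rg j))%E).
    by apply: lee_sum_nneg_natr => //; rewrite -addnn leq_addr.
  have -> : (\sum_(0 <= j < N.*2) mu (Rg j) =
      \sum_(0 <= j < N) mu (Rg (j.*2 + 0)%N) +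
      \sum_(0 <= j < N) mu (Rg (j.*2 + 1)%N))%E.
    elim: (N) => [|k IH]; first by rewrite !big_nil adde0.
    rewrite doubleS !big_nat_recr //= IH addn0 addn1 -!addeA; congr (_ + _)%E.
    by rewrite addeCA.
  by apply: leeD; exact: ring_sum.
set UU' := \bigcup_j U j.
(* The part of [X] in the union but outside [U N] lies in the rings of index at least [N], and [sep]
   applies to [U N] and the complement of the union. This is additivity up to the tail of a
   convergent series. *)
have step N : (mu (X `&` UU') + mu (X `&` ~` UU') <=
    mu X + \sum_(N <= k <oo) mu (Rg k))%E.
  have le1 : (mu (X `&` UU') <= mu (X `&` U N) + \sum_(N <= k <oo) mu (Rg k))%E.
    have sub : X `&` UU' `<=` (X `&` U N) `|` \bigcup_(k in ~` `I_N) Rg k.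
      move=> x [Xx [j _]]; elim: j => [|j IH] Ux.
        by left; split=> //; exact: UU Ux.
      have [Uj|nUj] := pselect (U j x); first exact: IH.
      have [jN|Nj] := ltnP j N; first by left; split=> //; exact: UU Ux.
      by right; exists j => //=; rewrite ltnNge Nj.
    apply: le_trans (le_outer_measure mu _ _ sub) _.
    apply: le_trans (outer_measureU2 _ _ _) _.
    by apply: leeD => //; exact: outer_measure_sigma_subadditive_tail.
  apply: le_trans (leeD2r _ le1) _; rewrite addeAC; apply: leeD2r.
  have -> : mu (X `&` ~` UU') = mu ((X `&` ~` UU') `&` ~` U N.+1).
    congr (mu _); apply/seteqP; split=> [x [Xx nU]|x []//]; split=> // UN.
    by apply: nU; exists N.+1.
  apply: le_trans (sep N _ _ _ _) _; [by move=> x []|by move=> x []|].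
  by apply: le_outer_measure => x [[]|[[]]].
have tcvg : (mu X + \sum_(N <= k <oo) mu (Rg k))%E @[N --> \oo] --> (mu X + 0)%E.
  apply: cvgeD; [by rewrite fin_num_adde_defl|exact: cvg_cst|].
  by apply: nneseries_tail_cvg.
rewrite adde0 in tcvg; rewrite -(cvg_lim _ tcvg) //.
by apply: lime_ge; [apply/cvg_ex; eexists; exact: tcvg|exact: nearW].
Unshelve. all: by end_near. Qed.

(** With every subset measurable, [mu_ext], which takes coverings by measurable sets, takes
    coverings by arbitrary sets. *)
Definition discrete_type (T : Type) := g_sigma_algebraType (@setT (set T)).

Section HausdorffMeasure.
Context {R : realType} {n : nat}.
Implicit Types (A C : set 'rV[R]_n) (k : nat).

Lemma ball_volume_ge0 k : 0 <= ball_volume k :> R.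
Proof.
suff : 0 <= ball_volume k :> R /\ 0 <= ball_volume k.+1 :> R by case.
elim: k => [|k [IH1 IH2]]; first by split => /=.
split=> //; change (0 <= 2 * pi / k.+2%:R * ball_volume k :> R).
by rewrite mulr_ge0 // divr_ge0 // mulr_ge0 // pi_ge0.
Qed.

Lemma diam_ge0 C : 0 <= diam C.
Proof.
rewrite /diam; set E := [set _ | _ in _].
have E0 y : E y -> 0 <= y by move=> [p _ <-]; exact: enorm_ge0.
have [hE|hE] := pselect (has_sup E); last by rewrite sup_out.
have [[y Ey] ubE] := hE.
by apply: le_trans (E0 _ Ey) _; exact: ub_le_sup.
Qed.

Lemma hausdorff_size_ge0 k C : (0 <= hausdorff_size k C)%E.
Proof.
rewrite /hausdorff_size; case: ifP => // _.
by rewrite lee_fin mulr_ge0 ?ball_volume_ge0 // exprn_ge0 // divr_ge0 ?diam_ge0.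
Qed.

Definition small (delta : R) C := forall x y, C x -> C y -> enorm (x - y) <= delta.

(** An infinite weight on large sets moves the size constraint from the covering into the set
    function, which makes [hausdorff_delta] an instance of the general outer measure
    construction. *)
Definition restricted_size k delta (C : set (discrete_type 'rV[R]_n)) : \bar R :=
  if `[< small delta C >] then hausdorff_size k C else +oo%E.

Lemma restricted_size_ge0 k delta C : (0 <= restricted_size k delta C)%E.
Proof.
rewrite /restricted_size; case: ifP => _; first exact: hausdorff_size_ge0.
exact: leey.
Qed.

Lemma restricted_size0 k delta : restricted_size k delta set0 = 0%E.
Proof.
rewrite /restricted_size; case: asboolP => [_|]; last by case.
by rewrite /hausdorff_size eqxx.
Qed.

Lemma hausdorff_deltaE k delta A :
  hausdorff_delta k delta A =
  mu_ext (restricted_size k delta) (A : set (discrete_type _)).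
Proof.
apply/eqP; rewrite eq_le; apply/andP; split.
- apply: le_ereal_inf_tmp => y [C [mC AC] <-{y}].
  have [sC|] := pselect (forall i, small delta (C i)).
    apply: ereal_inf_lbound; exists C => //.
    by apply: eq_eseriesr => i _; rewrite /restricted_size; case: asboolP => // /(_ (sC i)).
  move/existsNP => [i nsC].
  rewrite (eseries_pinfty (k := i)) ?leey // => [j _|].
    by rewrite gt_eqF // (lt_le_trans _ (restricted_size_ge0 _ _ _)).
  by rewrite /restricted_size; case: asboolP.
- apply: le_ereal_inf_tmp => y [C [AC sC] <-{y}]; apply: ereal_inf_lbound; exists C.
    by split=> // i; exact: sub_sigma_algebra.
  apply: eq_eseriesr => i _; rewrite /restricted_size; case: asboolP => // h.
  by exfalso; apply: h; exact: sC.
Qed.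

Lemma hausdorff_delta_sigma_subadditive k delta :
  sigma_subadditive (hausdorff_delta k delta : set 'rV[R]_n -> \bar R).
Proof.
move=> F; rewrite (eq_eseriesr (g := fun i => mu_ext (restricted_size k delta) (F i))).
  rewrite hausdorff_deltaE.
  apply: (@mu_ext_sigma_subadditive _ (discrete_type _)).
  exact: restricted_size_ge0.
by move=> i _; rewrite hausdorff_deltaE.
Qed.

Lemma hausdorff_delta_ge0 k delta A : (0 <= hausdorff_delta k delta A)%E.
Proof. by rewrite hausdorff_deltaE; apply: mu_ext_ge0; exact: restricted_size_ge0. Qed.

Lemma hausdorff_delta_le k delta A :
  0 < delta -> (hausdorff_delta k delta A <= hausdorff k A)%E.
Proof. by move=> d0; apply: ereal_sup_ubound; exists delta. Qed.

Lemma hausdorff_set0 k : hausdorff k (@set0 'rV[R]_n) = 0%E.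
Proof.
apply/eqP; rewrite eq_le; apply/andP; split.
  apply: ge_ereal_sup => _ [delta _ <-]; rewrite hausdorff_deltaE mu_ext0 //.
    exact: restricted_size0.
  exact: restricted_size_ge0.
exact: le_trans (hausdorff_delta_ge0 k 1 _) (hausdorff_delta_le _ _ ltr01).
Qed.

Lemma hausdorff_ge0 k A : (0 <= hausdorff k A)%E.
Proof. exact: le_trans (hausdorff_delta_ge0 k 1 _) (hausdorff_delta_le _ _ ltr01). Qed.

Lemma le_hausdorff k : {homo (@hausdorff R n k) : A B / A `<=` B >-> (A <= B)%E}.
Proof.
move=> A B AB; apply: ge_ereal_sup => _ [delta d0 <-].
apply: le_trans (hausdorff_delta_le _ _ d0).
by rewrite !hausdorff_deltaE; apply: le_mu_ext.
Qed.

Lemma hausdorff_sigma_subadditive k :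
  sigma_subadditive (hausdorff k : set 'rV[R]_n -> \bar R).
Proof.
move=> F; apply: ge_ereal_sup => _ [delta d0 <-].
apply: le_trans (hausdorff_delta_sigma_subadditive _ _ _) _.
apply: lee_nneseries => i *; first exact: hausdorff_delta_ge0.
exact: hausdorff_delta_le.
Qed.

HB.instance Definition _ k := isOuterMeasure.Build R 'rV[R]_n (@hausdorff R n k)
  (hausdorff_set0 k) (hausdorff_ge0 k) (@le_hausdorff k)
  (@hausdorff_sigma_subadditive k).

Lemma hausdorff_delta_anti k (d1 d2 : R) A :
  d1 <= d2 -> (hausdorff_delta k d2 A <= hausdorff_delta k d1 A)%E.
Proof.
move=> d12; apply: le_ereal_inf_tmp => _ [C [AC sC] <-].
apply: ereal_inf_lbound; exists C => //; split=> // i x y Cx Cy.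
exact: le_trans (sC _ _ _ Cx Cy) d12.
Qed.

(* A set of diameter less than [e] meets at most one of [Y] and [Z]. *)
Lemma hausdorff_separated k (e : R) (Y Z : set 'rV[R]_n) : 0 < e ->
  (forall y z, Y y -> Z z -> e <= `|y - z|) ->
  (hausdorff k Y + hausdorff k Z <= hausdorff k (Y `|` Z))%E.
Proof.
move=> e0 sep.
(* Scales below [e] suffice, since [hausdorff_delta] grows as the scale shrinks. The two suprema are
   then compared at the smaller of two scales. *)
suff sum_le (d : R) : 0 < d -> d < e ->
    (hausdorff_delta k d Y + hausdorff_delta k d Z <= hausdorff k (Y `|` Z))%E.
  have nY (W : set 'rV[R]_n) : (hausdorff k W)%E = ereal_sup
      [set hausdorff_delta k d W | d in [set d : R | 0 < d /\ d < e]].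
    apply/eqP; rewrite eq_le; apply/andP; split.
      apply: ge_ereal_sup => y [d /= d0 <-{y}]; apply: le_trans (hausdorff_delta_anti k W (d1 := Num.min d (e / 2)) _) _.
        by rewrite ge_min lexx.
      apply: ereal_sup_ubound; exists (Num.min d (e / 2)) => //=.
      by rewrite lt_min d0 divr_gt0 //= gt_min; split=> //; apply/orP; right; lra.
    by apply: ge_ereal_sup => y [d /= [d0 de] <-{y}]; exact: hausdorff_delta_le.
  have [->|fin] := eqVneq (hausdorff k (Y `|` Z)) +oo%E; first by rewrite leey.
  have finW W : W `<=` Y `|` Z -> hausdorff k W \is a fin_num.
    move=> WYZ; rewrite ge0_fin_numE ?hausdorff_ge0 //.
    by apply: le_lt_trans (le_hausdorff k WYZ) _; rewrite ltey.
  have fY : hausdorff k Y \is a fin_num by apply: finW; exact: subsetUl.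
  have fZ : hausdorff k Z \is a fin_num by apply: finW; exact: subsetUr.
  rewrite -leeBrDr // nY; apply: ge_ereal_sup => _ [d /= [d0 de] <-].
  rewrite leeBrDr // addeC.
  have fdY : hausdorff_delta k d Y \is a fin_num.
    rewrite ge0_fin_numE ?hausdorff_delta_ge0 //.
    apply: le_lt_trans (hausdorff_delta_le _ _ d0) _.
    by rewrite -ge0_fin_numE ?hausdorff_ge0.
  rewrite -leeBrDr // nY; apply: ge_ereal_sup => _ [d' /= [d'0 d'e] <-].
  rewrite leeBrDr //.
  apply: le_trans (sum_le (Num.min d d') _ _).
  - by rewrite addeC; apply: leeD; apply: hausdorff_delta_anti; rewrite ge_min lexx ?orbT.
  - by rewrite lt_min d0 d'0.
  - by rewrite gt_min de.
move=> d0 de; apply: le_trans (hausdorff_delta_le k (Y `|` Z) d0).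
apply: le_ereal_inf_tmp => _ [C [YZC sC] <-].
have size0 : hausdorff_size k (@set0 'rV[R]_n) = 0%E by rewrite /hausdorff_size eqxx.
(* From a covering of the union keep the sets that meet [W]. No set is kept for both [Y] and [Z], so
   the two sums together do not exceed the whole. *)
have bound (W : set 'rV[R]_n) : W `<=` Y `|` Z ->
    (hausdorff_delta k d W <= \sum_(0 <= i <oo) hausdorff_size k
      (if `[< exists2 y, C i y & W y >] then C i else set0))%E.
  move=> WYZ; pose CW i := if `[< exists2 y, C i y & W y >] then C i else set0.
  apply: ereal_inf_lbound; exists CW => //; split.
    move=> x Wx; have [i _ Cix] := YZC x (WYZ x Wx).
    by exists i => //; rewrite /CW; case: asboolP => // h; exfalso; apply: h; exists x.
  by move=> i x y; rewrite /CW; case: asboolP => // _; exact: sC.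
apply: le_trans (leeD (bound Y _) (bound Z _)) _; [exact: subsetUl|exact: subsetUr|].
rewrite -nneseriesD; [|by move=> i *; exact: hausdorff_size_ge0..].
apply: lee_nneseries => i *; first by rewrite adde_ge0 ?hausdorff_size_ge0.
case: asboolP => [[y Ciy Yy]|_]; last by rewrite size0 add0e; case: asboolP => // _; rewrite size0 hausdorff_size_ge0.
case: asboolP => [[z Ciz Zz]|_]; last by rewrite size0 adde0.
have := le_lt_trans (le_trans (mx_norm_le_enorm _) (sC _ _ _ Ciy Ciz)) de.
by rewrite ltNge sep.
Qed.

Lemma open_hausdorff_caratheodory k (U : set 'rV[R]_n) :
  open U -> (hausdorff k).-caratheodory U.
Proof.
move=> oU.
(* The points at distance at least 1/(j+1) from the complement of [U]; consecutive levels leave a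
   gap of 1/(j+1) - 1/(j+2). *)
pose V j := [set x : 'rV[R]_n | forall y, `|x - y| < j.+1%:R^-1 -> U y].
have -> : U = \bigcup_j V j.
  apply/seteqP; split=> [x Ux|x [j _]]; last by apply; rewrite subrr normr0.
  have /nbhs_normP[e /= e0 xeU] : nbhs x U by exact: open_nbhs_nbhs.
  have [j je] := ltr_add_invr e0.
  exists j => // y xy; apply: xeU => /=.
  by apply: lt_trans xy _; rewrite add0r in je.
apply: caratheodory_exhaustion => [j x Vx y xy|j Y Z YV ZV].
  by apply: Vx; apply: lt_le_trans xy _; rewrite lef_pV2 ?posrE ?ltr0n // ler_nat.
apply: (@hausdorff_separated k (j.+1%:R^-1 - j.+2%:R^-1)).
  by rewrite subr_gt0 ltf_pV2 ?posrE ?ltr0n // ltr_nat.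
move=> y z /YV Vy /ZV /existsNP [w /not_implyP[zw nUw]].
rewrite leNgt; apply/negP => yz; apply: nUw; apply: Vy.
rewrite -(subrKA z) (le_lt_trans (ler_normD _ _)) //.
by rewrite -(subrK j.+2%:R^-1 j.+1%:R^-1) ltrD.
Qed.

Lemma borel_hausdorff_caratheodory k (B : set (borelRn R n)) :
  measurable B -> (hausdorff k).-caratheodory B.
Proof.
have sub : <<s @open 'rV[R]_n >> `<=` (hausdorff k).-cara.-measurable.
  apply: smallest_sub; first exact: sigma_algebra_measurable.
  by move=> U oU; exact: (@open_hausdorff_caratheodory k U oU).
exact: sub.
Qed.

Lemma hausdorffB_sigma_additive k :
  semi_sigma_additive (hausdorffB k : set (borelRn R n) -> \bar R).
Proof.
move=> F mF tF mUF.
by apply: (@caratheodory_measure_sigma_additive R 'rV[R]_n (hausdorff k)) => //;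
  [move=> i; exact: borel_hausdorff_caratheodory|exact: borel_hausdorff_caratheodory].
Qed.

(** From here on the integrals against [hausdorffB] in the definitions are integrals against a
    genuine Borel measure, and the general lemmas apply to them. *)
HB.instance Definition _ k := isMeasure.Build _ (borelRn R n) R
  (@hausdorffB R n k) (hausdorff_set0 k) (hausdorff_ge0 k)
  (@hausdorffB_sigma_additive k).

End HausdorffMeasure.

(** * Lower integrals *)

(* The library integral of a nonnegative function that need not be measurable
   is its lower integral. *)
Section LowerIntegral.
Local Open Scope ereal_scope.
Context d (T : measurableType d) (R : realType) (mu : {measure set T -> \bar R}).
Implicit Types (D : set T) (f g b : T -> \bar R).

Import HBNNSimple.

Lemma ge0_le_lower_integral D f g : (forall x, D x -> 0 <= f x) ->
  (forall x, D x -> f x <= g x) ->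
  \int[mu]_(x in D) f x <= \int[mu]_(x in D) g x.
Proof.
move=> f0 fg; rewrite !ge0_integralE //; last first.
  by move=> x Dx; apply: le_trans (f0 _ Dx) (fg _ Dx).
apply: ge_ereal_sup => _ [h hf <-]; apply: ereal_sup_ubound; exists h => // x.
apply: le_trans (hf x) _; rewrite /patch; case: ifPn => // /set_mem; exact: fg.
Qed.

(** Cutting the simple function [h] to 0 on the exceptional null set makes the bound hold everywhere
    without changing its integral; [f] is left untouched and may fail to be measurable. *)
Lemma nnsfun_le_lower_integral D f (h : {nnsfun T >-> R}) :
  (forall x, D x -> 0 <= f x) -> {ae mu, forall x, (h x)%:E <= (f \_ D) x} ->
  \int[mu]_x (h x)%:E <= \int[mu]_(x in D) f x.
Proof.
move=> f0 [N [mN N0 subN]].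
have mCN : measurable (~` N) by exact: measurableC.
pose h' := proj_nnsfun h mCN.
have -> : \int[mu]_x (h x)%:E = \int[mu]_x (h' x)%:E.
  apply: ge0_ae_eq_integral => //.
  - exact/measurable_EFinP.
  - exact/measurable_EFinP.
  - by move=> x _; rewrite lee_fin.
  - by move=> x _; rewrite lee_fin.
  exists N; split=> // x /= /not_implyP[_]; apply: contra_notP => Nx.
  by rewrite mindicE mem_set // mulr1.
rewrite [leRHS]integral_mkcond; apply: ge0_le_lower_integral => x _.
  by rewrite lee_fin.
rewrite /h' /= mindicE; have [xN|xN] := boolP (x \in ~` N); last first.
  by rewrite mulr0 erestrict_ge0.
by rewrite mulr1; apply: contrapT => hx; move/set_mem: xN; apply; exact: subN.
Qed.

Lemma ge0_ae_eq_lower_integral D f g :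
  (forall x, D x -> 0 <= f x) -> (forall x, D x -> 0 <= g x) ->
  ae_eq mu D f g -> \int[mu]_(x in D) f x = \int[mu]_(x in D) g x.
Proof.
suff le f' g' : (forall x, D x -> 0 <= f' x) -> (forall x, D x -> 0 <= g' x) ->
    ae_eq mu D f' g' -> \int[mu]_(x in D) f' x <= \int[mu]_(x in D) g' x.
  move=> f0 g0 fg; apply/eqP; rewrite eq_le !le //.
  by apply: filterS fg => x /[apply].
move=> f0 g0 fg; rewrite ge0_integralE //.
apply: ge_ereal_sup => _ [h hf <-]; rewrite -integralT_nnsfun.
apply: nnsfun_le_lower_integral => //.
apply: filterS fg => x fgx; apply: le_trans (hf x) _.
by rewrite /patch; case: ifPn => // /set_mem /fgx ->.
Qed.

Lemma ae_eq_lower_integral D f g :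
  ae_eq mu D f g -> \int[mu]_(x in D) f x = \int[mu]_(x in D) g x.
Proof.
move=> fg; rewrite integralE [RHS]integralE.
by congr (_ - _); apply: ge0_ae_eq_lower_integral => //;
  apply: filterS fg => x + Dx => /(_ Dx); rewrite ?funeposE ?funenegE => ->.
Qed.

Lemma ae_ge0_le_lower_integral D f g : measurable D -> measurable_fun D f ->
  (forall x, D x -> 0 <= f x) -> (forall x, D x -> 0 <= g x) ->
  {ae mu, forall x, D x -> f x <= g x} ->
  \int[mu]_(x in D) f x <= \int[mu]_(x in D) g x.
Proof.
move=> mD mf f0 g0 fg; rewrite ge0_integralE //.
apply: ge_ereal_sup => _ [h hf <-]; rewrite -integralT_nnsfun.
apply: nnsfun_le_lower_integral => //.
apply: filterS fg => x fgx; apply: le_trans (hf x) _.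
by rewrite /patch; case: ifPn => // /set_mem; exact: fgx.
Qed.

Lemma le_integral_integrable D f g : measurable D -> measurable_fun D f ->
  mu.-integrable D g -> (forall x, D x -> f x <= g x) ->
  \int[mu]_(x in D) f x <= \int[mu]_(x in D) g x.
Proof.
move=> mD mf ig fg; rewrite integralE [leRHS]integralE.
have fgD : {in D, forall x, f x <= g x} by move=> x /set_mem; exact: fg.
apply: leeB; apply: ge0_le_lower_integral => // x Dx.
  by apply: (funepos_le fgD); exact: mem_set.
by apply: (funeneg_le fgD); exact: mem_set.
Qed.

(** The measurable function [p], the positive part of [f' - b], fits between [f - b] and [g].
    Additivity is used for [b] and [p] only, and [g] enters only as an upper bound of [p], so its
    lower integral is enough. *)
Lemma integral_le_integrable_add D f b g : measurable D ->
  ae_measurable mu D f -> mu.-integrable D b -> (forall x, D x -> 0 <= g x) ->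
  {ae mu, forall x, D x -> f x <= b x + g x} ->
  \int[mu]_(x in D) f x <= \int[mu]_(x in D) b x + \int[mu]_(x in D) g x.
Proof.
move=> mD [f' mf' ff'] ib g0 fbg.
rewrite (ae_eq_lower_integral ff').
have mb := measurable_int _ ib.
pose p := (f' \- b)^\+.
have mp : measurable_fun D p by apply: measurable_funepos; exact: emeasurable_funB.
have p0 x : 0 <= p x by exact: funepos_ge0.
have pg : \int[mu]_(x in D) p x <= \int[mu]_(x in D) g x.
  apply: ae_ge0_le_lower_integral => //.
  have bfin := integrable_ae mD ib.
  apply: filterS3 ff' fbg bfin => x ff' fbg bfin Dx.
  rewrite /p funeposE ge_max g0 // andbT leeBlDl; last exact: bfin.
  by rewrite -ff' //; exact: fbg.
have bint : \int[mu]_(x in D) b x \is a fin_num by exact: integrable_fin_num.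
(* If [p] has infinite integral then so has [g], and the right-hand side is +oo because the integral
   of [b] is finite. *)
have [poo|pfin] := eqVneq (\int[mu]_(x in D) p x) +oo.
  move: pg; rewrite poo leye_eq => /eqP ->.
  by rewrite addey ?leey // -ltNye; move: bint; rewrite fin_numE => /andP[]; rewrite ltNye.
have ip : mu.-integrable D p.
  apply/integrableP; split=> //; rewrite (eq_integral p) ?ltey //.
  by move=> x _; rewrite gee0_abs.
apply: (@le_trans _ _ (\int[mu]_(x in D) b x + \int[mu]_(x in D) p x)); last first.
  exact: leeD.
pose fin := [set x | b x \is a fin_num].
rewrite -integralD //.
(* On the null set where [b] is infinite [f'] is altered, so that the bound by [b + p] holds at
   every point. *)
rewrite (@ae_eq_lower_integral D f' (fun x => if x \in fin then f' x else b x + p x)).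
  apply: le_integral_integrable => //; last first.
  - move=> x Dx; case: ifPn => // /set_mem bx.
    rewrite addeC -leeBlDr // /p funeposE le_max lexx //.
  - exact: integrableD.
  apply: measurable_fun_if => //.
  - apply: (measurable_fun_bool true).
    rewrite [X in measurable X](_ : _ = D `&` [set x | b x \is a fin_num]).
      exact: emeasurable_fin_num.
    by apply/seteqP; split=> x [Dx /=]; rewrite /fin mem_setE; [|].
  - by apply: measurable_funS mf' => // x [].
  - have mbp : measurable_fun D (fun x => b x + p x) by exact: emeasurable_funD.
    by apply: measurable_funS mbp => // x [].
apply: filterS (integrable_ae mD ib) => x bx Dx.
by rewrite mem_set //; exact: bx.
Qed.

(** Simple functions below [f] on the two pieces add up to one below [f] on the union. The suprema
    are taken one after the other, by subtraction, which is why the case of an infinite right-hand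
    side is split off. *)
Lemma ge0_lower_integral_setU D1 D2 f : measurable D1 -> measurable D2 ->
  (forall x, (D1 `|` D2) x -> 0 <= f x) -> [disjoint D1 & D2] ->
  \int[mu]_(x in D1) f x + \int[mu]_(x in D2) f x <=
  \int[mu]_(x in D1 `|` D2) f x.
Proof.
move=> mD1 mD2 f0 dis.
have key (h1 h2 : {nnsfun T >-> R}) : (forall x, (h1 x)%:E <= (f \_ D1) x) ->
    (forall x, (h2 x)%:E <= (f \_ D2) x) ->
    sintegral mu h1 + sintegral mu h2 <= \int[mu]_(x in D1 `|` D2) f x.
  move=> hf1 hf2; rewrite -sintegralD //.
  rewrite ge0_integralE //; apply: ereal_sup_ubound.
  exists (add_nnsfun h1 h2) => // x /=.
  rewrite EFinD; apply: le_trans (leeD (hf1 x) (hf2 x)) _.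
  rewrite /patch in_setU; have [x1|x1] := boolP (x \in D1).
    have -> /= : x \in D2 = false.
      by apply/negbTE/negP => x2; move/disj_setPS: dis => /(_ x); apply; split; exact: set_mem.
    by rewrite adde0.
  by rewrite add0e.
have f1 x : D1 x -> 0 <= f x by move=> ?; apply: f0; left.
have f2 x : D2 x -> 0 <= f x by move=> ?; apply: f0; right.
set I := \int[mu]_(x in D1 `|` D2) f x.
have [->|Ifin] := eqVneq I +oo; first by rewrite leey.
have I0 : 0 <= I by exact: integral_ge0.
have If : I \is a fin_num by rewrite ge0_fin_numE // ltey.
have le1 (h1 : {nnsfun T >-> R}) : (forall x, (h1 x)%:E <= (f \_ D1) x) ->
    sintegral mu h1 + \int[mu]_(x in D2) f x <= I.
  move=> hf1.
  have s1f : sintegral mu h1 \is a fin_num.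
    rewrite ge0_fin_numE ?sintegral_ge0 //.
    apply: (@le_lt_trans _ _ I); last by rewrite ltey.
    apply: le_trans (key h1 nnsfun0 hf1 _); first by rewrite sintegral0 adde0.
    by move=> x; rewrite erestrict_ge0.
  rewrite addeC -leeBrDr // (ge0_integralE _ f2); apply: ge_ereal_sup => _ [h2 hf2 <-].
  by rewrite leeBrDr // addeC; exact: key.
have s2f : \int[mu]_(x in D2) f x \is a fin_num.
  rewrite ge0_fin_numE ?integral_ge0 //.
  apply: (@le_lt_trans _ _ I); last by rewrite ltey.
  apply: le_trans (le1 nnsfun0 _); first by rewrite sintegral0 add0e.
  by move=> x; rewrite erestrict_ge0.
rewrite -leeBrDr // (ge0_integralE _ f1); apply: ge_ereal_sup => _ [h1 hf1 <-].
by rewrite leeBrDr //; exact: le1.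
Qed.

End LowerIntegral.

(** * Hausdorff measure under dilations *)

Section HausdorffScaling.
Context {R : realType} {n : nat}.
Implicit Types (A C : set 'rV[R]_n) (k : nat) (l : R).

Import HBNNSimple.

Lemma diam_scale_le l C : 0 < l -> diam ((fun x => l *: x) @` C) <= l * diam C.
Proof.
move=> l0; rewrite /diam; set E := [set _ | _ in _]; set E' := [set _ | _ in _].
(* Where no supremum exists [sup] is 0 and the bound is trivial; otherwise boundedness passes from
   the dilated set back to [C]. *)
have [hE|hE] := pselect (has_sup E); last first.
  rewrite sup_out // mulr_ge0 ?(ltW l0) //; exact: diam_ge0.
apply: ge_sup; first by have [] := hE.
move=> _ [[_ _] /= [[x Cx <-] [y Cy <-]] <-].
rewrite -scalerBr enormZ gtr0_norm // ler_pM2l //.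
apply: ub_le_sup; last by exists (x, y).
have [_ [M ubM]] := hE; exists (l^-1 * M) => _ [[x' y'] /= [Cx' Cy'] <-].
rewrite -(ler_pM2l l0) mulrA divff ?gt_eqF // mul1r.
apply: ubM; exists (l *: x', l *: y'); first by split; [exists x'|exists y'].
by rewrite -scalerBr enormZ gtr0_norm.
Qed.

Lemma hausdorff_scale_le k l A : 0 < l ->
  (hausdorff k ((fun x => l *: x) @` A) <= (l ^+ k)%:E * hausdorff k A)%E.
Proof.
move=> l0; have lk0 : 0 < l ^+ k by exact: exprn_gt0.
apply: ge_ereal_sup => _ [e /= e0 <-].
apply: (@le_trans _ _ ((l ^+ k)%:E * hausdorff_delta k (l^-1 * e) A)%E); last first.
  by apply: lee_wpmul2l; [rewrite lee_fin ltW|apply: hausdorff_delta_le; rewrite mulr_gt0 ?invr_gt0].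
rewrite -lee_pdivrMl //; apply: le_ereal_inf_tmp => _ [C [AC sC] <-].
rewrite lee_pdivrMl //.
rewrite -nneseriesZl //; last by move=> i _; exact: hausdorff_size_ge0.
pose C' i := (fun x => l *: x) @` C i.
apply: (@le_trans _ _ (\sum_(0 <= i <oo) hausdorff_size k (C' i))%E).
  apply: ereal_inf_lbound; exists C' => //; split.
    by move=> _ [x /AC [i _ Cix] <-]; exists i => //; exists x.
  move=> i _ _ [x Cx <-] [y Cy <-]; rewrite -scalerBr enormZ gtr0_norm //.
  by rewrite -ler_pdivlMl //; exact: sC Cx Cy.
apply: lee_nneseries => i *; first exact: hausdorff_size_ge0.
rewrite /hausdorff_size; case: ifPn => [_|C'0].
  by case: ifPn => [|_]; rewrite ?mule0 // -EFinM lee_fin; rewrite !(mulr_ge0, exprn_ge0, ball_volume_ge0, divr_ge0, diam_ge0) // ltW.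
case: ifPn => [/eqP C0|_].
  by exfalso; move/eqP: C'0; apply; rewrite /C' C0 image_set0.
rewrite -EFinM lee_fin mulrCA ler_wpM2l ?ball_volume_ge0 // -exprMn.
rewrite lerXn2r ?nnegrE ?divr_ge0 ?mulr_ge0 ?diam_ge0 ?(ltW l0) //.
by rewrite mulrA ler_pM2r ?invr_gt0 // diam_scale_le.
Qed.

Lemma hausdorff_scale k l A : 0 < l ->
  (hausdorff k ((fun x => l *: x) @` A) = (l ^+ k)%:E * hausdorff k A)%E.
Proof.
move=> l0; apply/eqP; rewrite eq_le hausdorff_scale_le //=.
have li0 : 0 < l^-1 by rewrite invr_gt0.
have := hausdorff_scale_le k ((fun x => l *: x) @` A) li0.
rewrite image_comp (_ : _ \o _ = id) ?image_id; last first.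
  by apply/funext => x /=; rewrite scalerA mulVf ?scale1r ?gt_eqF.
by rewrite exprVn -lee_pdivlMl ?invr_gt0 ?exprn_gt0 // invrK.
Qed.

Lemma measurable_scaleRn l :
  measurable_fun setT (fun x : borelRn R n => l *: x : borelRn R n).
Proof.
apply: (@measurability _ _ (borelRn R n) (borelRn R n) _ _ (@open 'rV[R]_n)) => // _ [U oU <-].
rewrite setTI; apply: sub_sigma_algebra.
by apply: (@open_comp _ _ (fun x : 'rV[R]_n => l *: x)) => // x _; exact: scaler_continuous.
Qed.

(** As [g] need not be measurable, the change of variables is made on simple functions: one below
    l^k g(l x) on [G], composed with the inverse dilation and divided by l^k, lies below [g] on the
    dilated set. The inverse dilation pushes Hausdorff measure forward to l^k times itself. *)
Lemma hausdorff_integral_scale_le k l (G : set (borelRn R n))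
    (g : borelRn R n -> \bar R) : 0 < l -> measurable G ->
  (forall x, 0 <= g x)%E ->
  (\int[hausdorffB k]_(x in G) ((l ^+ k)%:E * g (l *: x)) <=
   \int[hausdorffB k]_(x in (fun x => l *: x) @` G) g x)%E.
Proof.
move=> l0 mG g0; have lk0 : 0 < l ^+ k by exact: exprn_gt0.
rewrite ge0_integralE; last by move=> x _; rewrite mule_ge0 // lee_fin ltW.
apply: ge_ereal_sup => _ [h hf <-]; rewrite -integralT_nnsfun.
pose phi (x : borelRn R n) : borelRn R n := l^-1 *: x.
have mphi : measurable_fun setT phi by exact: measurable_scaleRn.
have lk0' : 0 <= l ^+ k by exact: ltW.
have mh : measurable_fun setT (fun x => (h x)%:E) by exact/measurable_EFinP.
have scaled : (\int[hausdorffB k]_x (h (phi x))%:E =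
    (l ^+ k)%:E * \int[hausdorffB k]_x (h x)%:E)%E.
  transitivity (\int[mscale (NngNum lk0') (hausdorffB k)]_x (h x)%:E)%E; last first.
    by rewrite ge0_integral_mscale // => x _; rewrite lee_fin.
  transitivity (\int[pushforward (hausdorffB k) phi]_x (h x)%:E)%E.
    by rewrite ge0_integral_pushforward ?preimage_setT // => x _; rewrite lee_fin.
  apply: eq_measure_integral => B mB _.
  change (hausdorff k (phi @^-1` B) = (l ^+ k)%:E * hausdorff k B)%E.
  rewrite -hausdorff_scale //; congr hausdorff.
  apply/seteqP; split=> [x Bx|_ [x Bx <-]].
    by exists (phi x) => //; rewrite /phi scalerA divff ?scale1r // gt_eqF.
  by rewrite /preimage /phi /= scalerA mulVf ?scale1r // gt_eqF.
have -> : (\int[hausdorffB k]_x (h x)%:E =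
    \int[hausdorffB k]_x ((l ^+ k)^-1%:E * (h (phi x))%:E))%E.
  rewrite ge0_integralZl_EFin ?invr_ge0 //.
  - by rewrite scaled muleA -EFinM mulVf ?gt_eqF // mul1e.
  - by move=> x _; rewrite lee_fin.
  - by apply/measurable_EFinP; apply: measurableT_comp.
rewrite [leRHS]integral_mkcond; apply: ge0_le_lower_integral => x _.
  by rewrite mule_ge0 // lee_fin ?invr_ge0.
have := hf (phi x); rewrite /patch.
have -> : l *: phi x = x by rewrite /phi scalerA divff ?scale1r // gt_eqF.
have [Gx|nGx] := boolP (phi x \in G).
  rewrite mem_set => [hle|]; first by rewrite lee_pdivrMl.
  by exists (phi x); [exact: set_mem|rewrite /phi scalerA divff ?scale1r ?gt_eqF].
move=> hle; case: ifPn => [_|_].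
  by apply: le_trans (g0 x); rewrite pmule_rle0 // lte_fin invr_gt0.
by rewrite pmule_rle0 // lte_fin invr_gt0.
Qed.

End HausdorffScaling.

(** * Functions of class C^k *)

Section CkCalculus.
Context {R : realType}.

(* Scalar functions with [j] continuous derivatives on [D], phrased with
   explicit derivatives so that their junk values outside [D] do not matter. *)
Fixpoint scalar_Ck (j : nat) (D : set R) (g : R -> R) : Prop :=
  if j is j'.+1 then
    exists2 g', (forall s, D s -> is_derive s 1 g (g' s)) & scalar_Ck j' D g'
  else forall s, D s -> {for s, continuous g}.

Context {V : normedModType R}.
Implicit Types (f g : V -> R) (j : nat).

Lemma is_derive_comp_scalar f (g : R -> R) (l : R) x (v : V) :
  differentiable f x -> is_derive (f x) 1 g l ->
  is_derive x v (g \o f) (l * 'D_v f x).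
Proof.
move=> df [dg gl].
have dg' : differentiable g (f x) by exact/derivable1_diffP.
have dc : differentiable (g \o f) x by exact: differentiable_comp.
apply: DeriveDef; first exact: diff_derivable.
rewrite deriveE // diff_comp //= (deriv1E dg) /= derive1E gl.
by rewrite mulrC deriveE.
Qed.

Lemma differentiable_comp_scalar f (g : R -> R) (l : R) x :
  differentiable f x -> is_derive (f x) 1 g l -> differentiable (g \o f) x.
Proof.
by move=> df [dg _]; apply: differentiable_comp => //; exact/derivable1_diffP.
Qed.

Lemma Ck_differentiable (W : normedModType R) j (f : V -> W) x :
  Ck j.+1 setT f -> differentiable f x.
Proof. by case=> + _; apply. Qed.

Lemma Ck_continuous (W : normedModType R) j (f : V -> W) : Ck j setT f -> continuous f.
Proof.
case: j => [|j] cf x; first exact: cf.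
by apply: differentiable_continuous; exact: Ck_differentiable cf.
Qed.

Lemma Ck_derive (W : normedModType R) j (f : V -> W) v :
  Ck j.+1 setT f -> Ck j setT (fun x => 'D_v f x).
Proof. by case=> _; apply. Qed.

Lemma Ck_pred (W : normedModType R) j (f : V -> W) : Ck j.+1 setT f -> Ck j setT f.
Proof.
elim: j f => [|j IH] f cf; first by move=> x _; exact: (Ck_continuous cf).
by split=> [x _|v]; [exact: Ck_differentiable cf|apply: IH; exact: Ck_derive].
Qed.

Lemma Ck_cst (W : normedModType R) j (c : W) : Ck j setT (fun _ : V => c).
Proof.
elim: j c => [|j IH] c; first by move=> x _; exact: cst_continuous.
split=> [x _|v]; first exact: differentiable_cst.
by rewrite (_ : 'D_v _ = fun _ => 0) //; apply/funext => x; rewrite derive_cst.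
Qed.

Lemma CkD (W : normedModType R) j (f g : V -> W) :
  Ck j setT f -> Ck j setT g -> Ck j setT (fun x => f x + g x).
Proof.
elim: j f g => [|j IH] f g cf cg.
  by move=> x _; apply: continuousD; [exact: cf|exact: cg].
split=> [x _|v].
  by apply: differentiableD; [exact: Ck_differentiable cf|exact: Ck_differentiable cg].
rewrite (_ : 'D_v _ = fun x => 'D_v f x + 'D_v g x).
  by apply: IH; exact: Ck_derive.
apply/funext => x; apply: deriveD; apply: diff_derivable.
  exact: Ck_differentiable cf.
exact: Ck_differentiable cg.
Qed.

Lemma CkM j f g : Ck j setT f -> Ck j setT g -> Ck j setT (fun x => f x * g x).
Proof.
elim: j f g => [|j IH] f g cf cg.
  by move=> x _; apply: continuousM; [exact: cf|exact: cg].
split=> [x _|v].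
  by apply: differentiableM; [exact: Ck_differentiable cf|exact: Ck_differentiable cg].
rewrite (_ : 'D_v _ = fun x => f x * 'D_v g x + g x * 'D_v f x).
  by apply: CkD; apply: IH; [exact: Ck_pred|exact: Ck_derive|exact: Ck_pred|exact: Ck_derive].
apply/funext => x; apply: deriveM; apply: diff_derivable.
  exact: Ck_differentiable cf.
exact: Ck_differentiable cg.
Qed.

Lemma CkMl j (k : R) f : Ck j setT f -> Ck j setT (fun x => k * f x).
Proof. by move=> cf; apply: (CkM _ cf); exact: Ck_cst. Qed.

Lemma CkDc (W : normedModType R) j (c : W) (f : V -> W) :
  Ck j setT f -> Ck j setT (fun x => f x + c).
Proof. by move=> cf; apply: (CkD cf); exact: Ck_cst. Qed.

Lemma Ck_sum (W : normedModType R) j (m : nat) (F : 'I_m -> V -> W) :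
  (forall i, Ck j setT (F i)) -> Ck j setT (fun x => \sum_(i < m) F i x).
Proof.
move=> cF; elim: m F cF => [|m IH] F cF.
  rewrite (_ : (fun x => _) = fun _ => 0); first exact: Ck_cst.
  by apply/funext => x; rewrite big_ord0.
rewrite (_ : (fun x => _) = fun x => \sum_(i < m) F (widen_ord (leqnSn m) i) x + F ord_max x).
  by apply: CkD => //; exact: IH.
by apply/funext => x; rewrite big_ord_recr.
Qed.

Lemma CkZl (W : normedModType R) j f (w : W) :
  Ck j setT f -> Ck j setT (fun x => f x *: w).
Proof.
elim: j f => [|j IH] f cf.
  by move=> x _; apply: continuousZr_tmp; exact: cf.
split=> [x _|v]; first by apply: differentiableZl; exact: Ck_differentiable cf.
rewrite (_ : 'D_v _ = fun x => 'D_v f x *: w); first by apply: IH; exact: Ck_derive.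
apply/funext => x; rewrite deriveE; last first.
  by apply: differentiableZl; exact: Ck_differentiable cf.
rewrite diffZl; last exact: Ck_differentiable cf.
by rewrite deriveE //; exact: Ck_differentiable cf.
Qed.

Lemma Ck_comp j (D : set R) (g : R -> R) f :
  scalar_Ck j D g -> (forall x, D (f x)) -> Ck j setT f -> Ck j setT (fun x => g (f x)).
Proof.
elim: j g f => [|j IH] g f cg Df cf.
  by move=> x _; apply: continuous_comp; [exact: cf|exact: cg].
have [g' dg cg'] := cg.
split=> [x _|v].
  by apply: differentiable_comp_scalar (dg _ (Df x)); exact: Ck_differentiable cf.
rewrite (_ : 'D_v _ = fun x => g' (f x) * 'D_v f x).
  by apply: CkM; [apply: IH => //; exact: Ck_pred|exact: Ck_derive].
apply/funext => x; have /(is_derive_comp_scalar v) := Ck_differentiable x cf.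
by move=> /(_ _ _ (dg _ (Df x))) [_ <-].
Qed.

Lemma Ck_linear (W : normedModType R) j (f : V -> W) :
  linear f -> continuous f -> Ck j setT f.
Proof.
move=> lf cf.
pose L : {linear V -> W} := HB.pack f (GRing.isLinear.Build _ _ _ _ f lf).
have dL x : differentiable f x by exact: (@linear_differentiable _ _ _ L).
case: j => [|j]; first by move=> x _; exact: cf.
split=> [x _|v]; first exact: dL.
rewrite (_ : 'D_v _ = fun _ => f v); first exact: Ck_cst.
by apply/funext => x; rewrite deriveE // (@diff_lin _ _ _ L).
Qed.

End CkCalculus.

Section ScalarDerivatives.
Context {R : realType}.
Implicit Types (f g : R -> R) (x k : R).

Lemma dereq f x (d d' : R) : is_derive x (1 : R) f d -> d = d' -> is_derive x (1 : R) f d'.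
Proof. by move=> ? <-. Qed.

Lemma derD f g x (df dg : R) : is_derive x (1 : R) f df -> is_derive x (1 : R) g dg ->
  is_derive x (1 : R) (fun z => f z + g z) (df + dg).
Proof. exact: is_deriveD. Qed.

Lemma derM f g x (df dg : R) : is_derive x (1 : R) f df -> is_derive x (1 : R) g dg ->
  is_derive x (1 : R) (fun z => f z * g z) (f x * dg + g x * df).
Proof. exact: is_deriveM. Qed.

Lemma derC (c : R) x : is_derive x (1 : R) (fun _ => c) (0 : R).
Proof. exact: is_derive_cst. Qed.

Lemma derI x : is_derive x (1 : R) (fun z => z) (1 : R).
Proof. exact: is_derive_id. Qed.

Lemma derMl k f x (df : R) : is_derive x (1 : R) f df ->
  is_derive x (1 : R) (fun z => k * f z) (k * df).
Proof. by move=> h; apply: dereq (derM (derC k x) h) _; rewrite mulr0 addr0. Qed.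

Lemma derDc f x c (df : R) : is_derive x (1 : R) f df ->
  is_derive x (1 : R) (fun z => f z + c) df.
Proof. by move=> h; apply: dereq (derD h (derC c x)) _; rewrite addr0. Qed.

Lemma dercomp g f x (df dg : R) : is_derive x (1 : R) g dg -> is_derive (g x) (1 : R) f df ->
  is_derive x (1 : R) (fun z => f (g z)) (df * dg).
Proof. by move=> ? ?; exact: is_derive1_comp. Qed.

Lemma der_continuous f x (df : R) : is_derive x (1 : R) f df -> {for x, continuous f}.
Proof. by move=> [dd _]; apply: differentiable_continuous; apply/derivable1_diffP. Qed.

End ScalarDerivatives.

(** * The cutoff *)

Section PositivePart.
Context {R : realType}.

Definition pos (x : R) : R := Num.max 0 x.

Lemma pos_ge0 x : 0 <= pos x. Proof. by rewrite /pos le_max lexx. Qed.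

Lemma posE x : 0 <= x -> pos x = x. Proof. by move=> x0; exact/max_idPr. Qed.

Lemma pos0 x : x <= 0 -> pos x = 0. Proof. by move=> x0; exact/max_idPl. Qed.

Lemma continuous_pos : continuous pos.
Proof. by move=> x; apply: continuous_max; [exact: cst_continuous|exact: cvg_id]. Qed.

(** Meant for [pos z ^+ 2], whose two formulas meet at 0: an error bound valid for all [z] spares
    any discussion of neighbourhoods of the kink. *)
Lemma is_derive_quadratic_error (f : R -> R) x l (C : R) :
  (forall z, `|f z - f x - l * (z - x)| <= C * (z - x) ^+ 2) -> is_derive x 1 f l.
Proof.
move=> fC; apply/is_derive1_caratheodory.
exists (fun z => if z == x then l else (f z - f x) / (z - x)); split; last by rewrite eqxx.
  by move=> z; case: eqP => [->|/eqP]; [rewrite !subrr mulr0|rewrite -subr_eq0 => /divfK].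
rewrite /prop_for /continuous_at eqxx; apply/cvgrPdist_le => /= e e0; near=> z.
have C0 : 0 <= `|C| + 1 by apply: addr_ge0.
have [_|zx] := eqVneq z x; first by rewrite subrr normr0 ltW.
have zx0 : 0 < `|z - x| by rewrite normr_gt0 subr_eq0.
have zxn : z - x != 0 by rewrite -normr_gt0.
rewrite distrC -(ler_pM2r zx0) -normrM mulrBl divfK //.
apply: le_trans (fC z) _.
rewrite -(real_normK (num_real (z - x))) expr2 mulrA ler_pM2r //.
apply: (@le_trans _ _ ((`|C| + 1) * `|z - x|)).
  by rewrite ler_wpM2r // (le_trans (ler_norm C)) // lerDl.
rewrite mulrC -ler_pdivlMr; last by rewrite ltr_wpDl.
rewrite distrC; near: z; apply: cvgr_dist_le; [exact: cvg_id|].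
by rewrite divr_gt0 // ltr_wpDl.
Unshelve. all: by end_near. Qed.

Lemma is_derive_pos2 (x : R) : is_derive x (1 : R) (fun z => pos z ^+ 2) (2 * pos x).
Proof.
apply: (@is_derive_quadratic_error _ _ _ 1) => z; rewrite mul1r.
have z2 := sqr_ge0 z; have x2 := sqr_ge0 x; have zx2 := sqr_ge0 (z - x).
rewrite ler_norml; have [x0|x0] := lerP 0 x; have [z0|z0] := lerP 0 z.
- by rewrite !posE //; apply/andP; split; nra.
- have xz : 0 <= x * - z by rewrite mulr_ge0 // oppr_ge0 ltW.
  by rewrite (posE x0) (pos0 (ltW z0)); apply/andP; split; nra.
- have xz : 0 <= z * - x by rewrite mulr_ge0 // oppr_ge0 ltW.
  by rewrite (posE z0) (pos0 (ltW x0)); apply/andP; split; nra.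
- by rewrite (pos0 (ltW z0)) (pos0 (ltW x0)); apply/andP; split; nra.
Qed.

Lemma pos3E z : pos z ^+ 3 = z * pos z ^+ 2.
Proof.
have [z0|z0] := lerP 0 z; first by rewrite posE // exprS.
by rewrite pos0 ?ltW // !expr0n mulr0.
Qed.

Lemma is_derive_pos3 (x : R) : is_derive x (1 : R) (fun z => pos z ^+ 3) (3 * pos x ^+ 2).
Proof.
rewrite (_ : (fun z => pos z ^+ 3) = fun z => z * pos z ^+ 2); last first.
  by apply/funext => z; rewrite pos3E.
apply: dereq (derM (derI x) (is_derive_pos2 x)) _; rewrite mulr1 mulrCA.
have -> : x * pos x = pos x ^+ 2.
  have [x0|x0] := lerP 0 x; first by rewrite posE // expr2.
  by rewrite pos0 ?ltW // expr0n mulr0.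
ring.
Qed.

End PositivePart.

Section Profile.
Context {R : realType}.
Variables (r : R) (N : nat).

(* [ramp] vanishes up to [r], is affine with slope 6 after [r + 2], and its
   second derivative is a tent on [r, r + 2]. *)
Definition ramp (w : R) : R :=
  pos (w - r) ^+ 3 - 2 * pos (w - r - 1) ^+ 3 + pos (w - r - 2) ^+ 3.
Definition ramp1 (w : R) : R :=
  3 * (pos (w - r) ^+ 2 - 2 * pos (w - r - 1) ^+ 2 + pos (w - r - 2) ^+ 2).
Definition ramp2 (w : R) : R :=
  6 * (pos (w - r) - 2 * pos (w - r - 1) + pos (w - r - 2)).

Lemma is_derive_pos_shift (k : nat) (g : R -> R) (c x : R) :
  (forall y : R, is_derive y (1 : R) (fun z => pos z ^+ k) (g y)) ->
  is_derive x (1 : R) (fun z => pos (z - c) ^+ k) (g (x - c)).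
Proof.
move=> dg; have dl : is_derive x (1 : R) (fun z => z - c) (1 : R) := derDc (- c) (derI x).
by have := dercomp dl (dg _); rewrite mulr1.
Qed.

Lemma is_derive_ramp (x : R) : is_derive x (1 : R) ramp (ramp1 x).
Proof.
have d0 := @is_derive_pos_shift 3 _ r x is_derive_pos3.
have d1 := @is_derive_pos_shift 3 _ (r + 1) x is_derive_pos3.
have d2 := @is_derive_pos_shift 3 _ (r + 2) x is_derive_pos3.
rewrite (_ : ramp = fun z => pos (z - r) ^+ 3 + (-2 * pos (z - (r + 1)) ^+ 3
   + pos (z - (r + 2)) ^+ 3)); last first.
  by apply/funext => z; rewrite /ramp !opprD !addrA; ring.
apply: dereq (derD d0 (derD (derMl (-2) d1) d2)) _.
by rewrite /ramp1 !opprD !addrA; ring.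
Qed.

Lemma is_derive_ramp1 (x : R) : is_derive x (1 : R) ramp1 (ramp2 x).
Proof.
have d0 := @is_derive_pos_shift 2 _ r x is_derive_pos2.
have d1 := @is_derive_pos_shift 2 _ (r + 1) x is_derive_pos2.
have d2 := @is_derive_pos_shift 2 _ (r + 2) x is_derive_pos2.
rewrite (_ : ramp1 = fun z => 3 * (pos (z - r) ^+ 2 + (-2 * pos (z - (r + 1)) ^+ 2
   + pos (z - (r + 2)) ^+ 2))); last first.
  by apply/funext => z; rewrite /ramp1 !opprD !addrA; ring.
apply: dereq (derMl 3 (derD d0 (derD (derMl (-2) d1) d2))) _.
by rewrite /ramp2 !opprD !addrA; ring.
Qed.

Lemma continuous_ramp2 : continuous ramp2.
Proof.
have cp c : continuous (fun w : R => pos (w - c)).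
  move=> w; apply: (@continuous_comp _ _ _ (fun w : R => w - c) pos); last exact: continuous_pos.
  by apply: continuousB; [exact: cvg_id|exact: cst_continuous].
rewrite (_ : ramp2 = fun w => 6 * (pos (w - r) - 2 * pos (w - (r + 1)) + pos (w - (r + 2)))).
  move=> w; apply: cvgM; first exact: cvg_cst.
  apply: cvgD; last exact: cp.
  by apply: cvgB; [exact: cp|apply: cvgM; [exact: cvg_cst|exact: cp]].
by apply/funext => w; rewrite /ramp2 !opprD !addrA.
Qed.

Lemma ramp_le_r w : w <= r -> (ramp w = 0) * (ramp1 w = 0) * (ramp2 w = 0).
Proof.
move=> wr; have z0 : pos (w - r) = 0 by apply: pos0; lra.
have z1 : pos (w - r - 1) = 0 by apply: pos0; lra.
have z2 : pos (w - r - 2) = 0 by apply: pos0; lra.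
by rewrite /ramp /ramp1 /ramp2 z0 z1 z2; split; [split|]; ring.
Qed.

Lemma ramp_ge_r2 w : r + 2 <= w ->
  (ramp w = 6 * (w - r - 1)) * (ramp1 w = 6) * (ramp2 w = 0).
Proof.
move=> wr; have z0 : pos (w - r) = w - r by apply: posE; lra.
have z1 : pos (w - r - 1) = w - r - 1 by apply: posE; lra.
have z2 : pos (w - r - 2) = w - r - 2 by apply: posE; lra.
by rewrite /ramp /ramp1 /ramp2 z0 z1 z2; split; [split|]; ring.
Qed.

Lemma ramp_ge0 w : 0 <= ramp w.
Proof.
have [wr|wr] := lerP w r; first by rewrite ramp_le_r.
have [wr2|wr2] := lerP (r + 2) w; first by rewrite ramp_ge_r2 //; lra.
have z0 : pos (w - r) = w - r by apply: posE; lra.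
have z2 : pos (w - r - 2) = 0 by apply: pos0; lra.
rewrite /ramp z0 z2 expr0n addr0; set y := w - r.
have y0 : 0 < y by rewrite /y; lra. have y2 : y < 2 by rewrite /y; lra.
have [z1|z1] := lerP 0 (y - 1).
  have -> : y ^+ 3 - 2 * pos (y - 1) ^+ 3 = 1 + 3 * (y - 1) + (y - 1) ^+ 2 * (4 - y).
    by rewrite (posE z1); ring.
  have := mulr_ge0 (sqr_ge0 (y - 1)) (_ : 0 <= 4 - y).
  by lra.
by rewrite (pos0 (ltW z1)) expr0n mulr0 subr0 exprn_ge0 // ltW.
Qed.

Lemma ramp1_bounds w : 0 <= ramp1 w <= 6.
Proof.
have [wr|wr] := lerP w r; first by rewrite ramp_le_r // lexx ler0n.
have [wr2|wr2] := lerP (r + 2) w; first by rewrite ramp_ge_r2 // lexx ler0n.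
have z0 : pos (w - r) = w - r by apply: posE; lra.
have z2 : pos (w - r - 2) = 0 by apply: pos0; lra.
rewrite /ramp1 z0 z2 expr0n addr0; set y := w - r.
have y0 : 0 < y by rewrite /y; lra. have y2 : y < 2 by rewrite /y; lra.
have [z1|z1] := lerP 0 (y - 1).
  by rewrite (posE z1); apply/andP; split; nra.
by rewrite (pos0 (ltW z1)) expr0n mulr0 subr0; apply/andP; split; nra.
Qed.

Lemma ramp2_bounds w : 0 <= ramp2 w <= 6.
Proof.
have [wr|wr] := lerP w r; first by rewrite ramp_le_r // lexx ler0n.
have [wr2|wr2] := lerP (r + 2) w; first by rewrite ramp_ge_r2 // lexx ler0n.
have z0 : pos (w - r) = w - r by apply: posE; lra.
have z2 : pos (w - r - 2) = 0 by apply: pos0; lra.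
rewrite /ramp2 z0 z2 addr0; set y := w - r.
have y0 : 0 < y by rewrite /y; lra. have y2 : y < 2 by rewrite /y; lra.
have [z1|z1] := lerP 0 (y - 1).
  by rewrite (posE z1); apply/andP; split; lra.
by rewrite (pos0 (ltW z1)); apply/andP; split; lra.
Qed.

(** The cube gives class C^2. Being a convex decreasing function of [ramp], the cutoff has a second
    derivative whose only negative term is the one with [ramp2]: it lives on [r, r + 2] for every
    [N] and carries a factor 1/(N+1). *)
Definition cutoff (w : R) : R := pos (1 - ramp w / N.+1%:R) ^+ 3.
Definition cutoff1 (w : R) : R :=
  - (3 * pos (1 - ramp w / N.+1%:R) ^+ 2 * (ramp1 w / N.+1%:R)).
Definition cutoff2 (w : R) : R :=
  6 * pos (1 - ramp w / N.+1%:R) * (ramp1 w / N.+1%:R) ^+ 2 -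
  3 * pos (1 - ramp w / N.+1%:R) ^+ 2 * (ramp2 w / N.+1%:R).

Let d := N.+1%:R : R.
Let d0 : 0 < d. Proof. by rewrite ltr0n. Qed.

Lemma is_derive_level (x : R) :
  is_derive x (1 : R) (fun w => 1 - ramp w / d) (- (ramp1 x / d)).
Proof.
rewrite (_ : (fun w => _) = fun w => - d^-1 * ramp w + 1); last first.
  by apply/funext => z; rewrite mulNr mulrC addrC.
by apply: dereq (derDc 1 (derMl (- d^-1) (is_derive_ramp x))) _; rewrite mulNr mulrC.
Qed.

Lemma is_derive_pos_level (k : nat) (g : R -> R) (x : R) :
  (forall y : R, is_derive y (1 : R) (fun z => pos z ^+ k) (g y)) ->
  is_derive x (1 : R) (fun w => pos (1 - ramp w / d) ^+ k)
   (g (1 - ramp x / d) * - (ramp1 x / d)).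
Proof. by move=> dg; exact: dercomp (is_derive_level x) (dg _). Qed.

Lemma is_derive_cutoff (x : R) : is_derive x (1 : R) cutoff (cutoff1 x).
Proof.
have := is_derive_pos_level x is_derive_pos3.
by rewrite /cutoff1 -/d mulrN.
Qed.

Lemma is_derive_cutoff1 (x : R) : is_derive x (1 : R) cutoff1 (cutoff2 x).
Proof.
have d1 := is_derive_pos_level x is_derive_pos2.
have d2 := is_derive_ramp1 x.
rewrite (_ : cutoff1 = fun w => - (3 / d) * (pos (1 - ramp w / d) ^+ 2 * ramp1 w)); last first.
  by apply/funext => z; rewrite /cutoff1 -/d; ring.
apply: dereq (derMl _ (derM d1 d2)) _; rewrite /cutoff2 -/d.
by ring.
Qed.

Lemma continuous_cutoff2 : continuous cutoff2.
Proof.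
have cl : continuous (fun w => pos (1 - ramp w / d)).
  move=> w; apply: (@continuous_comp _ _ _ (fun w : R => 1 - ramp w / d) pos).
    exact: der_continuous (is_derive_level w).
  exact: continuous_pos.
have c1 : continuous ramp1.
  by move=> w; exact: der_continuous (is_derive_ramp1 w).
have c2 := continuous_ramp2.
rewrite (_ : cutoff2 = fun w => (6 / d / d) * (pos (1 - ramp w / d) * (ramp1 w * ramp1 w)) -
  (3 / d) * ((pos (1 - ramp w / d) * pos (1 - ramp w / d)) * ramp2 w)); last first.
  by apply/funext => z; rewrite /cutoff2 -/d; ring.
move=> w; apply: cvgB; apply: cvgM; first exact: cvg_cst.
- by apply: cvgM; [exact: cl|apply: cvgM; exact: c1].
- exact: cvg_cst.
- by apply: cvgM; [apply: cvgM; exact: cl|exact: c2].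
Qed.

Lemma scalar_Ck_cutoff : scalar_Ck 2 setT cutoff.
Proof.
exists cutoff1; first by move=> s _; exact: is_derive_cutoff.
exists cutoff2; first by move=> s _; exact: is_derive_cutoff1.
by move=> s _; exact: continuous_cutoff2.
Qed.

Lemma level_bounds w : 0 <= pos (1 - ramp w / d) <= 1.
Proof.
rewrite pos_ge0 /= /pos ge_max ler01 /= lerBlDr lerDl.
by rewrite divr_ge0 ?ramp_ge0 // ltW.
Qed.

Lemma cutoff_bounds w : 0 <= cutoff w <= 1.
Proof.
have /andP[l0 l1] := level_bounds w.
by rewrite /cutoff -/d exprn_ge0 //= exprn_ile1.
Qed.

Lemma cutoff_le_r w : w <= r -> (cutoff w = 1) * (cutoff1 w = 0) * (cutoff2 w = 0).
Proof.
move=> wr; rewrite /cutoff /cutoff1 /cutoff2 !(ramp_le_r wr) mul0r subr0.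
by rewrite posE //; split; [split|]; ring.
Qed.

(** A convenient bound, not the sharp one: there [ramp] is already 6 (N + 2), beyond the level N + 1
    at which the cutoff vanishes. *)
Definition radius : R := r + 2 + d.

Lemma cutoff_radius w : radius <= w ->
  (cutoff w = 0) * (cutoff1 w = 0) * (cutoff2 w = 0).
Proof.
move=> wr; have w2 : r + 2 <= w by apply: le_trans wr; rewrite /radius lerDl ltW.
have z : pos (1 - ramp w / d) = 0.
  apply: pos0; rewrite subr_le0 ler_pdivlMr // mul1r (ramp_ge_r2 w2).
  by move: wr; rewrite /radius; have := d0; lra.
by rewrite /cutoff /cutoff1 /cutoff2 -/d z; split; [split|]; ring.
Qed.

Lemma cutoff1_bounds w : -18 <= cutoff1 w <= 0.
Proof.
have /andP[l0 l1] := level_bounds w; have /andP[r0 r6] := ramp1_bounds w.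
rewrite /cutoff1 -/d; set l := pos _ in l0 l1 *; set q := ramp1 w / d.
have q0 : 0 <= q by rewrite divr_ge0 // ltW.
have q6 : q <= 6.
  rewrite ler_pdivrMr // (le_trans r6) // ler_peMr // ?ler1n //.
have ll : 0 <= l ^+ 2 <= 1 by rewrite exprn_ge0 //= exprn_ile1.
case/andP: ll => ll0 ll1.
have := mulr_ge0 ll0 q0; have := ler_pM ll0 q0 ll1 q6.
by rewrite mul1r => h1 h2; apply/andP; split; rewrite -mulrA; lra.
Qed.

(** Here 216 = 6 * 6^2, from [ramp1] being at most 6. The bound does not decay in [N]; it only
    serves integrability. *)
Lemma cutoff2_upper w : cutoff2 w <= 216.
Proof.
have /andP[l0 l1] := level_bounds w; have /andP[r0 r6] := ramp1_bounds w.
have /andP[s0 s6] := ramp2_bounds w.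
rewrite /cutoff2 -/d; set l := pos _ in l0 l1 *; set q := ramp1 w / d.
have q0 : 0 <= q by rewrite divr_ge0 // ltW.
have q6 : q <= 6.
  rewrite ler_pdivrMr // (le_trans r6) // ler_peMr // ?ler1n //.
have p0 : 0 <= 3 * l ^+ 2 * (ramp2 w / d).
  by rewrite mulr_ge0 ?divr_ge0 ?(ltW d0) // mulr_ge0 // exprn_ge0.
have qq : q ^+ 2 <= 6 ^+ 2 by rewrite lerXn2r ?nnegrE.
have := ler_pM l0 (sqr_ge0 q) l1 qq; rewrite mul1r -[6 * l * _]mulrA.
set y := l * _; have -> : (6 : R) ^+ 2 = 36 by ring.
by move: p0; set z := 3 * _ * _; lra.
Qed.

(** The negative term is at most 3 * 6 / (N + 1), as the level is at most 1 and [ramp2] at most 6.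
    This decay in [N] is what removes the interior error in the limit. *)
Lemma cutoff2_lower w : - (18 / d) <= cutoff2 w.
Proof.
have /andP[l0 l1] := level_bounds w; have /andP[s0 s6] := ramp2_bounds w.
rewrite /cutoff2 -/d; set l := pos _ in l0 l1 *; set q := ramp1 w / d.
have p0 : 0 <= 6 * l * q ^+ 2 by rewrite mulr_ge0 ?sqr_ge0 // mulr_ge0.
have ll : 0 <= l ^+ 2 <= 1 by rewrite exprn_ge0 //= exprn_ile1.
case/andP: ll => ll0 ll1.
have sd0 : 0 <= ramp2 w / d by rewrite divr_ge0 // ltW.
have sd6 : ramp2 w / d <= 6 / d by rewrite ler_pM2r ?invr_gt0.
have := ler_pM ll0 sd0 ll1 sd6; rewrite mul1r -[3 * _ * _]mulrA => h.
have -> : 18 / d = 3 * (6 / d) by ring.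
move: p0 h; rewrite -[6 * l * _]mulrA; set y := l * _; set z := l ^+ 2 * _.
by set u := 6 / d; lra.
Qed.

(** Past the bend the ramp is affine, and the cutoff is a convex function of it. *)
Lemma cutoff2_ge0 w : r + 2 <= w -> 0 <= cutoff2 w.
Proof.
move=> wr; have /andP[l0 l1] := level_bounds w.
have r20 : ramp2 w = 0 by rewrite (ramp_ge_r2 wr).
rewrite /cutoff2 r20 mul0r mulr0 subr0.
by rewrite mulr_ge0 ?sqr_ge0 // mulr_ge0.
Qed.

End Profile.

(** For monotone convergence at the final time. *)
Lemma cutoff_nondecreasing {R : realType} (r w : R) : nondecreasing_seq (fun N => cutoff r N w).
Proof.
move=> N N' NN'; rewrite /cutoff lerXn2r ?nnegrE ?pos_ge0 //.
rewrite /pos ge_max !le_max lexx /= lerB ?orbT //.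
by rewrite ler_wpM2l ?ramp_ge0 // lef_pV2 ?posrE ?ltr0n // ler_nat.
Qed.

Lemma cutoff_cvg {R : realType} (r w : R) : cutoff r N w @[N --> \oo] --> (1 : R).
Proof.
rewrite /cutoff; have c0 : ramp r w / N.+1%:R @[N --> \oo] --> (0 : R).
  by rewrite -[X in _ --> X](mulr0 (ramp r w)); apply: cvgMr; exact: cvg_harmonic.
have c1 : 1 - ramp r w / N.+1%:R @[N --> \oo] --> (1 : R).
  by rewrite -[X in _ --> X]subr0; apply: cvgB => //; exact: cvg_cst.
have c2 : pos (1 - ramp r w / N.+1%:R) @[N --> \oo] --> pos (1 : R).
  by apply: continuous_cvg => //; exact: continuous_pos.
under eq_fun do rewrite !exprS expr0 mulr1.
have e : pos 1 * (pos 1 * pos 1) = 1 :> R by rewrite posE // !mulr1.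
by rewrite -[X in nbhs X]e; apply: cvgM => //; exact: cvgM.
Qed.

(** * The test function *)

Section TimeProfile.
Context {R : realType}.
Variable b : R.
Hypothesis b0 : b < 0.

(* A positive function of class C^2 on the whole line that equals [- t] for
   [t <= b]; test functions must be C^2 on all of R^n x R. *)
Definition tau (t : R) : R := - t + (b ^+ 2)^-1 * pos (t - b) ^+ 3.
Definition tau1 (t : R) : R := -1 + (b ^+ 2)^-1 * (3 * pos (t - b) ^+ 2).
Definition tau2 (t : R) : R := (b ^+ 2)^-1 * (6 * pos (t - b)).

Lemma tauE t : t <= b -> tau t = - t.
Proof. by move=> tb; rewrite /tau pos0 ?subr_le0 // expr0n mulr0 addr0. Qed.

Lemma tau1E t : t <= b -> tau1 t = -1.
Proof. by move=> tb; rewrite /tau1 pos0 ?subr_le0 // expr0n !mulr0 addr0. Qed.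

(** The coefficient b^-2 makes the cubic win in time. With s = t - b, b^2 tau is b^2 (-b - s) + s^3
    for s > 0; the first term is nonnegative up to s = -b, and afterwards the sum factors as -b^3 +
    s (s - b) (s + b). *)
Lemma tau_gt0 t : 0 < tau t.
Proof.
have [tb|bt] := lerP t b; first by rewrite tauE //; move: b0; lra.
rewrite /tau posE ?subr_ge0 ?ltW //; set s := t - b.
have s0 : 0 < s by rewrite /s subr_gt0.
have b2 : 0 < b ^+ 2 by rewrite exprn_even_gt0 //= lt_eqF.
rewrite -(pmulr_rgt0 _ b2) mulrDr mulrA divff ?gt_eqF // mul1r.
have -> : t = s + b by rewrite /s subrK.
have [sb|sb] := lerP s (- b).
  have h0 : 0 <= b ^+ 2 * (- b - s) by rewrite mulr_ge0 ?(ltW b2) //; lra.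
  have h1 : 0 < s ^+ 3 by rewrite exprn_gt0.
  by have -> : b ^+ 2 * - (s + b) = b ^+ 2 * (- b - s) by [ring]; lra.
have -> : b ^+ 2 * - (s + b) + s ^+ 3 = - b ^+ 3 + s * (s - b) * (s + b) by ring.
have h1 : 0 < (- b) ^+ 3 by rewrite exprn_gt0 // oppr_gt0.
have h2 : 0 < s * (s - b) * (s + b) by rewrite !mulr_gt0 //; move: b0; lra.
by have : (- b) ^+ 3 = - b ^+ 3 by [ring]; lra.
Qed.

Lemma is_derive_tau (t : R) : is_derive t (1 : R) tau (tau1 t).
Proof.
have d3 := @is_derive_pos_shift R 3 _ b t is_derive_pos3.
rewrite (_ : tau = fun z => -1 * z + (b ^+ 2)^-1 * pos (z - b) ^+ 3); last first.
  by apply/funext => z; rewrite mulN1r.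
by apply: dereq (derD (derMl (-1) (derI t)) (derMl _ d3)) _; rewrite mulr1.
Qed.

Lemma is_derive_tau1 (t : R) : is_derive t (1 : R) tau1 (tau2 t).
Proof.
have d3 := @is_derive_pos_shift R 2 _ b t is_derive_pos2.
rewrite (_ : tau1 = fun z => ((b ^+ 2)^-1 * 3) * pos (z - b) ^+ 2 + -1); last first.
  by apply/funext => z; rewrite /tau1 mulrA addrC.
by apply: dereq (derDc _ (derMl _ d3)) _; rewrite /tau2; ring.
Qed.

Lemma scalar_Ck_tau : scalar_Ck 2 setT tau.
Proof.
exists tau1; first by move=> s _; exact: is_derive_tau.
exists tau2; first by move=> s _; exact: is_derive_tau1.
move=> s _; apply: cvgM; first exact: cvg_cst.
apply: cvgM; first exact: cvg_cst.
apply: (@continuous_comp _ _ _ (fun w : R => w - b) pos); last exact: continuous_pos.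
by apply: continuousB; [exact: cvg_id|exact: cst_continuous].
Qed.

End TimeProfile.

Section ScalarCk.
Context {R : realType}.

Lemma scalar_Ck_expR j : scalar_Ck j setT (@expR R).
Proof.
elim: j => [|j IH]; first by move=> s _; exact: continuous_expR.
by exists expR => // s _; exact: is_derive_expR.
Qed.

Lemma scalar_Ck2_inv : scalar_Ck 2 [set s : R | 0 < s] (fun s => s^-1).
Proof.
have cV (s : R) : 0 < s -> {for s, continuous (fun s : R => s^-1)}.
  by move=> s0; apply: inv_continuous; rewrite gt_eqF.
have dV (s : R) : 0 < s -> is_derive s (1 : R) (fun s : R => s^-1) (- s^-1 ^+ 2).
  move=> s0; have := @is_deriveV R id s 1 1.
  by rewrite exprVn /GRing.scale /= mulr1; apply; rewrite ?gt_eqF.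
exists (fun s => - s^-1 ^+ 2) => //.
exists (fun s => 2 * s^-1 ^+ 3).
  move=> s s0; have dVs := dV s s0.
  rewrite (_ : (fun s => _) = fun s => -1 * (s^-1 * s^-1)); last first.
    by apply/funext => z; rewrite mulN1r expr2.
  by apply: dereq (derMl (-1) (derM dVs dVs)) _; ring.
move=> s s0; apply: cvgM; first exact: cvg_cst.
rewrite /continuous_at; under eq_fun do rewrite !exprS expr0 mulr1.
rewrite !exprS expr0 mulr1.
by apply: cvgM; [exact: cV|apply: cvgM; exact: cV].
Qed.

Lemma scalar_Ck2_ln : scalar_Ck 2 [set s : R | 0 < s] (@ln R).
Proof.
have [g dg [h dh _]] := scalar_Ck2_inv.
exists (fun s => s^-1); first by move=> s s0; exact: is_derive1_ln.
by exists g => // s s0; exact: der_continuous (dh s s0).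
Qed.

End ScalarCk.

Section TestFunction.
Context {R : realType} {n : nat}.
Variables (m : nat) (a b r : R) (N : nat).
Hypothesis b0 : b < 0.

Local Notation cut := (cutoff r N).
Local Notation cut1 := (cutoff1 r N).
Local Notation cut2 := (cutoff2 r N).

(* The backward heat kernel, with [s] in place of |x|^2. *)
Definition kernel (s t : R) : R :=
  expR (- (m%:R / 2) * ln (4 * pi * tau b t)) * expR (- (s * (4 * tau b t)^-1)).

(* |x|^2 + 2 m t solves the heat equation on an m-dimensional flow, so that a
   cutoff in this variable contributes only its second derivative. *)
Definition shifted (s t : R) : R := s + 2 * m%:R * (t - a).

Definition test (p : 'rV[R]_n * R) : R :=
  cut (shifted (dot p.1 p.1) p.2) * kernel (dot p.1 p.1) p.2.

Lemma Ck_sqnorm_fst j : Ck j setT (fun p : 'rV[R]_n * R => dot p.1 p.1).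
Proof.
rewrite /dot; apply: Ck_sum => i; apply: CkM; apply: Ck_linear.
- by move=> k [x s] [y t] /=; rewrite !mxE.
- move=> p; apply: (@continuous_comp _ _ _ fst (fun x : 'rV[R]_n => x 0 i)); first exact: cvg_fst.
  exact: coord_continuous.
- by move=> k [x s] [y t] /=; rewrite !mxE.
- move=> p; apply: (@continuous_comp _ _ _ fst (fun x : 'rV[R]_n => x 0 i)); first exact: cvg_fst.
  exact: coord_continuous.
Qed.

Lemma Ck_snd j : Ck j setT (fun p : 'rV[R]_n * R => p.2).
Proof. by apply: Ck_linear => // p; exact: cvg_snd. Qed.

Lemma Ck_test : Ck 2 setT test.
Proof.
have c1 : Ck 2 setT (fun p : 'rV[R]_n * R => shifted (dot p.1 p.1) p.2).
  exact: (CkD (Ck_sqnorm_fst 2) (CkMl (2 * m%:R) (CkDc (- a) (Ck_snd 2)))).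
have c2 : Ck 2 setT (fun p : 'rV[R]_n * R => cut (shifted (dot p.1 p.1) p.2)).
  exact: (@Ck_comp _ _ 2 setT cut _ (scalar_Ck_cutoff r N)).
have ctau : Ck 2 setT (fun p : 'rV[R]_n * R => tau b p.2).
  exact: (@Ck_comp _ _ 2 setT (tau b) (fun p : 'rV[R]_n * R => p.2) (scalar_Ck_tau b) (fun _ => I) (Ck_snd 2)).
have pi40 : 0 < 4 * pi :> R by rewrite mulr_gt0 ?pi_gt0.
have pos1 (k : R) (p : 'rV[R]_n * R) : 0 < k -> 0 < k * tau b p.2.
  by move=> k0; rewrite mulr_gt0 // tau_gt0.
have c3 := @Ck_comp _ _ 2 [set s : R | 0 < s] (@ln R) (fun p : 'rV[R]_n * R => 4 * pi * tau b p.2)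
  scalar_Ck2_ln (fun p => pos1 _ p pi40) (CkMl (4 * pi) ctau).
have four0 : 0 < 4 :> R by [].
have c4 := @Ck_comp _ _ 2 [set s : R | 0 < s] _ (fun p : 'rV[R]_n * R => 4 * tau b p.2)
  scalar_Ck2_inv (fun p => pos1 _ p four0) (CkMl 4 ctau).
have c5 := @Ck_comp _ _ 2 setT _ (fun p : 'rV[R]_n * R => - (m%:R / 2) * ln (4 * pi * tau b p.2))
  (scalar_Ck_expR 2) (fun _ => I) (CkMl (- (m%:R / 2)) c3).
have c6 := @Ck_comp _ _ 2 setT _ (fun p : 'rV[R]_n * R => -1 * (dot p.1 p.1 * (4 * tau b p.2)^-1))
  (scalar_Ck_expR 2) (fun _ => I) (CkMl (-1) (CkM (Ck_sqnorm_fst 2) c4)).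
rewrite (_ : test = fun p => cut (shifted (dot p.1 p.1) p.2) *
  (expR (- (m%:R / 2) * ln (4 * pi * tau b p.2)) *
   expR (-1 * (dot p.1 p.1 * (4 * tau b p.2)^-1)))); last first.
  by apply/funext => p; rewrite mulN1r.
exact: CkM c2 (CkM c5 c6).
Qed.

Lemma test_ge0 p : 0 <= test p.
Proof.
case/andP: (cutoff_bounds r N (shifted (dot p.1 p.1) p.2)) => f0 _.
by rewrite mulr_ge0 // mulr_ge0 // expR_ge0.
Qed.

Lemma kernel_ge0 s t : 0 <= kernel s t.
Proof. by rewrite mulr_ge0 // expR_ge0. Qed.

(** [kernel] writes the power as an exponential of a multiple of [ln], to which [Ck_comp] applies;
    up to time [b], where [tau] is |t|, this is the Gaussian weight of [Phi_flow]. *)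
Lemma kernelE s t : t <= b ->
  kernel s t = (4 * pi * `|t|) `^ (- (m%:R / 2)) * expR (- (s / (4 * `|t|))).
Proof.
move=> tb; have t0 : t < 0 by apply: le_lt_trans b0.
rewrite /kernel tauE // ltr0_norm // /powR gt_eqF //.
by rewrite !mulr_gt0 ?pi_gt0 ?oppr_gt0.
Qed.

Lemma kernel_le s t : 0 <= s -> t <= b -> kernel s t <= kernel 0 b.
Proof.
move=> s0 tb; have t0 : t < 0 by apply: le_lt_trans b0.
rewrite /kernel !tauE //; apply: ler_pM; rewrite ?expR_ge0 // ler_expR.
  rewrite ler_wnM2l ?oppr_le0 ?divr_ge0 ?ler0n //.
  rewrite ler_ln ?posrE ?mulr_gt0 ?pi_gt0 ?oppr_gt0 //.
  by rewrite ler_wpM2l ?mulr_ge0 ?pi_ge0 // lerN2.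
rewrite mul0r lerN2 mulr_ge0 // invr_ge0 mulr_ge0 // oppr_ge0 ltW //.
Qed.

Lemma is_derive_kernel_s (s t : R) :
  is_derive s (1 : R) (fun s => kernel s t) (- kernel s t / (4 * tau b t)).
Proof.
set k := (4 * tau b t)^-1; set K := expR (- (m%:R / 2) * ln (4 * pi * tau b t)).
rewrite (_ : (fun s => _) = fun s => K * expR (- k * s)); last first.
  by apply/funext => z; rewrite /kernel -/K -/k mulNr [z * k]mulrC.
have e := is_derive_expR (- k * s).
apply: dereq (derMl K (dercomp (derMl (- k) (derI s)) e)) _.
by rewrite /kernel -/K -/k mulNr [k * s]mulrC; ring.
Qed.

Lemma is_derive_kernel_t (s t : R) : t <= b ->
  is_derive t (1 : R) (fun t => kernel s t)
    (kernel s t * (m%:R / (2 * tau b t) - s / (4 * tau b t ^+ 2))).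
Proof.
move=> tb; have tau0 := tau_gt0 b0 t.
have tn0 : tau b t != 0 by rewrite gt_eqF.
have dt : is_derive t (1 : R) (tau b) (-1) by rewrite -(tau1E tb); exact: is_derive_tau.
have pi40 : 0 < 4 * pi :> R by rewrite mulr_gt0 ?pi_gt0.
have pos4 : 0 < 4 * pi * tau b t by rewrite mulr_gt0.
have dln := dercomp (derMl (4 * pi) dt) (is_derive1_ln pos4).
have dV : is_derive t (1 : R) (fun z => (tau b z)^-1) ((tau b t)^-1 ^+ 2).
  by apply: dereq (is_deriveV tn0 dt) _; rewrite /GRing.scale /= mulrN1 opprK exprVn.
have e1 := dercomp (derMl (- (m%:R / 2)) dln) (is_derive_expR _).
have e2 := dercomp (derMl (- (s / 4)) dV) (is_derive_expR _).
rewrite (_ : (fun t => _) = fun z => expR (- (m%:R / 2) * ln (4 * pi * tau b z)) *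
   expR (- (s / 4) * (tau b z)^-1)); last first.
  by apply/funext => z; rewrite /kernel; congr (_ * expR _); rewrite invfM mulNr mulrA.
apply: dereq (derM e1 e2) _; rewrite /kernel.
have -> : - (s * (4 * tau b t)^-1) = - (s / 4) * (tau b t)^-1 by rewrite invfM mulNr mulrA.
set E1 := expR (- (m%:R / 2) * _); set E2 := expR (- (s / 4) * _).
have ee : (4 * pi * tau b t)^-1 * (4 * pi * -1) = - (tau b t)^-1.
  by rewrite invfM mulrN1 mulrN mulrAC mulVf ?mul1r // gt_eqF.
by rewrite ee; field.
Qed.

(** All functions in play depend on x through s = |x|^2, so the calculus is done in the two real
    variables s and t and carried to R^n by radial formulas. *)
Definition test_s (s t : R) : R :=
  (cut1 (shifted s t) - cut (shifted s t) / (4 * tau b t)) * kernel s t.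

Definition test_t (s t : R) : R :=
  (2 * m%:R * cut1 (shifted s t) +
   cut (shifted s t) * (m%:R / (2 * tau b t) - s / (4 * tau b t ^+ 2))) * kernel s t.

Lemma is_derive_shifted_s (s t : R) (g : R -> R) (l : R) :
  is_derive (shifted s t) (1 : R) g l ->
  is_derive s (1 : R) (fun s => g (shifted s t)) l.
Proof.
move=> dg; have := dercomp (derDc (2 * m%:R * (t - a)) (derI s)) dg.
by rewrite mulr1.
Qed.

Lemma is_derive_shifted_t (s t : R) (g : R -> R) (l : R) :
  is_derive (shifted s t) (1 : R) g l ->
  is_derive t (1 : R) (fun t => g (shifted s t)) (l * (2 * m%:R)).
Proof.
move=> dg; have ds : is_derive t (1 : R) (fun t => shifted s t) (2 * m%:R).
  apply: dereq (derD (derC s t) (derMl (2 * m%:R) (derDc (- a) (derI t)))) _.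
  by rewrite add0r mulr1.
exact: dercomp ds dg.
Qed.

Lemma is_derive_test_s (s t : R) :
  is_derive s (1 : R) (fun s => cut (shifted s t) * kernel s t) (test_s s t).
Proof.
have d1 := is_derive_shifted_s (is_derive_cutoff r N (shifted s t)).
by apply: dereq (derM d1 (is_derive_kernel_s s t)) _; rewrite /test_s; ring.
Qed.

Lemma is_derive_test_t (s t : R) : t <= b ->
  is_derive t (1 : R) (fun t => cut (shifted s t) * kernel s t) (test_t s t).
Proof.
move=> tb; have d1 := is_derive_shifted_t (is_derive_cutoff r N (shifted s t)).
by apply: dereq (derM d1 (is_derive_kernel_t s tb)) _; rewrite /test_t; ring.
Qed.

(* The first variation is tested with the field u_1 grad(rho) - rho grad(u_1),
   u_1 the cutoff and rho the kernel; it is [field_coef |x|^2 t] times x. *)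
Definition field_coef (s t : R) : R :=
  - (2 * (kernel s t * (cut (shifted s t) / (4 * tau b t) + cut1 (shifted s t)))).

(** In differentiating [field_coef] the terms with [cut1] cancel, so only the cutoff and its second
    derivative occur. *)
Definition field_coef_s (s t : R) : R :=
  2 * (kernel s t * (cut (shifted s t) / (16 * tau b t ^+ 2) - cut2 (shifted s t))).

Lemma is_derive_field_coef (s t : R) :
  is_derive s (1 : R) (fun s => field_coef s t) (field_coef_s s t).
Proof.
have d1 := is_derive_shifted_s (is_derive_cutoff r N (shifted s t)).
have d1' := is_derive_shifted_s (is_derive_cutoff1 r N (shifted s t)).
have d2 := is_derive_kernel_s s t.
set k := (4 * tau b t)^-1.
rewrite (_ : (fun s => _) = fun s => -2 * (kernel s t *
  (k * cut (shifted s t) + cut1 (shifted s t)))); last first.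
  by apply/funext => z; rewrite /field_coef -/k; ring.
apply: dereq (derMl (-2) (derM d2 (derD (derMl k d1) d1'))) _.
rewrite /field_coef_s -/k (_ : 16 * tau b t ^+ 2 = (4 * tau b t) ^+ 2); last by ring.
by rewrite -exprVn -/k; ring.
Qed.

Lemma continuous_field_coef_s (t : R) : continuous (fun s => field_coef_s s t).
Proof.
have csh : continuous (fun s => shifted s t).
  by move=> s; apply: cvgD; [exact: cvg_id|exact: cvg_cst].
have ck : continuous (fun s => kernel s t).
  by move=> s; exact: der_continuous (is_derive_kernel_s s t).
have c0 : continuous cut.
  by move=> s; exact: der_continuous (is_derive_cutoff r N s).
move=> s; apply: cvgM; first exact: cvg_cst.
apply: cvgM; first exact: ck.
apply: cvgB.
  apply: cvgM; last exact: cvg_cst.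
  by apply: (@continuous_comp _ _ _ (fun s => shifted s t) cut); [exact: csh|exact: c0].
apply: (@continuous_comp _ _ _ (fun s => shifted s t) cut2); first exact: csh.
exact: continuous_cutoff2.
Qed.

End TestFunction.

(** * Tangential parts, radial functions and radial fields *)

Lemma derive_linear {R : realType} (V W : normedModType R) (f : V -> W) (x v : V) :
  linear f -> continuous f -> differentiable f x /\ 'D_v f x = f v.
Proof.
move=> lf cf.
pose L : {linear V -> W} := HB.pack f (GRing.isLinear.Build _ _ _ _ f lf).
have dL y : differentiable f y by exact: (@linear_differentiable _ _ _ L).
by split=> //; rewrite deriveE // (@diff_lin _ _ _ L).
Qed.

Section TangentialPart.
Context {R : realType} {n m : nat}.
Implicit Types (x y : 'rV[R]_n) (E : 'M[R]_(m, n)).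

(** For orthonormal rows this is |x^T|^2, x^T being the projection of [x] to the row space of
    [E]. *)
Definition tangential_sqr E x : R := \sum_(i < m) dot x (row i E) ^+ 2.

Lemma dotE k (x y : 'rV[R]_k) : dot x y = (x *m y^T) 0 0.
Proof. by rewrite mxE; apply: eq_bigr => i _; rewrite mxE. Qed.

Lemma dot_mulmx E (y : 'rV[R]_m) x : dot (y *m E) x = dot y (x *m E^T).
Proof. by rewrite !dotE trmx_mul trmxK mulmxA. Qed.

Lemma tangential_sqrE E x : tangential_sqr E x = dot (x *m E^T) (x *m E^T).
Proof.
apply: eq_bigr => i _; rewrite expr2 !mxE.
by congr (_ * _); apply: eq_bigr => j _; rewrite !mxE.
Qed.

(** The witness is x^perp, obtained by subtracting the projection x E^T E; a vector orthogonal to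
    the rows of [E] pairs equally with [x] and x^perp. *)
Lemma normal_part E x : E *m E^T = 1%:M ->
  exists y, dot y y = dot x x - tangential_sqr E x /\
    forall h : 'rV[R]_n, E *m h^T = 0 -> dot h y = dot h x.
Proof.
move=> E1; exists (x - x *m E^T *m E); split.
  have xz : dot x (x *m E^T *m E) = tangential_sqr E x.
    by rewrite dotC dot_mulmx tangential_sqrE.
  have zz : dot (x *m E^T *m E) (x *m E^T *m E) = tangential_sqr E x.
    by rewrite dot_mulmx -[x *m E^T *m E *m E^T]mulmxA E1 mulmx1 tangential_sqrE.
  rewrite !(dotDl, dotDr, dotNl, dotNr) (dotC _ x) xz zz; ring.
move=> h Eh; rewrite dotDr dotNr dotC [dot h (_ *m E)]dotC dot_mulmx.
have -> : h *m E^T = 0 by rewrite -[h]trmxK -trmx_mul Eh trmx0.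
by rewrite [dot _ 0]dotC dot0l subr0 dotC.
Qed.

Lemma tangential_sqr_le E x : E *m E^T = 1%:M ->
  0 <= tangential_sqr E x <= dot x x.
Proof.
move=> /(normal_part x) [y [yy _]]; apply/andP; split.
  by apply: sumr_ge0 => i _; exact: sqr_ge0.
by rewrite -subr_ge0 -yy dot_ge0.
Qed.

End TangentialPart.

Section RadialDerivatives.
Context {R : realType} {n : nat}.
Implicit Types x v : 'rV[R]_n.

Lemma coord_linear (i : 'I_n) : linear (fun x : 'rV[R]_n => x 0 i).
Proof. by move=> k x y /=; rewrite !mxE. Qed.

Lemma coord_cont (i : 'I_n) : continuous (fun x : 'rV[R]_n => x 0 i).
Proof. by move=> x; exact: coord_continuous. Qed.

Lemma Ck_coord j (i : 'I_n) : Ck j setT (fun x : 'rV[R]_n => x 0 i).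
Proof. apply: Ck_linear; [exact: coord_linear|exact: coord_cont]. Qed.

Lemma Ck_sqnorm j : Ck j setT (fun x : 'rV[R]_n => dot x x).
Proof. by apply: Ck_sum => i; exact: CkM (Ck_coord j i) (Ck_coord j i). Qed.

Lemma is_derive_coordM x v i :
  is_derive x v ((fun x : 'rV[R]_n => x 0 i) * (fun x => x 0 i)) (2 * (x 0 i * v 0 i)).
Proof.
have [dc e] := derive_linear x v (coord_linear i) (@coord_cont i).
have h : is_derive x v (fun x : 'rV[R]_n => x 0 i) (v 0 i).
  by apply: DeriveDef => //; exact: diff_derivable.
have := @is_deriveM _ _ _ _ x v _ _ h h.
move=> [d1 d2]; apply: DeriveDef => //; rewrite d2 /GRing.scale /=.
ring.
Qed.

Lemma derive_sqnorm x v : 'D_v (fun x => dot x x) x = 2 * dot x v.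
Proof.
rewrite (_ : (fun x => dot x x) = \sum_(i < n) ((fun x : 'rV[R]_n => x 0 i) * (fun x => x 0 i))); last first.
  by apply/funext => y; rewrite /dot fct_sumE.
rewrite derive_sum => [|i]; last by have [] := is_derive_coordM x v i.
rewrite /dot mulr_sumr; apply: eq_bigr => i _.
by have [_ ->] := is_derive_coordM x v i.
Qed.

Lemma is_derive_radial (g : R -> R) (l : R) x v : is_derive (dot x x) (1 : R) g l ->
  is_derive x v (fun x => g (dot x x)) (l * (2 * dot x v)).
Proof.
move=> dg; rewrite -derive_sqnorm.
apply: (@is_derive_comp_scalar _ _ (fun x : 'rV[R]_n => dot x x)) => //.
exact: Ck_differentiable (Ck_sqnorm 1).
Qed.

Lemma gradient_radial (g : R -> R) (l : R) x : is_derive (dot x x) (1 : R) g l ->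
  gradient (fun x => g (dot x x)) x = (2 * l) *: x.
Proof.
move=> dg; apply/rowP => i; rewrite !mxE.
have [_ ->] := is_derive_radial (delta_mx 0 i) dg.
have -> : dot x (delta_mx 0 i) = x 0 i.
  rewrite /dot (bigD1 i) //= mxE !eqxx mulr1 big1 ?addr0 // => j ji.
  by rewrite mxE (negbTE ji) andbF mulr0.
by rewrite mulrA [l * 2]mulrC.
Qed.

Variables (g g' : R -> R).
Hypothesis dg : forall s, is_derive s (1 : R) g (g' s).
Hypothesis cg' : continuous g'.

(** A finite sum of scalar functions times constant vectors, so that the product rule is needed for
    scalar functions only. *)
Let fieldE : (fun x : 'rV[R]_n => g (dot x x) *: x) =
  fun x => \sum_(i < n) (g (dot x x) * x 0 i) *: delta_mx 0 i.
Proof.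
apply/funext => x.
transitivity (g (dot x x) *: \sum_(i < n) x 0 i *: (delta_mx 0 i : 'rV[R]_n)).
  by rewrite -row_sum_delta.
rewrite scaler_sumr.
by apply: eq_bigr => i _; rewrite scalerA.
Qed.

Let CkF (i : 'I_n) : Ck 1 setT (fun x : 'rV[R]_n => g (dot x x) * x 0 i).
Proof.
have sg : scalar_Ck 1 setT g by exists g' => s _; [exact: dg|exact: cg'].
apply: CkM (Ck_coord 1 i).
exact: (@Ck_comp _ _ 1 setT g _ sg (fun _ => I) (Ck_sqnorm 1)).
Qed.

Lemma Ck_radial_field : Ck 1 setT (fun x : 'rV[R]_n => g (dot x x) *: x).
Proof. by rewrite fieldE; apply: Ck_sum => i; apply: CkZl; exact: CkF. Qed.

Lemma derive_radial_field x v :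
  'D_v (fun x => g (dot x x) *: x) x = g (dot x x) *: v + (2 * g' (dot x x) * dot x v) *: x.
Proof.
rewrite fieldE.
pose F (i : 'I_n) (x : 'rV[R]_n) := (g (dot x x) * x 0 i) *: (delta_mx 0 i : 'rV[R]_n).
rewrite (_ : (fun x => _) = \sum_(i < n) F i); last first.
  by apply/funext => y; rewrite fct_sumE.
have dF i : differentiable (F i) x.
  by apply: differentiableZl; exact: Ck_differentiable (CkF i).
rewrite derive_sum => [|i]; last exact: diff_derivable.
transitivity (\sum_(i < n) (g (dot x x) * v 0 i + (2 * g' (dot x x) * dot x v) * x 0 i) *: (delta_mx 0 i : 'rV[R]_n)).
  apply: eq_bigr => i _; rewrite deriveE // diffZl; last exact: Ck_differentiable (CkF i).
  rewrite -deriveE; last exact: Ck_differentiable (CkF i).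
  congr (_ *: _).
  have [dc e] := derive_linear x v (coord_linear i) (@coord_cont i).
  have [dr er] := is_derive_radial v (dg (dot x x)).
  have dcv : derivable (fun x : 'rV[R]_n => x 0 i) x v by exact: diff_derivable.
  have hM := deriveM dr dcv.
  rewrite [LHS]hM er e /GRing.scale /=; ring.
transitivity (g (dot x x) *: (\sum_(i < n) v 0 i *: (delta_mx 0 i : 'rV[R]_n)) +
  (2 * g' (dot x x) * dot x v) *: (\sum_(i < n) x 0 i *: (delta_mx 0 i : 'rV[R]_n))).
  rewrite !scaler_sumr -big_split /=.
  by apply: eq_bigr => i _; rewrite !scalerA -scalerDl.
by rewrite -!row_sum_delta.
Qed.

(** Each row e of the orthonormal frame contributes g |e|^2 + 2 g' (x . e)^2. *)
Lemma divergence_radial_field m (M : {measure set (borelRn R n) -> \bar R}) x :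
  tangent_frame m M x *m (tangent_frame m M x)^T = 1%:M ->
  divergence m M (fun x => g (dot x x) *: x) x =
  m%:R * g (dot x x) + 2 * g' (dot x x) * tangential_sqr (tangent_frame m M x) x.
Proof.
set E := tangent_frame m M x => E1; rewrite /divergence -/E.
transitivity (\sum_(i < m) (g (dot x x) + 2 * g' (dot x x) * dot x (row i E) ^+ 2)).
  apply: eq_bigr => i _; rewrite derive_radial_field dotDl !dotZl.
  have -> : dot (row i E) (row i E) = 1.
    have := congr1 (fun A : 'M[R]_m => A i i) E1; rewrite !mxE eqxx mulr1n => <-.
    by apply: eq_bigr => j _; rewrite !mxE.
  by rewrite mulr1 -!mulrA -expr2.
rewrite big_split /= sumr_const card_ord [in RHS]mulr_natl; congr (_ + _).
by rewrite /tangential_sqr mulr_sumr.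
Qed.

End RadialDerivatives.

(** * The monotonicity computation *)

Section Huisken.
Context {R : realType} {n : nat}.
Variables (m : nat) (a b r : R) (N : nat).
Hypotheses (b0 : b < 0) (ab : a <= b) (r0 : 0 <= r).
Implicit Types (x H : 'rV[R]_n) (t : R).

Local Notation u := (@test R n m a b r N).
Local Notation w x t := (shifted m a (dot x x) t).

Definition test_field t x := field_coef m a b r N (dot x x) t *: x.

(** Kept in the literal shape of the integrand in [brakke_flow], so that the two integrals agree by
    conversion. *)
Definition test_integrand t x H : R :=
  - u (x, t) * enorm H ^+ 2 + dot H (gradient (fun y => u (y, t)) x)
    + derive1 (fun s => u (x, s)) t.

Lemma test_integrandE t x H : t <= b -> test_integrand t x H =
  - (cutoff r N (w x t) * kernel m b (dot x x) t) * dot H H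
  + 2 * test_s m a b r N (dot x x) t * dot H x + test_t m a b r N (dot x x) t.
Proof.
move=> tb; rewrite /test_integrand enorm_sqr.
rewrite (gradient_radial (is_derive_test_s m a b r N (dot x x) t)) dotZr.
by rewrite derive1E; have [_ ->] := is_derive_test_t m a r N b0 (dot x x) tb.
Qed.

Lemma Ck_test_field t : Ck 1 setT (test_field t).
Proof.
apply: (Ck_radial_field (g := fun s => field_coef m a b r N s t)
  (g' := fun s => field_coef_s m a b r N s t)).
  by move=> s; exact: is_derive_field_coef.
exact: continuous_field_coef_s.
Qed.

Lemma divergence_test_field (M : {measure set (borelRn R n) -> \bar R}) t x :
  tangent_frame m M x *m (tangent_frame m M x)^T = 1%:M ->
  divergence m M (test_field t) x = m%:R * field_coef m a b r N (dot x x) t +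
  2 * field_coef_s m a b r N (dot x x) t * tangential_sqr (tangent_frame m M x) x.
Proof.
exact: (divergence_radial_field (g := fun s => field_coef m a b r N s t)
  (g' := fun s => field_coef_s m a b r N s t)
  (fun s => is_derive_field_coef m a b r N s t) (@continuous_field_coef_s _ m a b r N t)).
Qed.

Lemma shifted_ge t x : a <= t -> dot x x <= w x t.
Proof. by move=> at_; rewrite /shifted lerDl mulr_ge0 ?subr_ge0 // mulr_ge0. Qed.

(* Huisken's computation: the terms in the cutoff and in its first derivative
   combine into -u |H + x^perp / (2 tau)|^2 and only the second derivative of
   the cutoff is left. *)
Lemma huisken_identity (E : 'M[R]_(m, n)) t x H : t <= b ->
  E *m E^T = 1%:M -> E *m H^T = 0 ->
  exists2 q, 0 <= q & test_integrand t x H + dot H (test_field t x) +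
    (m%:R * field_coef m a b r N (dot x x) t +
     2 * field_coef_s m a b r N (dot x x) t * tangential_sqr E x) =
    - kernel m b (dot x x) t *
      (cutoff r N (w x t) * q + 4 * cutoff2 r N (w x t) * tangential_sqr E x).
Proof.
move=> tb E1 EH; have [y [yy Hy]] := normal_part x E1.
have tau0 := tau_gt0 b0 t; have tn0 : tau b t != 0 by rewrite gt_eqF.
exists (dot (H + (2 * tau b t)^-1 *: y) (H + (2 * tau b t)^-1 *: y)).
  exact: dot_ge0.
rewrite test_integrandE // /test_field dotZr !dotDl !dotDr !dotZl !dotZr.
(* With y = x^perp, the facts H . y = H . x and |y|^2 = |x|^2 - |x^T|^2 leave an identity of
   rational functions in [tau b t]. *)
rewrite (dotC y H) yy (Hy H EH) /test_s /test_t /field_coef /field_coef_s.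
by field.
Qed.

(** If |x|^2 > r + 2, the shifted variable, which is at least |x|^2 for t >= a, lies past the bend
    and the right-hand side of the identity is nonpositive. Otherwise 72 = 4 * 18 collects the
    factor of the last term and the bound on the second derivative, with |x^T|^2 <= r + 2. *)
Lemma huisken_inequality (E : 'M[R]_(m, n)) t x H : a <= t -> t <= b ->
  E *m E^T = 1%:M -> E *m H^T = 0 ->
  test_integrand t x H + dot H (test_field t x) +
    (m%:R * field_coef m a b r N (dot x x) t +
     2 * field_coef_s m a b r N (dot x x) t * tangential_sqr E x) <=
  72 * kernel m b 0 b * (r + 2) / N.+1%:R * (dot x x <= r + 2)%R%:R.
Proof.
move=> at_ tb E1 EH; have [q q0 ->] := huisken_identity x tb E1 EH.
set T := tangential_sqr E x; have /andP[T0 Tx] := tangential_sqr_le x E1.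
have k0 := kernel_ge0 m b (dot x x) t.
have kb := kernel_le m b0 (dot_ge0 x) tb.
have /andP[c0 _] := cutoff_bounds r N (w x t).
have kq : 0 <= kernel m b (dot x x) t * (cutoff r N (w x t) * q) := mulr_ge0 k0 (mulr_ge0 c0 q0).
have [wr|wr] := lerP (dot x x) (r + 2); last first.
  have c2 : 0 <= cutoff2 r N (w x t).
    by apply: cutoff2_ge0; apply: le_trans (shifted_ge x at_); exact: ltW.
  rewrite mulr0 mulNr oppr_le0; apply: (mulr_ge0 k0); apply: (addr_ge0 (mulr_ge0 c0 q0)).
  exact: (mulr_ge0 (mulr_ge0 (ler0n _ 4) c2) T0).
rewrite mulr1 mulNr mulrDr opprD.
apply: (@le_trans _ _ (kernel m b (dot x x) t * (- cutoff2 r N (w x t)) * (4 * T))).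
  rewrite -subr_ge0 (_ : _ - _ = kernel m b (dot x x) t * (cutoff r N (w x t) * q)) //.
  by rewrite -/T; ring.
have d0 : 0 < N.+1%:R :> R by rewrite ltr0n.
have lower := cutoff2_lower r N (w x t).
apply: (@le_trans _ _ (kernel m b (dot x x) t * (18 / N.+1%:R) * (4 * T))).
  apply: ler_wpM2r; first by rewrite mulr_ge0.
  by apply: ler_wpM2l => //; rewrite lerNl.
have -> : 72 * kernel m b 0 b * (r + 2) / N.+1%:R = kernel m b 0 b * (18 / N.+1%:R) * (4 * (r + 2)) by ring.
have e0 : 0 <= 18 / N.+1%:R :> R by rewrite divr_ge0 // ltW.
apply: ler_pM; rewrite ?mulr_ge0 //; first exact: ler_wpM2r.
by rewrite ler_pM2l // (le_trans Tx).
Qed.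

Lemma test_vanish t x : a <= t -> radius r N <= dot x x ->
  [/\ u (x, t) = 0, test_s m a b r N (dot x x) t = 0, test_t m a b r N (dot x x) t = 0,
      field_coef m a b r N (dot x x) t = 0 & field_coef_s m a b r N (dot x x) t = 0].
Proof.
move=> at_ xr; have z := cutoff_radius (le_trans xr (shifted_ge x at_)).
rewrite /test /test_s /test_t /field_coef /field_coef_s /= !z.
by split; ring.
Qed.

(** Only for integrability at a fixed [N]: [C] depends on [N] through the radius of the support and
    is never passed to the limit. *)
Lemma test_bounds : exists2 C : R, 0 <= C & forall t x, a <= t -> t <= b ->
  [/\ `|u (x, t)| <= C,
      forall H, `|test_integrand t x H| <= C * (1 + enorm H ^+ 2),
      forall H, `|dot H (test_field t x)| <= C * (1 + enorm H ^+ 2) &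
      forall E : 'M[R]_(m, n), E *m E^T = 1%:M ->
        `|m%:R * field_coef m a b r N (dot x x) t +
          2 * field_coef_s m a b r N (dot x x) t * tangential_sqr E x| <= C].
Proof.
(* [B] bounds |x|^2 on the support, [k] the kernel and [bt] the reciprocal of [tau]. Then [cs],
   [ct], [cg] and [cg'] bound the factors of the kernel in [test_s], [test_t], [field_coef] and
   [field_coef_s]. *)
pose B := radius r N; pose k := kernel m b 0 b; pose bt := (- b)^-1.
have B0 : 0 <= B by rewrite /B /radius !addr_ge0.
have k0 : 0 <= k := kernel_ge0 m b 0 b.
have bt0 : 0 <= bt by rewrite invr_ge0; move: b0; lra.
pose cs := 18 + bt; pose ct := 36 * m%:R + m%:R * bt + B * bt ^+ 2.
pose cg := 2 * cs; pose cg' := 2 * (bt ^+ 2 + 216).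
have m0 : 0 <= m%:R :> R by exact: ler0n.
have cs0 : 0 <= cs by rewrite addr_ge0.
have ct0 : 0 <= ct by rewrite !addr_ge0 ?mulr_ge0 ?exprn_ge0.
have cg0 : 0 <= cg by rewrite mulr_ge0.
have cg'0 : 0 <= cg' by rewrite mulr_ge0 ?addr_ge0 ?exprn_ge0.
pose C1 := k * (1 + 2 * cs * (1 + B) + ct).
pose C2 := k * (cg * (1 + B)).
pose C3 := k * (m%:R * cg + 2 * cg' * B).
have C10 : 0 <= C1 by rewrite !(mulr_ge0, addr_ge0).
have C20 : 0 <= C2 by rewrite !(mulr_ge0, addr_ge0).
have C30 : 0 <= C3 by rewrite !(mulr_ge0, addr_ge0).
exists (C1 + C2 + C3); first by rewrite !addr_ge0.
move=> t x at_ tb.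
have hC : 0 <= C1 + C2 + C3 by rewrite !addr_ge0.
have [Bx|xB] := lerP B (dot x x).
  have [z1 z2 z3 z4 z5] := test_vanish at_ Bx.
  have uz : cutoff r N (w x t) * kernel m b (dot x x) t = 0 := z1.
  split.
  - by rewrite z1 normr0.
  - move=> H; rewrite test_integrandE // z2 z3 uz oppr0 !mul0r mulr0 mul0r !addr0 normr0.
    by rewrite mulr_ge0 // addr_ge0 // exprn_ge0 // enorm_ge0.
  - by move=> H; rewrite /test_field z4 scale0r dotC dot0l normr0 mulr_ge0 // addr_ge0 // exprn_ge0 // enorm_ge0.
  - by move=> E _; rewrite z4 z5 !mulr0 mul0r addr0 normr0.
have tau0 := tau_gt0 b0 t; have tn0 : tau b t != 0 by rewrite gt_eqF.
have taub : (tau b t)^-1 <= bt.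
  by rewrite lef_pV2 ?posrE // ?tauE //; move: b0 tb; lra.
have taui0 : 0 <= (tau b t)^-1 by rewrite invr_ge0 ltW.
have K0 := kernel_ge0 m b (dot x x) t.
have Kk : kernel m b (dot x x) t <= k := kernel_le m b0 (dot_ge0 x) tb.
have /andP[f0 f1] := cutoff_bounds r N (w x t).
have /andP[g0 g1] := cutoff1_bounds r N (w x t).
have h0 := cutoff2_upper r N (w x t).
have h1 : -18 <= cutoff2 r N (w x t).
  apply: le_trans (cutoff2_lower r N (w x t)); rewrite lerN2 ler_pdivrMr ?ltr0n //.
  by rewrite ler_peMr // ler1n.
have x0 := dot_ge0 x; have xB' := ltW xB.
set f := cutoff r N (w x t) in f0 f1 *; set f' := cutoff1 r N (w x t) in g0 g1 *.
set f2 := cutoff2 r N (w x t) in h0 h1 *; set K := kernel m b (dot x x) t in K0 Kk *.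
set i := (tau b t)^-1 in taub taui0 *; set s := dot x x in x0 xB xB' *.
have fi : 0 <= f * i <= bt.
  by rewrite mulr_ge0 //= -[leRHS]mul1r ler_pM.
have fii : 0 <= f * i ^+ 2 <= bt ^+ 2.
  have ib : i ^+ 2 <= bt ^+ 2 by rewrite lerXn2r ?nnegrE.
  have i20 : 0 <= i ^+ 2 by rewrite exprn_ge0.
  by rewrite mulr_ge0 //= -[leRHS]mul1r ler_pM.
case/andP: fi => fi0 fib; case/andP: fii => fii0 fiib.
have normK (z c : R) : `|z| <= c -> `|z * K| <= k * c.
  by move=> zc; rewrite normrM mulrC (ger0_norm K0) ler_pM.
have cs_le : `|f' - f / (4 * tau b t)| <= cs.
  have -> : f / (4 * tau b t) = f * i / 4 by rewrite /i invfM mulrA mulrAC.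
  by rewrite /cs ler_norml; apply/andP; split; lra.
have ct_le : `|2 * m%:R * f' + f * (m%:R / (2 * tau b t) - s / (4 * tau b t ^+ 2))| <= ct.
  have -> : f * (m%:R / (2 * tau b t) - s / (4 * tau b t ^+ 2)) =
     m%:R * (f * i) / 2 - s * (f * i ^+ 2) / 4.
    by rewrite /i; field.
  have q1 : 0 <= m%:R * (f * i) <= m%:R * bt by rewrite mulr_ge0 //= ler_wpM2l.
  have q2 : 0 <= s * (f * i ^+ 2) <= B * bt ^+ 2.
    by rewrite mulr_ge0 //= ler_pM.
  have q3 : - 36 * m%:R <= 2 * m%:R * f' <= 0.
    have -> : 2 * m%:R * f' = m%:R * (2 * f') by ring.
    have -> : - 36 * m%:R = m%:R * - 36 :> R by ring.
    rewrite ler_wpM2l //=; last by lra.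
    by rewrite mulr_ge0_le0 //; lra.
  case/andP: q1 => q1 q1'; case/andP: q2 => q2 q2'; case/andP: q3 => q3 q3'.
  rewrite /ct ler_norml; move: q1 q1' q2 q2' q3 q3' m0.
  set A1 := m%:R * (f * i); set A2 := m%:R * bt; set A3 := s * _; set A4 := B * _.
  by set A5 := 2 * _ * f'; move=> *; apply/andP; split; lra.
have cg_le : `|- (2 * (f / (4 * tau b t) + f'))| <= cg.
  have -> : f / (4 * tau b t) = f * i / 4 by rewrite /i invfM mulrA mulrAC.
  by rewrite /cg /cs ler_norml; apply/andP; split; lra.
have cg'_le : `|2 * (f / (16 * tau b t ^+ 2) - f2)| <= cg'.
  have -> : f / (16 * tau b t ^+ 2) = f * i ^+ 2 / 16.
    by rewrite /i; field.
  rewrite /cg' ler_norml; move: fii0 fiib; set A1 := f * _; set A2 := bt ^+ 2 => *.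
  by apply/andP; split; lra.
(* From |H - x|^2 >= 0 and |H + x|^2 >= 0, in a form dominated by the energy density 1 + |H|^2. *)
have Hx H : `|dot H x| <= (1 + B) * (1 + dot H H).
  have hh := dot_ge0 H.
  have p1 := dot_ge0 (H - x); have p2 := dot_ge0 (H + x).
  rewrite !(dotDl, dotDr, dotNl, dotNr) (dotC x H) -/s in p1 p2.
  have p3 : 0 <= B * dot H H by rewrite mulr_ge0.
  rewrite ler_norml; move: p1 p2 p3 hh xB' x0 B0.
  have -> : (1 + B) * (1 + dot H H) = 1 + dot H H + B + B * dot H H by ring.
  by set A1 := dot H x; set A2 := dot H H; set A3 := B * _ => *; apply/andP; split; lra.
split.
- apply: (@le_trans _ _ C1); last by rewrite -addrA lerDl addr_ge0.
  rewrite /test /= -/s -/f -/K; apply: le_trans (normK _ _ (_ : `|f| <= 1)) _.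
    by rewrite ger0_norm.
  by rewrite /C1 ler_wpM2l // -addrA lerDl !(mulr_ge0, addr_ge0).
- move=> H; rewrite test_integrandE // enorm_sqr -/s -/f -/K.
  have hh := dot_ge0 H.
  apply: (@le_trans _ _ (C1 * (1 + dot H H))); last first.
    by rewrite ler_wpM2r ?addr_ge0 // -addrA lerDl addr_ge0.
  apply: le_trans (ler_normD _ _) _.
  have n1 : `|- (f * K) * dot H H| <= k * (1 + dot H H).
    rewrite mulNr normrN (normrM (f * K)) (normrM f K) (ger0_norm f0) (ger0_norm K0) (ger0_norm hh).
    apply: (ler_pM (mulr_ge0 f0 K0) hh); last by rewrite lerDr.
    by rewrite -[leRHS]mul1r; exact: (ler_pM f0 K0).
  have n2 : `|2 * test_s m a b r N s t * dot H x| <= k * (2 * cs * (1 + B)) * (1 + dot H H).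
    rewrite /test_s -/f' -/f -/K normrM.
    have -> : k * (2 * cs * (1 + B)) * (1 + dot H H) = (2 * (k * cs)) * ((1 + B) * (1 + dot H H)) by ring.
    apply: ler_pM => //.
    rewrite normrM (ger0_norm (ler0n _ 2)) ler_pM2l //.
    exact: normK.
  have n3 : `|test_t m a b r N s t| <= k * ct * (1 + dot H H).
    rewrite -[leLHS]mulr1; apply: ler_pM => //; last by rewrite lerDl.
    by rewrite /test_t -/f' -/f -/K; exact: normK.
  apply: le_trans (lerD (le_trans (ler_normD _ _) (lerD n1 n2)) n3) _.
  by rewrite le_eqVlt; apply/orP; left; apply/eqP; rewrite /C1; ring.
- move=> H; rewrite enorm_sqr; have hh := dot_ge0 H.
  apply: (@le_trans _ _ (C2 * (1 + dot H H))); last first.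
    by rewrite ler_wpM2r ?addr_ge0 // -addrA addrCA lerDl addr_ge0.
  rewrite /test_field dotZr normrM /C2.
  have -> : k * (cg * (1 + B)) * (1 + dot H H) = (k * cg) * ((1 + B) * (1 + dot H H)) by ring.
  apply: ler_pM => //; rewrite /field_coef -/s -/f -/f' -/K.
  have -> : - (2 * (K * (f / (4 * tau b t) + f'))) = - (2 * (f / (4 * tau b t) + f')) * K by ring.
  exact: normK.
- move=> E /(tangential_sqr_le x) /andP[T0 Ts].
  apply: (@le_trans _ _ C3); last by rewrite lerDr addr_ge0.
  apply: le_trans (ler_normD _ _) _; rewrite /C3 mulrDr; apply: lerD.
    rewrite normrM (ger0_norm m0) mulrCA ler_wpM2l //.
    rewrite /field_coef -/s -/f -/f' -/K.
    have -> : - (2 * (K * (f / (4 * tau b t) + f'))) = - (2 * (f / (4 * tau b t) + f')) * K by ring.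
    exact: normK.
  rewrite normrM (ger0_norm T0) (_ : k * (2 * cg' * B) = 2 * (k * cg') * B); last by ring.
  apply: ler_pM => //; last by exact: le_trans Ts xB'.
  rewrite normrM (ger0_norm (ler0n _ 2)) ler_pM2l //.
  rewrite /field_coef_s -/s -/f -/f2 -/K.
  have -> : 2 * (K * (f / (16 * tau b t ^+ 2) - f2)) = 2 * (f / (16 * tau b t ^+ 2) - f2) * K by ring.
  exact: normK.
Qed.

End Huisken.

(** * Geometry of the moving boundary *)

Section OrthogonalProjection.
Context {R : realType} {n k : nat}.

(* The normal part of [v] is [v - v B^T (B B^T)^-1 B] when [V] is the row
   space of the row-free matrix [B]. *)
Lemma perp_part_row (B : 'M[R]_(k, n)) (V : set 'rV[R]_n) (v : 'rV[R]_n) :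
  (forall u : 'rV[R]_k, u *m B = 0 -> u = 0) ->
  (forall w, V w <-> exists u : 'rV[R]_k, w = u *m B) ->
  V (v - perp_part V v) /\ forall z, V z -> dot (perp_part V v) z = 0.
Proof.
move=> inj VB; have unit : B *m B^T \in unitmx.
  rewrite -row_free_unit; apply: inj_row_free => u uBB; apply: inj.
  by apply: dot_eq0; rewrite dot_mulmx -mulmxA uBB dotC dot0l.
pose u := v *m B^T *m invmx (B *m B^T).
rewrite /perp_part; apply: (@xgetPex _ 0 [set w | V (v - w) /\ forall z, V z -> dot w z = 0]).
(* A witness shows that the defining set of [perp_part] is nonempty, so [xget] returns an element of
   it. *)
exists (v - u *m B); split; first by apply/VB; exists u; rewrite subKr.
move=> _ /VB[z ->]; rewrite dotC dot_mulmx mulmxBl -[u *m B *m _]mulmxA /u -mulmxA.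
by rewrite mulVmx // mulmx1 subrr dotC dot0l.
Qed.

End OrthogonalProjection.

Lemma derive_comp {R : realType} (U V W : normedModType R) (f : U -> V) (g : V -> W)
    (x v : U) : differentiable f x -> differentiable g (f x) ->
  'D_v (g \o f) x = 'D_('D_v f x) g (f x).
Proof.
move=> df dg; have dc : differentiable (g \o f) x by exact: differentiable_comp.
by rewrite (deriveE _ dc) (deriveE _ dg) (deriveE _ df) diff_comp.
Qed.

Section Family.
Context {R : realType} {k n : nat} {S : topologicalType}.
Variables (A : set (chart R k S)) (F : S -> R -> 'rV[R]_n).
Hypotheses (hS : closed_manifold A)
           (hF : smooth_family_of_embeddings A `]-oo, 0[ F).

Let hchart c : A c -> is_chart c.
Proof. by have [_ _ [+ _ _]] := hS; apply. Qed.

Let hcover x : exists2 c, A c & cdom c x.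
Proof. by have [_ _ [_ + _]] := hS; apply. Qed.

Local Notation P c := (fun p : 'rV[R]_k * R => F (cinv c p.1) p.2).

Let negE (t : R) : t < 0 -> (`]-oo, 0[%classic : set R) t.
Proof. by move=> t0; rewrite /= in_itv. Qed.

Let P_smooth c j : A c -> Ck j (cimg c `*` (`]-oo, (0 : R)[%classic)) (P c).
Proof. by move=> Ac; have [+ _] := hF => /(_ c Ac); apply. Qed.

Let P_diff c x (t : R) : A c -> cdom c x -> t < 0 -> differentiable (P c) (cmap c x, t).
Proof.
move=> Ac cx t0; have [+ _] := P_smooth 1 Ac; apply; split => /=; last exact: negE.
by exists x.
Qed.

Let P_diff_cont c x (t : R) v : A c -> cdom c x -> t < 0 ->
  {for (cmap c x, t), continuous (fun p => 'D_v (P c) p)}.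
Proof.
move=> Ac cx t0; have [_ +] := P_smooth 1 Ac => /(_ v); apply; split => /=; last exact: negE.
by exists x.
Qed.

Let cinvK c x : A c -> cdom c x -> cinv c (cmap c x) = x.
Proof. by move=> /hchart[_ _ + _ _]; apply. Qed.

Let cdom_nbhs c x : A c -> cdom c x -> nbhs x (cdom c).
Proof. by move=> /hchart[oc _ _ _ _] cx; exact: open_nbhs_nbhs. Qed.

Let cmap_cont c x : A c -> cdom c x -> {for x, continuous (cmap c)}.
Proof. by move=> /hchart[_ _ _ + _]; apply. Qed.

(** Near the given point [F] is its expression in a chart composed with the chart map; the two agree
    only over the chart domain, which is a neighbourhood. *)
Lemma family_continuous (x : S) (t : R) : t < 0 ->
  {for (x, t), continuous (fun p : S * R => F p.1 p.2)}.
Proof.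
move=> t0; have [c Ac cx] := hcover x.
have cP : {for (cmap c x, t), continuous (P c)}.
  by apply: differentiable_continuous; exact: P_diff.
have cm : (cmap c p.1, p.2) @[p --> (x, t)] --> (cmap c x, t).
  have c1 : cmap c p.1 @[p --> (x, t)] --> cmap c x.
    by apply: (@cvg_comp _ _ _ fst (cmap c) _ (nbhs x)); [exact: cvg_fst|exact: cmap_cont].
  by have := cvg_pair c1 (@cvg_snd _ _ (nbhs x) (nbhs t) _); apply.
have h := cvg_comp (fun p : S * R => (cmap c p.1, p.2)) (P c) cm cP.
have e : P c (cmap c x, t) = F x t := congr1 (F^~ t) (cinvK Ac cx).
rewrite e in h; apply: cvg_trans h; apply: near_eq_cvg.
have : \forall y \near (x, t), cdom c y.1.
  by have /= := @cvg_fst _ _ (nbhs x) (nbhs t) _; apply; exact: cdom_nbhs.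
apply: filterS => -[y s] cy.
have ey : P c (cmap c y, s) = F y s := congr1 (F^~ s) (cinvK Ac cy).
exact: ey.
Qed.

Lemma family_continuous_space (t : R) : t < 0 -> continuous (F^~ t).
Proof.
move=> t0 x; have h := @family_continuous x t t0.
apply: (@continuous_comp _ _ _ (fun y => (y, t)) (fun p : S * R => F p.1 p.2)) => //.
by have := cvg_pair (@cvg_id _ (nbhs x)) (@cvg_cst _ t _ (nbhs x) _); apply.
Qed.

Lemma family_bounded (a b : R) : b < 0 ->
  exists2 r : R, 0 <= r & forall x t, a <= t -> t <= b -> dot (F x t) (F x t) <= r.
Proof.
move=> b0; have [cS _ _] := hS.
pose K := ([set: S] `*` `[a, b]%classic : set (S * R)).
have cK : compact K by apply: compact_setX => //; exact: segment_compact.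
(* The manifold or the time interval may be empty, and then the bound is vacuous. *)
have [K0|] := pselect (K !=set0); last first.
  move=> K0; exists 0 => // x t at_ tb; exfalso; apply: K0; exists (x, t).
  by split=> //=; rewrite in_itv /= at_.
have cf : {within K, continuous (fun p : S * R => dot (F p.1 p.2) (F p.1 p.2))}.
  apply: continuous_in_subspaceT => -[x t] /set_mem [_ /=]; rewrite in_itv /= => /andP[_ tb].
  apply: (@continuous_comp _ _ _ (fun p : S * R => F p.1 p.2) (fun y : 'rV[R]_n => dot y y)).
    by apply: family_continuous; exact: le_lt_trans b0.
  exact: (Ck_continuous (Ck_sqnorm 0)).
have [[x0 t0] K0x hmax] := compact_EVT_max K0 cK cf.
exists (dot (F x0 t0) (F x0 t0)); first exact: dot_ge0.
move=> x t at_ tb; apply: (hmax (x, t)); rewrite inE; split=> //=.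
by rewrite in_itv /= at_.
Qed.

Lemma derive_time c z s : 'D_((0 : 'rV[R]_k, 1 : R)) (P c) (z, s) = derive1 (F (cinv c z)) s.
Proof.
rewrite derive1E /derive.
rewrite (_ : (fun h => _) = (fun h : R => h^-1 *: ((F (cinv c z) \o shift s) (h *: 1) - F (cinv c z) s))) //.
by apply/funext => h /=; rewrite scaler0 add0r.
Qed.

Lemma family_time_derivable (x : S) (t : R) : t < 0 -> derivable (F x) t 1.
Proof.
move=> t0; have [c Ac cx] := hcover x.
have : derivable (P c) (cmap c x, t) (0, 1) by apply: diff_derivable; exact: P_diff.
rewrite /derivable /= (_ : (fun h => _) = (fun h : R => h^-1 *: ((F x \o shift t) (h *: 1) - F x t))) //.
by apply/funext => h /=; rewrite scaler0 add0r cinvK.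
Qed.

Lemma time_derivative_continuous (t : R) : t < 0 -> continuous (fun x => derive1 (F x) t).
Proof.
move=> t0 x; have [c Ac cx] := hcover x.
have cD := @P_diff_cont c x t (0, 1) Ac cx t0.
have cm : (cmap c y, t) @[y --> x] --> (cmap c x, t).
  by have := cvg_pair (cmap_cont Ac cx) (@cvg_cst _ t _ (nbhs x) _); apply.
have e y : cdom c y -> 'D_(0, 1) (P c) (cmap c y, t) = derive1 (F y) t.
  by move=> cy; rewrite derive_time (cinvK Ac cy).
have h := cvg_comp _ _ cm cD; rewrite (e x cx) in h.
apply: cvg_trans h; apply: near_eq_cvg.
by apply: filterS (cdom_nbhs Ac cx) => y cy; exact: e.
Qed.

Let slice_diff c x (t : R) : A c -> cdom c x -> t < 0 ->
  differentiable (F^~ t \o cinv c) (cmap c x).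
Proof.
move=> Ac cx t0.
rewrite (_ : F^~ t \o cinv c = P c \o (fun z => (z, t))) //.
apply: differentiable_comp; last exact: P_diff.
by apply: differentiable_pair.
Qed.

(* The tangent space can be computed in any one chart, by the chain rule for
   the transition map. *)
Lemma tangent_spaceE c x (t : R) w : A c -> cdom c x -> t < 0 ->
  tangent_space A (F^~ t) x w <-> exists v, w = 'D_v (F^~ t \o cinv c) (cmap c x).
Proof.
move=> Ac cx t0; split; last by move=> [v ->]; exists c; split=> //; exists v.
move=> [c' [Ac' c'x [v ->]]].
pose psi := cmap c \o cinv c'.
have psix : psi (cmap c' x) = cmap c x by rewrite /psi /= cinvK.
have im : (cmap c' @` (cdom c' `&` cdom c)) (cmap c' x) by exists x.
have dpsi : differentiable psi (cmap c' x).
  have [_ _ [_ _ trans]] := hS.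
  by have [+ _] := trans c' c Ac' Ac 1%N; apply.
have dg : differentiable (F^~ t \o cinv c) (psi (cmap c' x)).
  by rewrite psix; exact: slice_diff.
exists ('D_v psi (cmap c' x)).
rewrite (@near_eq_derive _ _ _ _ ((F^~ t \o cinv c) \o psi)); last first.
  have [oc' oi' _ _ ci'] := hchart Ac'.
  have n1 : \forall z \near cmap c' x, cimg c' z.
    by apply: open_nbhs_nbhs; split=> //; exists x.
  have n2 : \forall z \near cmap c' x, cdom c (cinv c' z).
    have := ci' (cmap c' x) (ex_intro2 _ _ x c'x erefl).
    by rewrite /prop_for /continuous_at cinvK //; apply; exact: cdom_nbhs.
  apply: filterS2 n1 n2 => z' [y c'y <-{z'}].
  by rewrite /psi /comp !(cinvK Ac' c'y) => cy; rewrite (cinvK Ac cy).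
by rewrite (derive_comp v dpsi dg) psix.
Qed.

(** The matrix of the differential in one chart, injective by the immersion property: the form in
    which [perp_part_row] takes a subspace. *)
Lemma tangent_space_rows (x : S) (t : R) : t < 0 -> exists2 B : 'M[R]_(k, n),
  (forall u : 'rV[R]_k, u *m B = 0 -> u = 0) &
  forall w, tangent_space A (F^~ t) x w <-> exists u : 'rV[R]_k, w = u *m B.
Proof.
move=> t0; have [c Ac cx] := hcover x.
have dg := slice_diff Ac cx t0.
pose L : {linear 'rV[R]_k -> 'rV[R]_n} := 'd (F^~ t \o cinv c) (cmap c x).
have LE v : 'D_v (F^~ t \o cinv c) (cmap c x) = v *m lin1_mx L.
  by rewrite deriveE // mul_rV_lin1.
exists (lin1_mx L).
  move=> u; rewrite -LE => Du.
  by have [_ /(_ t (negE t0)) [imm _]] := hF; exact: imm Ac cx Du.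
move=> w; split.
  by move=> /(tangent_spaceE _ Ac cx t0) [v ->]; exists v; rewrite LE.
by move=> [u ->]; apply/(tangent_spaceE _ Ac cx t0); exists u; rewrite LE.
Qed.

Lemma tangent_space_rescaled (x : S) (t : R) : t < 0 ->
  tangent_space A ((rescaled F)^~ t) x = tangent_space A (F^~ t) x.
Proof.
move=> t0; have s0 : 0 < Num.sqrt `|t| by rewrite sqrtr_gt0 normr_gt0 lt_eqF.
set l := (Num.sqrt `|t|)^-1; have l0 : l != 0 by rewrite invr_eq0 gt_eqF.
have D c v : A c -> cdom c x ->
    'D_v ((rescaled F)^~ t \o cinv c) (cmap c x) = l *: 'D_v (F^~ t \o cinv c) (cmap c x).
  move=> Ac cx; rewrite -deriveZ; last by apply: diff_derivable; exact: slice_diff.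
  by [].
have Dl c v (a : R) : A c -> cdom c x ->
    'D_(a *: v) (F^~ t \o cinv c) (cmap c x) = a *: 'D_v (F^~ t \o cinv c) (cmap c x).
  by move=> Ac cx; rewrite !deriveE ?linearZ //; exact: slice_diff.
apply/seteqP; split=> w [c [Ac cx [v ->]]]; exists c; split=> //.
  by exists (l *: v); rewrite D // Dl.
by exists (l^-1 *: v); rewrite D // Dl // scalerA divff ?scale1r.
Qed.

(** The product rule, the factor (-t)^(-1/2) having derivative (-t)^(-1/2) / (2 |t|); it produces
    the drift x / (2 |t|) of the rescaled flow. *)
Lemma rescaled_derive1 (x : S) (t : R) : t < 0 ->
  derive1 (rescaled F x) t =
  (Num.sqrt `|t|)^-1 *: (derive1 (F x) t + (2 * `|t|)^-1 *: F x t).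
Proof.
move=> t0; have nt0 : 0 < - t by rewrite oppr_gt0.
pose g (s : R) : R := (Num.sqrt (- s))^-1.
have dn : is_derive t (1 : R) (fun s : R => -1 * s) (-1).
  by apply: dereq (derMl (-1) (derI t)) _; rewrite mulr1.
have pos1 : 0 < -1 * t by rewrite mulN1r.
have ds := is_derive1_sqrt pos1.
have dg : is_derive t (1 : R) g (g t * (2 * `|t|)^-1).
  have sn0 : Num.sqrt (-1 * t) != 0 by rewrite gt_eqF // sqrtr_gt0.
  have dV := @is_deriveV _ (fun z => Num.sqrt (-1 * z)) t _ 1 sn0 (dercomp dn ds).
  rewrite (_ : g = (fun y => (Num.sqrt (-1 * y))^-1)); last first.
    by apply/funext => s; rewrite mulN1r.
  apply: dereq dV _; rewrite /GRing.scale /= ltr0_norm // mulN1r.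
  have := sqr_sqrtr (ltW nt0).
  set q := Num.sqrt (- t) => q2; rewrite -q2.
  have q0 : q != 0 by rewrite gt_eqF // sqrtr_gt0.
  by field.
have dF := @family_time_derivable x t t0.
have near_eq : \forall s \near t, rescaled F x s = \row_i (g s * F x s 0 i).
  have : \forall s \near t, s < 0 by exact: lt_nbhsl.
  by apply: filterS => s s0; apply/rowP => i; rewrite !mxE ltr0_norm.
have dFi i : derivable (fun s => F x s 0 i) t 1 by exact: (derivable_mxP _ _ _).1.
have dprod i : is_derive t (1 : R) (fun s => g s * F x s 0 i)
    (g t * ((derive1 (F x) t) 0 i + (2 * `|t|)^-1 * F x t 0 i)).
  have hF' : is_derive t (1 : R) (fun s => F x s 0 i) ((derive1 (F x) t) 0 i).
    by apply: DeriveDef => //; rewrite derive1E derive_mx // mxE.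
  apply: dereq (derM dg hF') _; ring.
rewrite derive1E (near_eq_derive _ near_eq) derive_mx; last first.
  apply/derivable_mxP => i0 i; rewrite ord1 /=.
  rewrite (_ : (fun s => _) = fun s => g s * F x s 0 i); first by have [] := dprod i.
  by apply/funext => s; rewrite mxE.
apply/rowP => i; rewrite !mxE.
rewrite (_ : (fun s => _) = fun s => g s * F x s 0 i); last first.
  by apply/funext => s; rewrite mxE.
by have [_ ->] := dprod i; rewrite /g ltr0_norm.
Qed.

Section Conormal.
Variables (t : R) (nu : 'rV[R]_n -> 'rV[R]_n).
Hypotheses (t0 : t < 0) (nu1 : forall x, enorm (nu (F x t)) <= 1)
  (nuT : forall x w, tangent_space A (F^~ t) x w -> dot (nu (F x t)) w = 0).

(** The two velocities differ by a tangent vector, which [nu] annihilates. This trades the normal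
    velocity, defined by a choice, for a derivative that is continuous in [x]. *)
Lemma conormal_velocity x :
  dot (nu (F x t)) (time_velocity_perp A F t x) = dot (nu (F x t)) (derive1 (F x) t).
Proof.
have [B injB VB] := tangent_space_rows x t0.
have [h _] := perp_part_row (derive1 (F x) t) injB VB.
have := nuT h; rewrite dotDr dotNr => /eqP; rewrite subr_eq0 => /eqP <-.
by [].
Qed.

(** The left side is [nu] paired with the velocity of the rescaled boundary. Only its normal part
    counts, and Cauchy-Schwarz with |nu| <= 1 bounds the pairing. *)
Lemma conormal_rescaled_velocity_le x :
  (Num.sqrt `|t|)^-1 *
    dot (nu (F x t)) (derive1 (F x) t + (2 * `|t|)^-1 *: F x t) <=
  enorm (time_velocity_perp A (rescaled F) t x).
Proof.
have [B injB VB] := tangent_space_rows x t0.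
rewrite -dotZr -rescaled_derive1 // /time_velocity_perp tangent_space_rescaled //.
set v := derive1 _ _.
have [h _] := perp_part_row v injB VB.
have := nuT h; rewrite dotDr dotNr => /eqP; rewrite subr_eq0 => /eqP ->.
apply: le_trans (dot_le_enorm _ _) _.
by rewrite -[leRHS]mul1r ler_wpM2r ?enorm_ge0.
Qed.

End Conormal.

End Family.

(** * Borel sets and functions on R^n *)

Section BorelRn.
Context {R : realType} {n : nat}.

Lemma continuous_measurable_Rn (f : 'rV[R]_n -> R) :
  continuous f -> measurable_fun setT (f : borelRn R n -> R).
Proof.
move=> cf; apply: (measurability _ (RGenOInfty.measurableE R)) => _ [_ [x ->] <-].
rewrite setTI; apply: sub_sigma_algebra.
by apply: (@open_comp _ _ f `]x, +oo[%classic) => [y _|]; [exact: cf|exact: interval_open].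
Qed.

Lemma closed_measurable_Rn (K : set 'rV[R]_n) : closed K -> measurable (K : set (borelRn R n)).
Proof.
move=> cK; rewrite -[K]setCK; apply: measurableC; apply: sub_sigma_algebra.
exact: closed_openC.
Qed.

Lemma compact_measurable_Rn (K : set 'rV[R]_n) : compact K -> measurable (K : set (borelRn R n)).
Proof.
by move=> cK; apply: closed_measurable_Rn; apply: compact_closed => //; exact: norm_hausdorff.
Qed.

Lemma measurable_coord (D : set (borelRn R n)) (f : borelRn R n -> borelRn R n) i :
  measurable D -> measurable_fun D f -> measurable_fun D (fun x => (f x : 'rV[R]_n) 0 i).
Proof.
move=> mD mf; apply: (@measurableT_comp _ _ _ _ _ _ (fun y : borelRn R n => (y : 'rV[R]_n) 0 i)) => //.
by apply: continuous_measurable_Rn; exact: coord_cont.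
Qed.

Lemma measurable_dot (D : set (borelRn R n)) (f g : borelRn R n -> 'rV[R]_n) :
  (forall i, measurable_fun D (fun x => f x 0 i)) ->
  (forall i, measurable_fun D (fun x => g x 0 i)) ->
  measurable_fun D (fun x => dot (f x) (g x)).
Proof.
move=> mf mg; apply: measurable_sum => i; exact: measurable_funM.
Qed.

(* [h @^-1` `[x, +oo[ `&` range f] is the image of a compact subset of [S]. *)
Lemma transport_measurable (S : topologicalType) (f : S -> 'rV[R]_n) (g : S -> R)
    (h : 'rV[R]_n -> R) : compact [set: S] -> continuous f -> continuous g ->
  (forall x, h (f x) = g x) -> measurable_fun (range f : set (borelRn R n)) (h : borelRn R n -> R).
Proof.
move=> cS cf cg hg.
apply: (measurability _ (RGenCInfty.measurableE R)) => _ [_ [x ->] <-].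
have -> : range f `&` h @^-1` `[x, +oo[%classic = f @` (g @^-1` `[x, +oo[%classic).
  apply/seteqP; split=> [_ [[y _ <-]] /=|_ [y /= gy <-]].
    by rewrite hg => gy; exists y.
  by split; [exists y|rewrite /= hg].
apply: compact_measurable_Rn; apply: continuous_compact.
  by apply: continuous_subspaceT => y; exact: cf.
apply: (subclosed_compact _ cS) => //.
by apply: (closed_comp (f := g)) => [y _|]; [exact: cg|exact: interval_closed].
Qed.

Lemma box_compact (c : R) : compact [set x : 'rV[R]_n | forall i, - c <= x 0 i <= c].
Proof.
have sc : compact `[- c, c]%classic by exact: segment_compact.
have := @rV_compact R n (fun _ => `[- c, c]%classic) (fun _ => sc).
by rewrite (_ : [set v : 'rV[R]_n | _] = [set x | forall i, - c <= x 0 i <= c]).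
Qed.

(** A half-width of c + 1 avoids square roots, as (c + 1)^2 > c. *)
Lemma box_sqnorm (c : R) (x : 'rV[R]_n) : 0 <= c ->
  ~ (forall i, - (c + 1) <= x 0 i <= c + 1) -> c < dot x x.
Proof.
move=> c0 /existsNP[i hi]; apply: lt_le_trans (sqr_coord_le_dot x i).
apply: contrapT => hle; apply: hi; move/negP: hle; rewrite -leNgt => hle.
by apply/andP; split; nra.
Qed.

End BorelRn.

Lemma transportE {R : realType} {n : nat} {S : topologicalType} {V : zmodType}
  (f : S -> 'rV[R]_n) (g : S -> V) x : injective f -> transport f g (f x) = g x.
Proof.
move=> injf; rewrite /transport.
have [|y /= fyx <-] := @xgetPex _ 0 (g @` (f @^-1` [set f x])); first by exists (g x); exists x.
by rewrite (injf _ _ fyx).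
Qed.

Lemma measurable_test {R : realType} {n : nat} (m : nat) (a b r : R) (N : nat) (t : R) : b < 0 ->
  measurable_fun [set: borelRn R n] (fun q : borelRn R n => test m a b r N (q, t) : R).
Proof.
move=> b0; have cu : continuous (fun q : 'rV[R]_n => test m a b r N (q, t)).
  move=> q; apply: (@continuous_comp _ _ _ (fun q : 'rV[R]_n => (q, t)) (test m a b r N)).
    by have := cvg_pair (@cvg_id _ (nbhs q)) (@cvg_cst _ t _ (nbhs q) _); apply.
  exact: (Ck_continuous (@Ck_test R n m a b r N b0)).
exact: continuous_measurable_Rn cu.
Qed.

(** * Integrability from the energy on compact sets *)

Section DominatedByEnergy.
Context {R : realType} {n : nat}.
Variables (M : {measure set (borelRn R n) -> \bar R}) (H : 'rV[R]_n -> 'rV[R]_n).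
Hypothesis mH : measurable_fun [set: borelRn R n] (H : borelRn R n -> borelRn R n).

Definition energy (K : set 'rV[R]_n) : \bar R :=
  (\int[M]_(x in (K : set (borelRn R n))) (1 + enorm (H x) ^+ 2)%:E)%E.

Lemma energy_ge0 K : (0 <= energy K)%E.
Proof.
by apply: integral_ge0 => x _; rewrite lee_fin addr_ge0 // exprn_ge0 // enorm_ge0.
Qed.

Lemma measurable_energy_density :
  measurable_fun [set: borelRn R n] (fun x : borelRn R n => 1 + enorm (H x) ^+ 2 : R).
Proof.
apply: measurable_funD => //.
rewrite (_ : (fun x => _) = fun x => dot (H x) (H x)); last first.
  by apply/funext => x; rewrite enorm_sqr.
by apply: measurable_dot => i; apply: (measurable_coord (f := H)).
Qed.

Lemma energyZ (K : set (borelRn R n)) (c : R) : measurable K -> 0 <= c ->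
  (\int[M]_x ((fun x : borelRn R n => (c * (1 + enorm (H x) ^+ 2))%:E) \_ K) x =
   c%:E * energy K)%E.
Proof.
move=> mK c0; rewrite -integral_mkcond.
under eq_integral do rewrite EFinM.
rewrite ge0_integralZl_EFin //.
- by move=> x _; rewrite lee_fin addr_ge0 // exprn_ge0 // enorm_ge0.
- by apply/measurable_EFinP; apply: measurable_funS measurable_energy_density.
Qed.

Lemma integrable_energy_bound (f : borelRn R n -> R) (C : R) (K : set (borelRn R n)) :
  measurable K -> 0 <= C -> (energy K < +oo)%E -> measurable_fun setT f ->
  (forall x, `|f x| <= C * (1 + enorm (H x) ^+ 2)) -> (forall x, ~ K x -> f x = 0) ->
  M.-integrable setT (EFin \o f) /\ (`|\int[M]_x (f x)%:E| <= C%:E * energy K)%E.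
Proof.
move=> mK C0 Efin mf fC f0.
have mfE : measurable_fun setT (EFin \o f) by exact/measurable_EFinP.
have dom : (\int[M]_x `|(f x)%:E| <= C%:E * energy K)%E.
  rewrite -energyZ //; apply: ge0_le_lower_integral => x _ //.
  have [Kx|nK] := pselect (K x); first by rewrite patchT ?inE //= lee_fin.
  by rewrite patchC ?inE //= f0 // normr0.
split; last by apply: le_trans dom; apply: le_abse_integral.
apply/integrableP; split=> //; apply: le_lt_trans dom _.
by rewrite lte_mul_pinfty // ?lee_fin.
Qed.

End DominatedByEnergy.

(** * The monotonicity inequality at a fixed time *)

Section FixedTime.
Context {R : realType} {m n : nat} {S : topologicalType}.
Hypothesis hm : (0 < m)%N.
Variables (A : set (chart R m.-1 S)) (F : S -> R -> 'rV[R]_n).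
Hypotheses (hS : closed_manifold A)
           (hF : smooth_family_of_embeddings A `]-oo, 0[ F).
Variables (a b r : R) (N : nat).
Hypotheses (b0 : b < 0) (ab : a <= b) (r0 : 0 <= r).
Variables (t : R).
Hypotheses (at_ : a <= t) (tb : t <= b).
Hypothesis rF : forall x, shifted m a (dot (F x t) (F x t)) t <= r.
Variables (M : {measure set (borelRn R n) -> \bar R}) (H nu : 'rV[R]_n -> 'rV[R]_n).
Hypothesis fv : first_variation_with_boundary m A (F^~ t) M H nu.

Local Notation u := (@test R n m a b r N).
Local Notation X := (@test_field R n m a b r N t).
Local Notation box c := [set x : 'rV[R]_n | forall i, - c <= x 0 i <= c].
Let K := box (radius r N + 1).
Let K0 := box (r + 2 + 1).
Hypotheses (EK : (energy M H K < +oo)%E).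

Let Gamma : set (borelRn R n) := range (F^~ t).

Let t0 : t < 0. Proof. exact: le_lt_trans b0. Qed.

Let mH : measurable_fun [set: borelRn R n] (H : borelRn R n -> borelRn R n).
Proof. by have [_ [+ _] _ _ _] := fv. Qed.

Let mK : measurable (K : set (borelRn R n)).
Proof. by apply: compact_measurable_Rn; exact: box_compact. Qed.

Let mK0 : measurable (K0 : set (borelRn R n)).
Proof. by apply: compact_measurable_Rn; exact: box_compact. Qed.

Let injF : injective (F^~ t).
Proof. by have [_ /(_ t)] := hF; rewrite /= in_itv /= => /(_ t0) [_ []]. Qed.

Let cF : continuous (F^~ t).
Proof. exact: (family_continuous_space hS hF). Qed.

Let mGamma : measurable Gamma.
Proof.
apply: compact_measurable_Rn; apply: continuous_compact; last by have [] := hS.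
by apply: continuous_subspaceT => y; exact: cF.
Qed.

Definition boundary_speed (x : S) : R :=
  enorm (time_velocity_perp A (rescaled F) t x) * Phi m (rescaled F x t).

(** The integrand, at time [t], of the integral that defines [Phi_swept]. *)
Definition swept_rate : \bar R :=
  integral_pullback (k := m.-1) ((rescaled F)^~ t) boundary_speed.

Let lam := (Num.sqrt `|t|)^-1.

Let lam0 : 0 < lam.
Proof. by rewrite invr_gt0 sqrtr_gt0 normr_gt0 lt_eqF. Qed.

Lemma kernel_rescaled (q : 'rV[R]_n) :
  kernel m b (dot q q) t = lam ^+ m * Phi m (lam *: q).
Proof.
have nt : 0 < `|t| by rewrite normr_gt0 lt_eqF.
rewrite kernelE // /Phi powRM ?mulr_ge0 ?pi_ge0 // enormZ (ger0_norm (ltW lam0)).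
have -> : `|t| `^ (- (m%:R / 2)) = lam ^+ m.
  rewrite powRN mulrC powRrM powR12_sqrt // powR_mulrn ?sqrtr_ge0 //.
  by rewrite /lam exprVn.
have -> : (lam * enorm q) ^+ 2 = `|t|^-1 * dot q q.
  by rewrite exprMn enorm_sqr /lam exprVn sqr_sqrtr ?normr_ge0.
have -> : dot q q / (4 * `|t|) = `|t|^-1 * dot q q / 4.
  by have tn0 : `|t| != 0 by [rewrite gt_eqF]; field.
by rewrite mulrCA mulrA.
Qed.

Lemma transport_speed (x : S) :
  transport ((rescaled F)^~ t) boundary_speed (lam *: F x t) = boundary_speed x.
Proof.
apply: transportE => y z /= /(congr1 (fun v => lam^-1 *: v)).
by rewrite !scalerA mulVf ?gt_eqF // !scale1r => /injF.
Qed.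

(** The full velocity carried to the boundary; continuity in the parameter makes it measurable by
    [transport_measurable]. *)
Let velocity (q : 'rV[R]_n) := transport (F^~ t) (fun x => derive1 (F x) t) q.

Let velocityE x : velocity (F x t) = derive1 (F x) t.
Proof. exact: transportE. Qed.

Let mnu i : measurable_fun Gamma (fun q : borelRn R n => nu q 0 i : R).
Proof. by have [_ _ _ [mnu _ _] _] := fv; exact: (measurable_coord i mGamma mnu). Qed.

Let mvelocity i : measurable_fun Gamma (fun q : borelRn R n => velocity q 0 i : R).
Proof.
apply: (transport_measurable (g := fun x => derive1 (F x) t 0 i)) => //.
- by have [] := hS.
- move=> x; apply: (@continuous_comp _ _ _ (fun x => derive1 (F x) t) (fun v : 'rV[R]_n => v 0 i)).
    exact: (time_derivative_continuous hS hF).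
  exact: coord_cont.
- by move=> x; rewrite velocityE.
Qed.

Let coord_measurable (D : set (borelRn R n)) i : measurable_fun D (fun q : borelRn R n => (q : 'rV[R]_n) 0 i : R).
Proof.
have := continuous_measurable_Rn (@coord_cont R n i).
by apply: measurable_funS.
Qed.

Let mfield (D : set (borelRn R n)) i : measurable D -> measurable_fun D (fun q : borelRn R n => X q 0 i : R).
Proof.
move=> mD; have cX : continuous (fun q : 'rV[R]_n => X q 0 i).
  move=> q; apply: (@continuous_comp _ _ _ X (fun v : 'rV[R]_n => v 0 i)).
    exact: (Ck_continuous (Ck_test_field m a b r N t)).
  exact: coord_cont.
by apply: measurable_funS (continuous_measurable_Rn cX).
Qed.

Let mtest (D : set (borelRn R n)) : measurable D -> measurable_fun D (fun q : borelRn R n => u (q, t) : R).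
Proof. by move=> mD; apply: measurable_funS (measurable_test m a r N t b0). Qed.

Definition boundary_integral : \bar R :=
  (\int[hausdorffB m.-1]_(q in Gamma) (u (q, t) * dot (nu q) (normal_velocity A F t q))%:E)%E.

Definition conormal_flux : \bar R :=
  (\int[hausdorffB m.-1]_(q in Gamma) (dot (nu q) (X q))%:E)%E.

Let test_Gamma x : u (F x t, t) = kernel m b (dot (F x t) (F x t)) t.
Proof. by rewrite /test /= (cutoff_le_r N (rF x)) mul1r. Qed.

Let field_Gamma x :
  X (F x t) = - (kernel m b (dot (F x t) (F x t)) t * (2 * `|t|)^-1) *: F x t.
Proof.
have tn0 : - t != 0 by rewrite oppr_eq0 lt_eqF.
rewrite /test_field; congr (_ *: _); rewrite /field_coef !(cutoff_le_r N (rF x)) tauE //.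
rewrite ltr0_norm //; set k := kernel _ _ _ _.
by field; rewrite ?tn0 ?lt_eqF.
Qed.

(** On the boundary the cutoff is 1 with derivative 0, so moving the field term to the left gives
    rho nu . (dF/dt + x / (2 |t|)). Of the [m] factors [lam] in the kernel, one turns this velocity
    into the rescaled one and [m.-1] remain for the scaling of Hausdorff measure. *)
Lemma boundary_pointwise x :
  u (F x t, t) * dot (nu (F x t)) (normal_velocity A F t (F x t)) <=
  dot (nu (F x t)) (X (F x t)) + lam ^+ m.-1 * boundary_speed x.
Proof.
have [_ _ _ [_ nu1 nuT] _] := fv.
have -> : normal_velocity A F t (F x t) = time_velocity_perp A F t x by exact: transportE.
rewrite (conormal_velocity hS hF t0 nuT) test_Gamma field_Gamma dotZr.
have := conormal_rescaled_velocity_le hS hF t0 nu1 nuT x.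
rewrite -/lam dotDr dotZr /boundary_speed.
set E := enorm _; set p := dot _ (derive1 _ _); set q := dot _ (F x t) => le.
have Phi0 : 0 <= lam ^+ m.-1 * Phi m (rescaled F x t).
  by rewrite mulr_ge0 ?exprn_ge0 ?(ltW lam0) // mulr_ge0 ?powR_ge0 ?expR_ge0.
have := ler_wpM2l Phi0 le.
rewrite kernel_rescaled -[lam *: F x t]/(rescaled F x t).
have -> : lam ^+ m = lam ^+ m.-1 * lam by rewrite -exprSr prednK.
set P := Phi _ _; set L := lam ^+ m.-1; set i := (2 * _)^-1 => h.
have -> : L * (E * P) = L * P * E by ring.
have -> : L * lam * P * p = L * P * (lam * (p + i * q)) + - (L * lam * P * i) * q by ring.
by rewrite addrC lerD2l.
Qed.

Lemma boundary_measurable : measurable_fun Gamma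
  (fun q : borelRn R n => (u (q, t) * dot (nu q) (normal_velocity A F t q))%:E).
Proof.
apply/measurable_EFinP.
have mW : measurable_fun Gamma (fun q : borelRn R n => u (q, t) * dot (nu q) (velocity q) : R).
  apply: measurable_funM; first exact: mtest.
  by apply: measurable_dot => i; [exact: mnu|exact: mvelocity].
apply: eq_measurable_fun mW => q /set_mem [x _ <-].
have [_ _ _ [_ nu1 nuT] _] := fv; congr (_ * _); rewrite velocityE.
have -> : normal_velocity A F t (F x t) = time_velocity_perp A F t x by exact: transportE.
by rewrite (conormal_velocity hS hF t0 nuT).
Qed.

(** Finiteness of the flux makes its integrand integrable, which allows it to play the part of [b]
    in [integral_le_integrable_add]; the possibly nonmeasurable speed plays that of [g]. *)
Lemma boundary_integral_le : conormal_flux \is a fin_num ->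
  (boundary_integral <= conormal_flux + swept_rate)%E.
Proof.
move=> fin.
have mflux : measurable_fun Gamma (fun q : borelRn R n => dot (nu q) (X q) : R).
  by apply: measurable_dot => i; [exact: mnu|exact: mfield].
have ib : (hausdorffB m.-1).-integrable Gamma (fun q : borelRn R n => (dot (nu q) (X q))%:E).
  apply/integrableP; split; first exact/measurable_EFinP.
  by rewrite integral_fin_num_abs.
pose g (q : borelRn R n) : \bar R := (transport ((rescaled F)^~ t) boundary_speed q)%:E.
have g0 q : (0 <= g q)%E.
  rewrite lee_fin /transport; case: xgetP => [y _ [x _ <-]|//].
  by rewrite mulr_ge0 ?enorm_ge0 // mulr_ge0 ?powR_ge0 ?expR_ge0.
have step : (boundary_integral <= conormal_flux +
    \int[hausdorffB m.-1]_(q in Gamma) ((lam ^+ m.-1)%:E * g (lam *: q)))%E.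
  apply: (@integral_le_integrable_add _ _ _ (hausdorffB m.-1)) => //.
  - exists (fun q : borelRn R n => (u (q, t) * dot (nu q) (normal_velocity A F t q))%:E).
      exact: boundary_measurable.
    by exists set0; split=> // q /= /not_implyP[].
  - by move=> q _; rewrite mule_ge0 // lee_fin exprn_ge0 // ltW.
  exists set0; split=> // q /= /not_implyP[[x _ <-]] []; rewrite /g transport_speed.
  by rewrite -EFinM -EFinD lee_fin; exact: boundary_pointwise.
apply: le_trans step _; apply: leeD2l.
have -> : swept_rate = (\int[hausdorffB m.-1]_(q in (fun x => lam *: x) @` Gamma) g q)%E.
  by rewrite /swept_rate /integral_pullback /Gamma image_comp.
exact: hausdorff_integral_scale_le.
Qed.

Let cut_cont : continuous (fun s => cutoff r N (shifted m a s t)).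
Proof.
by move=> s; exact: (der_continuous (is_derive_shifted_s (is_derive_cutoff r N (shifted m a s t)))).
Qed.

Let cut1_cont : continuous (fun s => cutoff1 r N (shifted m a s t)).
Proof.
by move=> s; exact: (der_continuous (is_derive_shifted_s (is_derive_cutoff1 r N (shifted m a s t)))).
Qed.

Let ker_cont : continuous (fun s => kernel m b s t).
Proof. by move=> s; exact: der_continuous (is_derive_kernel_s m b s t). Qed.

Let mradial (g : R -> R) : continuous g ->
  measurable_fun [set: borelRn R n] (fun x : borelRn R n => g (dot x x) : R).
Proof.
move=> cg; apply: (@continuous_measurable_Rn R n (fun x => g (dot x x))) => x.
apply: (@continuous_comp _ _ _ (fun x : 'rV[R]_n => dot x x) g); last exact: cg.
exact: (Ck_continuous (Ck_sqnorm 0)).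
Qed.

Lemma test_integrand_measurable :
  measurable_fun [set: borelRn R n] (fun x : borelRn R n => test_integrand m a b r N t x (H x) : R).
Proof.
rewrite (_ : (fun x => _) = fun x : borelRn R n =>
   (- (cutoff r N (shifted m a (dot x x) t) * kernel m b (dot x x) t)) * dot (H x) (H x)
  + (2 * test_s m a b r N (dot x x) t) * dot (H x) x + test_t m a b r N (dot x x) t); last first.
  by apply/funext => x; rewrite test_integrandE.
have mHi i : measurable_fun [set: borelRn R n] (fun x : borelRn R n => H x 0 i : R).
  exact: (measurable_coord (f := H)).
apply: measurable_funD; first (apply: measurable_funD; apply: measurable_funM).
- apply: (mradial (g := fun s => - (cutoff r N (shifted m a s t) * kernel m b s t))) => s.
  by apply: cvgN; apply: cvgM; [exact: cut_cont|exact: ker_cont].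
- by apply: measurable_dot.
- apply: (mradial (g := fun s => 2 * test_s m a b r N s t)) => s.
  apply: cvgM; first exact: cvg_cst.
  apply: cvgM; last exact: ker_cont.
  apply: cvgB; first exact: cut1_cont.
  by apply: cvgM; [exact: cut_cont|exact: cvg_cst].
- by apply: measurable_dot => i //; exact: coord_measurable.
- apply: (mradial (g := fun s => test_t m a b r N s t)) => s.
  apply: cvgM; last exact: ker_cont.
  apply: cvgD; first by apply: cvgM; [exact: cvg_cst|exact: cut1_cont].
  apply: cvgM; first exact: cut_cont.
  apply: cvgB; first exact: cvg_cst.
  by apply: cvgM; [exact: cvg_id|exact: cvg_cst].
Qed.

Definition interior_integral : \bar R :=
  (\int[M]_x (test_integrand m a b r N t x (H x))%:E)%E.

Let rad0 : 0 <= radius r N. Proof. by rewrite /radius !addr_ge0. Qed.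

Let outK (x : 'rV[R]_n) : ~ K x -> radius r N <= dot x x.
Proof. by move=> nK; apply/ltW; exact: box_sqnorm. Qed.

Let test_integrand_out x : ~ K x -> test_integrand m a b r N t x (H x) = 0.
Proof.
move=> /outK xr; have [z1 z2 z3 _ _] := test_vanish m b at_ xr.
rewrite test_integrandE // z2 z3 [cutoff _ _ _ * _]z1.
by rewrite oppr0 mul0r mulr0 mul0r !addr0.
Qed.

Lemma interior_integral_bound (C : R) : 0 <= C ->
  (forall x h : 'rV[R]_n, `|test_integrand m a b r N t x h| <= C * (1 + enorm h ^+ 2)) ->
  M.-integrable setT (fun x => (test_integrand m a b r N t x (H x))%:E) /\
  (`|interior_integral| <= C%:E * energy M H K)%E.
Proof.
move=> C0 hC; apply: (integrable_energy_bound mH mK C0 EK) => //.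
- exact: test_integrand_measurable.

Qed.

(** The first variation formula expresses the flux through the integrals of the divergence of the
    field and of H . X. Both are dominated by the energy on the support, which makes the flux
    finite. *)
Lemma fixed_time_inequality : conormal_flux \is a fin_num /\
  (interior_integral + conormal_flux <=
   (72 * kernel m b 0 b * (r + 2) / N.+1%:R)%:E * energy M H K0)%E.
Proof.
have [C C0 hC] := @test_bounds R n m a b r N b0 r0.
pose q x := test_integrand m a b r N t x (H x).
pose p x := dot (H x) (X x).
pose E := tangent_frame m M.
pose dv x := divergence m M X x.
have [intq _] : M.-integrable setT (fun x => (q x)%:E) /\ (`|interior_integral| <= C%:E * energy M H K)%E.
  by apply: interior_integral_bound => // x h; have [_ h1 _ _] := hC t x at_ tb; exact: h1.
have mp : measurable_fun [set: borelRn R n] (p : borelRn R n -> R).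
  apply: measurable_dot => i; last exact: mfield.
  exact: (measurable_coord (f := H)).
have [intp _] : M.-integrable setT (EFin \o (p : borelRn R n -> R)) /\
    (`|\int[M]_x (p x)%:E| <= C%:E * energy M H K)%E.
  apply: (integrable_energy_bound mH mK C0 EK) => // x.
    by have [_ _ h1 _] := hC t x at_ tb; exact: h1.
  move=> /outK xr; have [_ _ _ z _] := test_vanish m b at_ xr.
  by rewrite /p /test_field z scale0r dotC dot0l.
have [_ _ aeE _ fvX] := fv.
have csX : compactly_supported X.
  exists K; first exact: box_compact.
  move=> x /outK xr; have [_ _ _ z _] := test_vanish m b at_ xr.
  by rewrite /test_field z scale0r.
(* [d] is a measurable version of the divergence, whose tangent frame is chosen arbitrarily at each
   point. *)
have [[d md dvd] eqX] := fvX X (Ck_test_field m a b r N t) csX.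
have divE x : is_tangent_frame M x (E x) -> dv x =
    m%:R * field_coef m a b r N (dot x x) t +
    2 * field_coef_s m a b r N (dot x x) t * tangential_sqr (E x) x.
  by move=> [E1 _]; exact: divergence_test_field.
have aeF : Filter (nbhs (almost_everywhere M)) by exact: ae_filter_ringOfSetsType.
have intd : M.-integrable setT d.
  apply/integrableP; split=> //.
  apply: (@le_lt_trans _ _ (C%:E * energy M H K)%E); last first.
    by rewrite lte_mul_pinfty // ?lee_fin.
  rewrite -energyZ //.
  apply: ae_ge0_le_lower_integral => //.
  - exact: measurableT_comp.
  - move=> x _; apply: erestrict_ge0 => y _.
    by rewrite lee_fin mulr_ge0 // addr_ge0 // exprn_ge0 // enorm_ge0.
  apply: filterS2 aeE dvd => x [Ex _] /(_ I) dE _; rewrite -dE -/(dv x) divE //.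
  have [E1 _] := Ex; have [Kx|nK] := pselect (K x).
    rewrite patchT ?inE //= lee_fin.
    have [_ _ _ /(_ (E x) E1) le] := hC t x at_ tb; apply: le_trans le _.
    by rewrite ler_peMr // lerDl exprn_ge0 // enorm_ge0.
  have [_ _ _ z4 z5] := test_vanish m b at_ (outK nK).
  by rewrite patchC ?inE //= z4 z5 !mulr0 mul0r addr0 normr0.
have eqd : (\int[M]_x (dv x)%:E = \int[M]_x d x)%E.
  exact: ae_eq_lower_integral.
have fd : (\int[M]_x d x)%E \is a fin_num by exact: integrable_fin_num.
have fp : (\int[M]_x (p x)%:E)%E \is a fin_num by exact: (integrable_fin_num measurableT intp).
have fluxE : conormal_flux = (\int[M]_x (p x)%:E + \int[M]_x d x)%E.
  have := eqX; rewrite -/conormal_flux [X in X = _]eqd => ->.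
  by rewrite addeA subee // add0e.
split; first by rewrite fluxE fin_numD fp fd.
pose c := 72 * kernel m b 0 b * (r + 2) / N.+1%:R.
have c0 : 0 <= c.
  by rewrite divr_ge0 // mulr_ge0 ?addr_ge0 // mulr_ge0 // kernel_ge0.
(* With the flux replaced by its value, the integrands add up to the left side of
   [huisken_inequality]. The bound there vanishes where |x|^2 > r + 2, in particular outside
   [K0]. *)
rewrite fluxE addeA /interior_integral -/q.
have intqp : M.-integrable setT (fun x => (q x)%:E + (p x)%:E)%E by exact: integrableD.
rewrite -(integralD _ intq intp) // -(integralD _ intqp intd) // -/c -energyZ //.
have := @integral_le_integrable_add _ _ _ M setT
  (fun x => ((q x)%:E + (p x)%:E) + d x)%E (cst 0%E)
  ((fun x : borelRn R n => (c * (1 + enorm (H x) ^+ 2))%:E) \_ K0) measurableT.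
rewrite integral0 add0e; apply.
- exists (fun x => ((q x)%:E + (p x)%:E) + d x)%E; last by exists set0; split=> // x /= /not_implyP[].
  by have /integrableP[] := integrableD measurableT intqp intd.
- exact: integrable0.
- move=> x _; apply: erestrict_ge0 => y _.
  by rewrite lee_fin mulr_ge0 // addr_ge0 // exprn_ge0 // enorm_ge0.
apply: filterS2 aeE dvd => x [Ex EH] /(_ I) dE _; rewrite -dE -/(dv x) divE // add0e.
have [E1 _] := Ex; rewrite -!EFinD.
have le := huisken_inequality r N b0 x at_ tb E1 EH.
apply: (@le_trans _ _ (c * (dot x x <= r + 2)%R%:R)%:E); first by rewrite lee_fin.
have [Kx|nK] := pselect (K0 x).
  rewrite patchT ?inE //= lee_fin ler_wpM2l //; apply: (@le_trans _ _ 1); first by case: (dot x x <= r + 2)%R; rewrite ?ler01.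
  by rewrite lerDl exprn_ge0 // enorm_ge0.
have xr : r + 2 < dot x x by apply: box_sqnorm => //; rewrite addr_ge0.
have -> : (dot x x <= r + 2)%R = false by apply/negbTE; rewrite -ltNge.
by rewrite patchC ?inE //= lee_fin mulr0.
Qed.

End FixedTime.

Lemma swept_rate_ge0 {R : realType} (m n : nat) (S : topologicalType)
    (A : set (chart R m.-1 S)) (F : S -> R -> 'rV[R]_n) (t : R) : (0 <= swept_rate A F t)%E.
Proof.
apply: integral_ge0 => q _; rewrite lee_fin /transport.
case: xgetP => [y _ [x _ <-]|//].
by rewrite mulr_ge0 ?enorm_ge0 // mulr_ge0 ?powR_ge0 ?expR_ge0.
Qed.

Lemma ae_measurable_dominated d (T : measurableType d) {R : realType}
    (mu : {measure set T -> \bar R}) (D : set T) (f g : T -> \bar R) :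
  measurable D -> ae_measurable mu D f -> (forall x, D x -> (0 <= g x)%E) ->
  {ae mu, forall x, D x -> (`|f x| <= g x)%E} -> (\int[mu]_(x in D) g x < +oo)%E ->
  exists2 h, mu.-integrable D h & f = h %[ae mu in D].
Proof.
move=> mD [h mh fh] g0 fg gfin; exists h => //; apply/integrableP; split=> //.
apply: le_lt_trans gfin; apply: ae_ge0_le_lower_integral => //.
  exact: measurableT_comp.
by apply: filterS2 fh fg => x fh fg Dx; rewrite -fh ?fg.
Qed.

Lemma le_add_harmonic {R : realType} (x y : \bar R) (d : R) (N0 : nat) : 0 <= d ->
  (forall N, (N0 <= N)%N -> (x <= y + (d / N.+1%:R)%:E)%E) -> (x <= y)%E.
Proof.
move=> d0 h; apply/lee_addgt0Pr => e e0.
have de0 : 0 <= d / e by rewrite divr_ge0 // ltW.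
pose N := maxn N0 (Num.bound (d / e)).
apply: le_trans (h N (leq_maxl _ _)) _; apply: leeD2l; rewrite lee_fin.
rewrite ler_pdivrMr ?ltr0n // mulrC -ler_pdivrMr //.
apply: le_trans (ltW (archi_boundP de0)) _.
by rewrite ler_nat ltnW // ltnS leq_maxr.
Qed.

(** * Integration in time *)

Section TimeIntegration.
Context {R : realType} {m n : nat} {S : topologicalType}.
Hypothesis hm : (0 < m)%N.
Variables (A : set (chart R m.-1 S)) (F : S -> R -> 'rV[R]_n).
Hypotheses (hS : closed_manifold A)
           (hF : smooth_family_of_embeddings A `]-oo, 0[ F).
Variable M : R -> {measure set (borelRn R n) -> \bar R}.
Hypothesis hM : brakke_flow m A `]-oo, 0[ F M.
Variables (a b r : R).
Hypotheses (b0 : b < 0) (ab : a <= b) (r0 : 0 <= r).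
Hypothesis rF : forall x t, a <= t -> t <= b -> shifted m a (dot (F x t) (F x t)) t <= r.
Local Notation leb := (@lebesgue_measure R).
Local Notation u N := (@test R n m a b r N).
Local Notation box c := [set x : 'rV[R]_n | forall i, - c <= x 0 i <= c].

Let rad0 N : 0 <= radius r N. Proof. by rewrite /radius !addr_ge0. Qed.

Let outK N x : ~ box (radius r N + 1) x -> radius r N <= dot x x.
Proof. by move=> nK; apply/ltW; exact: box_sqnorm. Qed.

Let abI : [set` `[a, b]] `<=` [set` `]-oo, (0 : R)[].
Proof. by move=> t /=; rewrite !in_itv /= => /andP[_] /le_lt_trans; apply. Qed.

(** Allows the difference in the Brakke inequality to be rearranged; the full Gaussian areas may be
    infinite. *)
Lemma test_integral_fin N t : a <= t -> t <= b -> (\int[M t]_x (u N (x, t))%:E)%E \is a fin_num.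
Proof.
move=> at_ tb; have [rad _] := hM.
have t0 : t < 0 by exact: le_lt_trans b0.
have cK := @box_compact R n (radius r N + 1).
have mK := compact_measurable_Rn cK.
rewrite ge0_fin_numE; last by apply: integral_ge0 => x _; rewrite lee_fin test_ge0.
apply: (@le_lt_trans _ _ ((kernel m b 0 b)%:E * M t (box (radius r N + 1)))%E); last first.
  rewrite lte_mul_pinfty ?lee_fin ?kernel_ge0 //.
  by apply: rad => //; rewrite /= in_itv.
rewrite -integral_cst // integral_mkcond; apply: ge0_le_lower_integral => x _.
  by rewrite lee_fin test_ge0.
have [Kx|nK] := pselect (box (radius r N + 1) x).
  rewrite patchT ?inE //= lee_fin.
  have /andP[f0 f1] := cutoff_bounds r N (shifted m a (dot x x) t).
  apply: (@le_trans _ _ (kernel m b (dot x x) t)); last by apply: kernel_le => //; exact: dot_ge0.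
  by rewrite /test /= ler_piMl // kernel_ge0.
have [-> _ _ _ _] := test_vanish m b at_ (outK nK).
by rewrite patchC ?inE.
Qed.

(** [d] involves the energy of the box of half-width r + 3 only, so it is the same for all [N]. The
    boxes that grow with [N] are used for integrability alone. *)
Lemma test_flow_inequality : exists2 d : R, 0 <= d & forall N,
  (\int[M b]_x (u N (x, b))%:E <= \int[M a]_x (u N (x, a))%:E +
     ((d / N.+1%:R)%:E + \int[leb]_(t in `[a, b]) swept_rate A F t))%E.
Proof.
have [rad [H [nu [fv en br]]]] := hM.
have aeF : Filter (nbhs (almost_everywhere leb)) by exact: ae_filter_ringOfSetsType.
have mJ : measurable ([set` `[a, b]] : set (g_sigma_algebraType R.-ocitv.-measurable)).
  exact: measurable_itv.
have fin_energy c : exists2 h, leb.-integrable [set` `[a, b]] h &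
    ae_eq leb [set` `[a, b]] (fun t => energy (M t) (H t) (box c)) h.
  have [me fe] := en (box c) a b (@box_compact R n c) ab abI.
  apply: (ae_measurable_dominated _ me _ _ fe) => //.
  - by move=> t _; exact: energy_ge0.
  - by apply: aeW => t _; rewrite gee0_abs // energy_ge0.
have [h0 ih0 eh0] := fin_energy (r + 2 + 1).
have E00 : (0 <= \int[leb]_(t in `[a, b]) h0 t)%E.
  rewrite -(ae_eq_lower_integral eh0); apply: integral_ge0 => t _; exact: energy_ge0.
have fE0 : (\int[leb]_(t in `[a, b]) h0 t)%E \is a fin_num by exact: integrable_fin_num.
pose c := 72 * kernel m b 0 b * (r + 2).
have c0 : 0 <= c.
  by rewrite /c mulr_ge0 ?addr_ge0 // mulr_ge0 // kernel_ge0.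
exists (c * fine (\int[leb]_(t in `[a, b]) h0 t)%E); first by rewrite mulr_ge0 // fine_ge0.
move=> N.
have [hK ihK ehK] := fin_energy (radius r N + 1).
pose int t := @interior_integral R m n a b r N t (M t) (H t).
pose bd t := boundary_integral A F a b r N t (nu t).
have [mi mb le] : [/\ ae_measurable leb [set` `[a, b]] int, ae_measurable leb [set` `[a, b]] bd &
    (\int[M b]_x (u N (x, b))%:E - \int[M a]_x (u N (x, a))%:E <=
     \int[leb]_(t in `[a, b]) int t + \int[leb]_(t in `[a, b]) bd t)%E].
  apply: (br a b (u N) ab abI (@Ck_test R n m a b r N b0)) => [x t _|].
    exact: test_ge0.
  exists (box (radius r N + 1)); first exact: box_compact.
  move=> x t; rewrite in_itv /= => /andP[at_ tb] /outK xr.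
  by have [] := test_vanish m b at_ xr.
have [C C0 hC] := @test_bounds R n m a b r N b0 r0.
have aeK : {ae leb, forall t, `[a, b]%classic t -> (energy (M t) (H t) (box (radius r N + 1)) < +oo)%E}.
  have := integrable_ae mJ ihK.
  by apply: filterS2 ehK => t e fin tab; rewrite e // ltey_eq fin.
have aeK0 : {ae leb, forall t, `[a, b]%classic t -> (energy (M t) (H t) (box (r + 2 + 1)) < +oo)%E}.
  have := integrable_ae mJ ih0.
  by apply: filterS2 eh0 => t e fin tab; rewrite e // ltey_eq fin.
have bound_int : {ae leb, forall t, `[a, b]%classic t ->
    (`|int t| <= C%:E * energy (M t) (H t) (box (radius r N + 1)))%E}.
  apply: filterS2 fv aeK => t fvt finK tab.
  have := tab; rewrite /= in_itv /= => /andP[at_ tb].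
  have [|_ //] := interior_integral_bound b0 r0 at_ tb (fvt (abI tab)) (finK tab) C0.
  by move=> x h; have [_ h1 _ _] := hC t x at_ tb; exact: h1.
have [i ii ei] : exists2 i, leb.-integrable [set` `[a, b]] i & ae_eq leb [set` `[a, b]] int i.
  pose e (t : R) := (C%:E * energy (M t) (H t) (box (radius r N + 1)))%E.
  apply: (@ae_measurable_dominated _ _ R leb _ int e mJ mi) => //.
    by move=> t _; rewrite /e mule_ge0 ?lee_fin // energy_ge0.
  rewrite (@ae_eq_lower_integral _ _ _ leb _ e (fun t => C%:E * hK t)%E); last first.
    by apply: filterS ehK => t eK tab; rewrite /e eK.
  have iC := integrableZl mJ C ihK.
  by have := integrable_fin_num mJ iC; rewrite fin_numE => /andP[_]; rewrite -ltey.
have fi : (\int[leb]_(t in `[a, b]) i t)%E \is a fin_num by exact: integrable_fin_num.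
(* The interior integral is almost everywhere equal to an integrable function [i] of time, so it can
   be moved across the inequality at a fixed time before integrating. *)
have le_bd : (\int[leb]_(t in `[a, b]) bd t <=
    \int[leb]_(t in `[a, b]) ((c / N.+1%:R)%:E * h0 t - i t) +
    \int[leb]_(t in `[a, b]) swept_rate A F t)%E.
  apply: integral_le_integrable_add => //.
  - by apply: integrableB => //; exact: integrableZl.
  - by move=> t _; exact: swept_rate_ge0.
  near=> t => tab.
  have := tab; rewrite /= in_itv /= => /andP[at_ tb].
  have fvt : first_variation_with_boundary m A (F^~ t) (M t) (H t) (nu t).
    by move: (tab) => /abI; near: t.
  have EK : (energy (M t) (H t) (box (radius r N + 1)) < +oo)%E by move: tab; near: t.
  have EK0 : (energy (M t) (H t) (box (r + 2 + 1)) < +oo)%E by move: tab; near: t.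
  have [ff le_if] := fixed_time_inequality b0 r0 at_ tb fvt EK.
  have fint : int t \is a fin_num.
    have : (`|int t| <= C%:E * energy (M t) (H t) (box (radius r N + 1)))%E by move: tab; near: t.
    rewrite fin_num_abs => /le_lt_trans; apply.
    by rewrite lte_mul_pinfty // lee_fin.
  have <- : int t = i t by move: tab; near: t.
  have <- : energy (M t) (H t) (box (r + 2 + 1)) = h0 t by move: tab; near: t.
  apply: le_trans (boundary_integral_le hm hS hF b0 tb (fun x => rF x at_ tb) fvt ff) _.
  by apply: leeD2r; rewrite leeBrDl.
move: le; rewrite leeBlDr ?test_integral_fin // => /le_trans; apply.
rewrite [X in (X <= _)%E]addeC; apply: leeD2l.
(* The integral of [i] now cancels against the one subtracted in [le_bd]. *)
rewrite (ae_eq_lower_integral ei).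
apply: le_trans (leeD2l _ le_bd) _.
have iZ : leb.-integrable [set` `[a, b]] (fun t => (c / N.+1%:R)%:E * h0 t)%E by exact: integrableZl.
rewrite integralB // integralZl // -(fineK fE0) -(fineK fi) /= -EFinM -EFinB addeA -EFinD.
by rewrite [fine _ + _]addrC subrK mulrAC.
Unshelve. all: by end_near. Qed.

(** At time [a] the cutoff is at most 1, so the initial term is bounded by the full Gaussian area
    for every [N]; at time [b] monotone convergence recovers it. No difference of areas is formed,
    so infinite values do no harm. *)
Lemma Phi_flow_le_add : (Phi_flow m M b <=
  Phi_flow m M a + \int[leb]_(t in `[a, b]) swept_rate A F t)%E.
Proof.
have [d d0 h] := test_flow_inequality.
have Phi_kernel t : t <= b -> Phi_flow m M t = (\int[M t]_x (kernel m b (dot x x) t)%:E)%E.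
  by move=> tb; apply: eq_integral => x _; rewrite kernelE // enorm_sqr.
have le_a N : (\int[M a]_x (u N (x, a))%:E <= Phi_flow m M a)%E.
  rewrite Phi_kernel //; apply: ge0_le_lower_integral => x _; first by rewrite lee_fin test_ge0.
  have /andP[f0 f1] := cutoff_bounds r N (shifted m a (dot x x) a).
  by rewrite lee_fin /test /= ler_piMl // kernel_ge0.
have mono x : nondecreasing_seq (fun N => (u N (x, b))%:E).
  move=> N N' NN'; rewrite lee_fin /test /= ler_wpM2r ?kernel_ge0 //.
  exact: cutoff_nondecreasing.
(* The test function for [N0] lies below those for larger [N], whose error d/(N+1) is arbitrarily
   small; so the error disappears already before the limit in [N0]. *)
have le_b N0 : (\int[M b]_x (u N0 (x, b))%:E <=
    Phi_flow m M a + \int[leb]_(t in `[a, b]) swept_rate A F t)%E.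
  apply: (le_add_harmonic (N0 := N0) d0) => N NN.
  apply: (@le_trans _ _ (\int[M b]_x (u N (x, b))%:E)%E).
    by apply: ge0_le_lower_integral => x _; [rewrite lee_fin test_ge0|exact: mono].
  apply: le_trans (h N) _; rewrite (addeC (d / _)%:E) addeA; apply: leeD2r.
  exact: leeD2r (le_a N).
have cvgu : (\int[M b]_x (u N (x, b))%:E)%E @[N --> \oo] --> Phi_flow m M b.
  rewrite Phi_kernel // (_ : (fun x => _) = fun x => limn (fun N => (u N (x, b))%:E)); last first.
    apply/funext => x; apply/esym/cvg_lim => //; apply/cvg_EFin.
      by near=> N.
    rewrite /test /= -[X in _ --> X]mul1r; apply: cvgMl; exact: cutoff_cvg.
  apply: cvg_monotone_convergence => //.
  - by move=> N; apply/measurable_EFinP; exact: measurable_test.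
  - by move=> N x _; rewrite lee_fin test_ge0.
rewrite -(cvg_lim _ cvgu) //; apply: lime_le; first by apply/cvg_ex; exists (Phi_flow m M b).
by near=> N; exact: le_b.
Unshelve. all: by end_near. Qed.

End TimeIntegration.

Lemma ge0_lower_integral_itv_split {R : realType} (a b c : R) (g : R -> \bar R) :
  a <= b -> b < c -> (forall t, (0 <= g t)%E) ->
  (\int[lebesgue_measure]_(t in `[a, b]) g t + \int[lebesgue_measure]_(t in `[b, c[) g t <=
   \int[lebesgue_measure]_(t in `[a, c[) g t)%E.
Proof.
move=> ab bc g0.
(* The point [b] belongs to both intervals; dropping it from one changes a null set and makes them
   disjoint. *)
have -> : (\int[lebesgue_measure]_(t in `[b, c[) g t = \int[lebesgue_measure]_(t in `]b, c[) g t)%E.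
  rewrite integral_mkcond [RHS]integral_mkcond; apply: ae_eq_lower_integral.
  exists [set b]; split; [exact: measurable_set1|exact: lebesgue_measure_set1|].
  move=> t /=; apply: contra_notP => /eqP tb _; rewrite /patch !mem_setE !in_itv /=.
  by rewrite le_eqVlt eq_sym (negbTE tb).
rewrite (_ : [set` `[a, c[] = [set` `[a, b]] `|` [set` `]b, c[]); last first.
  by apply/seteqP; split => t /=; rewrite !in_itv /=; case: (leP t b) => tb; lra.
apply: ge0_lower_integral_setU => //.
by apply/disj_setPS => t [] /=; rewrite !in_itv /=; lra.
Qed.

Theorem theorem6 (R : realType) (m n : nat) (hm : (0 < m)%N)
    (S : topologicalType) (A : set (chart R m.-1 S)) (hS : closed_manifold A)
    (F : S -> R -> 'rV[R]_n)
    (hF : smooth_family_of_embeddings A `]-oo, 0[ F)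
    (M : R -> {measure set (borelRn R n) -> \bar R})
    (hM : brakke_flow m A `]-oo, 0[ F M) :
  forall s t : R, s <= t -> t < 0 ->
    (Phi_flow m M t + Phi_swept m A (rescaled F) t <=
     Phi_flow m M s + Phi_swept m A (rescaled F) s)%E.
Proof.
move=> s t st t0.
have [r0 r00 hr] := family_bounded hS hF s t0.
(* [r0] bounds |x|^2 on the boundary between the two times, and the shift 2 m (z - s) adds at most 2
   m (t - s); so the cutoff is 1 on the whole boundary. *)
pose r := r0 + 2 * m%:R * (t - s).
have r_ge0 : 0 <= r by rewrite addr_ge0 // mulr_ge0 ?subr_ge0.
have rF x z : s <= z -> z <= t -> shifted m s (dot (F x z) (F x z)) z <= r.
  by move=> sz zt; apply: lerD; [exact: hr|rewrite ler_wpM2l // lerB].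
have le := Phi_flow_le_add hm hS hF hM t0 st r_ge0 rF.
apply: le_trans (leeD2r _ le) _; rewrite -addeA; apply: leeD2l.
exact: (ge0_lower_integral_itv_split st t0 (swept_rate_ge0 A F)).
Qed.
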